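(* Let $\mathbf k$ be a field and $A$ a (unital) graded $\mathbf k$-algebra. The isomorphism of graded algebras $$H^{\bullet,*}(\kappa)\colon\operatorname{HH}^{\bullet,*}(A|A)\xrightarrow{\ \sim\ }\operatorname{HH}^{\bullet,*}(A)[\varepsilon]/(\varepsilon^2),\qquad|\varepsilon|=(1,0),$$ induces a shifted Lie bracket and a Gerstenhaber square operation on $\operatorname{HH}^{\bullet,*}(A)[\varepsilon]/(\varepsilon^2)$, and hence an isomorphic Gerstenhaber algebra structure. Moreover, the following statements hold: (1) The induced shifted Lie bracket extends the Gerstenhaber bracket on the shifted graded Lie subalgebra $\operatorname{HH}^{\bullet,*}(A)\subseteq\operatorname{HH}^{\bullet,*}(A)[\varepsilon]/(\varepsilon^2)$ and is uniquely determined by the following additional requirements: $$[\varepsilon,\varepsilon]=0,\qquad[c,\varepsilon]=0,\quad c\in\operatorname{HH}^{\bullet,*}(A).$$ From these it follows that, for all $c_1,c_2\in\operatorname{HH}^{\bullet,*}(A)$, $$[c_1,c_2\cdot\varepsilon]=[c_1,c_2]\cdot\varepsilon,\qquad[c_1\cdot\varepsilon,c_2\cdot\varepsilon]=0.$$ (2) If $\operatorname{char}(\mathbf k)=2$, then the induced Gerstenhaber square extends the Gerstenhaber square on $\operatorname{HH}^{\bullet,*}(A)$ and is more generally given by the formula $$\operatorname{Sq}(c_1+c_2\cdot\varepsilon)=\operatorname{Sq}(c_1)+(c_2^2+[c_1,c_2])\cdot\varepsilon,\qquad c_1,c_2\in\operatorname{HH}^{\bullet,*}(A).$$ If $\operatorname{char}(\mathbf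 k)\neq2$, then the Gerstenhaber square is given in even total degrees by $\operatorname{Sq}(x)=\tfrac12[x,x]$.
   Context: **Compositions.** For multilinear maps $c_1$ with $p$ inputs and $c_2$ with $s$ inputs and degree $t$, let $(c_1\bullet_ic_2)(x_1,\dots,x_{p+s-1})=(-1)^{(s-1)(p-i)+t(p-1+\sum_{j<i}|x_j|)}c_1(x_1,\dots,x_{i-1},c_2(x_i,\dots,x_{i+s-1}),x_{i+s},\dots)$ if the output of $c_2$ is of the same type (algebra or bimodule) as the $i$-th input of $c_1$, and $0$ otherwise (the algebra $A$ and the bimodule $A$ are regarded as distinct types). Put $c_1\{c_2\}=\sum_ic_1\bullet_ic_2$ and, for $m$ a binary operation of degree $0$ and $c_1$ with $p$ inputs, $m\{c_1,c_2\}=(m\bullet_1c_1)\bullet_{p+1}c_2$. **Hochschild complex.** $C^{p,q}(A)$ is the space of degree $q$ linear maps $A^{\otimes p}\to A$ (bidegree $(p,q)$, total degree $p+q$). With $m_2$ the product of $A$: bracket $[c_1,c_2]=c_1\{c_2\}-(-1)^{(|c_1|-1)(|c_2|-1)}c_2\{c_1\}$, square $\operatorname{Sq}(c)=c\{c\}$ (if $\operatorname{char}\mathbf k=2$ or $|c|$ even), differential $[m_2,-]$, cup product $c_1\cdot c_2=(-1)^{|c_1|-1}m_2\{c_1,c_2\}$. The cohomology $\operatorname{HH}^{\bullet,*}(A)$ is a Gerstenhaber algebra with respect to the total degree. **Bimodule Hochschild complex of the diagonal bimodule.** $C^{p,q,r}_{A^e}(A)$ is the space of degree $r$ maps $A^{\otimes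 p}\otimes A\otimes A^{\otimes q}\to A$ with middle input and output in the diagonal bimodule; $C^{n,r}(A|A)=C^{n,r}(A)\oplus\bigoplus_{p+q=n-1}C^{p,q,r}_{A^e}(A)$, with horizontal degree $n$ = number of inputs and total degree $|c|=n+r$. Bracket and $\operatorname{Sq}$ are given by the same formulas; the differential is $[m_2^{A\ltimes A},-]$ and the cup product is $c_1\cdot c_2=(-1)^{|c_1|-1}m_2^{A\ltimes A}\{c_1,c_2\}$, where $m_2^{A\ltimes A}\in C^{2,0}(A|A)$ is the sum of the product of $A$ and the left and right action maps of the diagonal bimodule. Its cohomology $\operatorname{HH}^{\bullet,*}(A|A)$ is a Gerstenhaber algebra with respect to the total degree. **Gerstenhaber algebra.** A graded-commutative algebra with a degree $-1$ (shifted) Lie bracket satisfying $[x,yz]=[x,y]z+(-1)^{(|x|-1)|y|}y[x,z]$ and, in characteristic $2$, an operation $\operatorname{Sq}$ with $|\operatorname{Sq}(x)|=2|x|-1$, $\operatorname{Sq}(x+y)=\operatorname{Sq}(x)+\operatorname{Sq}(y)+[x,y]$, $\operatorname{Sq}(xy)=\operatorname{Sq}(x)y^2+x[x,y]y+x^2\operatorname{Sq}(y)$, $[\operatorname{Sq}(x),y]=[x,[x,y]]$. **The map $\kappa$.** $C^{\bullet,*}(A)[\varepsilon]=C^{\bullet,*}(A)\oplus C^{\bullet,*}(A)\cdot\varepsilon$ with $\varepsilon$ of bidegree $(1,0)$, $\varepsilon^2=0$, $\varepsilon\cdot c=(-1)^{|c|}c\cdot\varepsilon$, $d(\varepsilon)=0$,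 $d(c\cdot\varepsilon)=d(c)\cdot\varepsilon$; its cohomology is $\operatorname{HH}^{\bullet,*}(A)[\varepsilon]/(\varepsilon^2)$. The map $\kappa\colon C^{\bullet,*}(A|A)\to C^{\bullet,*}(A)[\varepsilon]$ is the identity on $C^{\bullet,*}(A)$ and sends $c\in C^{p,q,r}_{A^e}(A)$ to $(c\bullet_{p+1}1_A)\cdot\varepsilon$, i.e. to $\varepsilon$ multiplied by the cochain $(x_1,\dots,x_{p+q})\mapsto(-1)^qc(x_1,\dots,x_p,1_A,x_{p+1},\dots,x_{p+q})$. It is a quasi-isomorphism of dg algebras with respect to the total degree. *)

(* Defs.v *)
From HB Require Import structures.
From mathcomp Require Import all_boot all_order all_algebra.
From mathcomp Require Import boolp classical_sets functions cardinality fsbigop.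

Set Implicit Arguments.
Unset Strict Implicit.
Unset Printing Implicit Defensive.

Import GRing.Theory.
Local Open Scope ring_scope.

(* A unital Z-graded k-algebra. The product and the unit are fields of the    *)
(* structure, instead of being inherited from algType, because an algType has *)
(* 1 != 0 and the zero algebra must not be excluded. The grading is given by  *)
(* its projections: hcomp i x is the component of degree i of x.              *)
HB.mixin Record isGradedAlgebra (k : fieldType) A of GRing.Lmodule k A := {
  amul : A -> A -> A;
  aone : A;
  amulA : associative amul;
  amul1 : left_id aone amul;
  amulr1 : right_id aone amul;
  amul_linearl : forall y, linear (fun x => amul x y);
  amul_linearr : forall x, linear (amul x);
  hcomp : int -> A -> A;
  hcomp_linear : forall i, linear (hcomp i);
  hcompK : forall i j x,
    hcomp i (hcomp j x) = if i == j then hcomp j x else 0;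
  hcomp_finite : forall x, finite_set [set i | hcomp i x != 0];
  hcomp_sum : forall x, \sum_(i \in [set: int]) hcomp i x = x;
  hcomp_one : hcomp 0 aone = aone;
  hcomp_mul : forall i j x y,
    hcomp (i + j) (amul (hcomp i x) (hcomp j y)) = amul (hcomp i x) (hcomp j y)
}.

#[short(type="gradedAlgType")]
HB.structure Definition GradedAlgebra (k : fieldType) :=
  { A of isGradedAlgebra k A & GRing.Lmodule k A }.

Section Cohomology.
Variables (k : fieldType) (V : lmodType k) (S : submodClosed V).
Variable d : V -> V.
Hypothesis d_linear :
  forall a, {in S &, forall u v, d (a *: u + v) = a *: d u + d v}.

Definition is_cocycle : {pred V} := [pred v | (v \in S) && (d v == 0)].

Let d0 : d 0 = 0.
Proof.
have := d_linear (-1) (rpred0 S) (rpred0 S).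
by rewrite !scaleN1r oppr0 addr0 addNr.
Qed.

Fact is_cocycle_submod : submod_closed is_cocycle.
Proof.
split; first by rewrite inE rpred0 d0 eqxx.
move=> a u v; rewrite !inE => /andP[uS /eqP du] /andP[vS /eqP dv].
by rewrite rpredD ?rpredZ //= d_linear // du dv scaler0 addr0.
Qed.

HB.instance Definition _ :=
  GRing.isSubmodClosed.Build k V is_cocycle is_cocycle_submod.

Record cocycle := Cocycle { cocycle_val :> V; _ : cocycle_val \in is_cocycle }.

HB.instance Definition _ := [isSub for cocycle_val].
HB.instance Definition _ := [Choice of cocycle by <:].
HB.instance Definition _ := [SubChoice_isSubLmodule of cocycle by <:].

Definition is_coboundary : {pred cocycle} :=
  [pred z | `[< exists2 b, b \in S & val z = d b >]].

Fact is_coboundary_submod : submod_closed is_coboundary.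
Proof.
split; first by apply/asboolP; exists 0; rewrite ?rpred0 ?d0.
move=> a u v /asboolP[b bS ub] /asboolP[c cS vc]; apply/asboolP.
exists (a *: b + c); first by rewrite rpredD ?rpredZ.
by rewrite d_linear // -ub -vc linearP.
Qed.

HB.instance Definition _ :=
  GRing.isSubmodClosed.Build k cocycle is_coboundary is_coboundary_submod.

Definition cohom := Quotient.quot is_coboundary.

HB.instance Definition _ := GRing.Zmodule.on cohom.
HB.instance Definition _ := EqQuotient.on cohom.

Definition cohom_scale (a : k) (x : cohom) : cohom := \pi_cohom%qT (a *: repr x).

Fact pi_cohom_scale a z : cohom_scale a (\pi_cohom z)%qT = (\pi_cohom (a *: z))%qT.
Proof.
apply/eqP; rewrite /cohom_scale -Quotient.idealrBE -scalerBr rpredZ //.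
by rewrite Quotient.idealrBE reprK.
Qed.

Fact pi_cohomD x y :
  (\pi_cohom x)%qT + (\pi_cohom y)%qT = (\pi_cohom (x + y))%qT :> cohom.
Proof. exact: (esym (Quotient.pi_add _ x y)). Qed.

Fact cohom_scalerA a b v :
  cohom_scale a (cohom_scale b v) = cohom_scale (a * b) v.
Proof.
elim/quotW: v => v.
by rewrite (pi_cohom_scale b) !(pi_cohom_scale _ v) pi_cohom_scale scalerA.
Qed.

Fact cohom_scale1r : left_id 1 cohom_scale.
Proof. by elim/quotW=> v; rewrite pi_cohom_scale scale1r. Qed.

Fact cohom_scalerDr : right_distributive cohom_scale +%R.
Proof.
move=> a; elim/quotW=> u; elim/quotW=> v.
by rewrite pi_cohomD (pi_cohom_scale _ u) (pi_cohom_scale _ v) pi_cohomD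
  pi_cohom_scale scalerDr.
Qed.

Fact cohom_scalerDl v : {morph cohom_scale^~ v : a b / a + b}.
Proof.
elim/quotW: v => v a b.
by rewrite !(pi_cohom_scale _ v) pi_cohomD scalerDl.
Qed.

HB.instance Definition _ := GRing.Zmodule_isLmodule.Build k cohom
  cohom_scalerA cohom_scale1r cohom_scalerDr cohom_scalerDl.

Definition rep (x : cohom) : V := val (repr x).
(* The class of a cocycle, and 0 if v is not a cocycle. *)
Definition cls (v : V) : cohom := \pi_cohom%qT (insubd (0 : cocycle) v).

End Cohomology.

Section Cochains.
Variables (k : fieldType) (A : gradedAlgType k).

Definition homog (i : int) (x : A) : Prop := hcomp i x = x.

(* x |-> (-1)^(t |x|) x, extended linearly to nonhomogeneous x. *)
Definition koszul (t : int) (x : A) : A :=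
  \sum_(i \in [set: int]) (-1) ^ (t * i) *: hcomp i x.

(* The inputs are elements of A tagged by their type, false for the algebra   *)
(* and true for the bimodule. On a list of inputs the value of a map is in    *)
(* the bimodule if one of the inputs is, and in the algebra otherwise.        *)
Definition input : Type := (bool * A)%type.
Definition mmap : Type := seq input -> A.

(* c q is the part of degree q of c; its restriction to the lists of length p *)
(* is the component of bidegree (p, q) of c. On lists of length p without     *)
(* true tags this component is in C^{p,q}(A), and on those whose only true    *)
(* tag is at position i (from 0) it is in C^{i,p-1-i,q}_{A^e}(A).             *)
Definition cochain : Type := int -> mmap.

HB.instance Definition _ := GRing.Lmodule.on cochain.

Definition multilinear_cochain (c : cochain) : Prop :=
  forall q (l r : seq input) b a u v,
    c q (l ++ (b, a *: u + v) :: r) =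
    a *: c q (l ++ (b, u) :: r) + c q (l ++ (b, v) :: r).

Definition degree_cochain (c : cochain) : Prop :=
  forall q (x : seq (int * input)),
    (forall u, u \in x -> homog u.1 u.2.2) ->
    homog (\sum_(u <- x) u.1 + q) (c q [seq u.2 | u <- x]).

Definition typed_cochain (c : cochain) : Prop :=
  forall q (x : seq input), (1 < count fst x)%N -> c q x = 0.

Definition finite_cochain (c : cochain) : Prop :=
  exists N : nat, forall q (x : seq input),
    c q x != 0 -> (size x <= N)%N && (`|q| <= N)%N.

Definition algebra_cochain (c : cochain) : Prop :=
  forall q (x : seq input), has fst x -> c q x = 0.

(* C(A|A) is the direct sum of all the C^{n,r}(A|A). *)
Definition bim_cochains : {pred cochain} :=
  [pred c | `[< [/\ multilinear_cochain c, degree_cochain c,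
                    typed_cochain c & finite_cochain c] >]].

(* C(A), a graded subspace (not a subcomplex) of C(A|A). *)
Definition alg_cochains : {pred cochain} :=
  [pred c | (c \in bim_cochains) && `[< algebra_cochain c >]].

Fact bim_cochains_submod : submod_closed bim_cochains.
Proof.
split.
  apply/asboolP; split=> //.
  - by move=> q l r b a u v; rewrite scaler0 addr0.
  - move=> q x _; rewrite /homog.
    have /= := hcomp_linear (\sum_(u <- x) u.1 + q) (-1) (0 : A) 0.
    by rewrite !scaleN1r oppr0 addr0 addNr.
  - by exists 0%N => q x; rewrite eqxx.
move=> a c e /asboolP[cl cd ct [N cN]] /asboolP[el ed et [M eM]].
apply/asboolP; split.
- move=> q l r b a' u v; rewrite /= !fctE /= cl el !scalerDr !scalerA.
  by rewrite [a' * a]mulrC addrACA.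
- by move=> q x hx; rewrite /homog /= hcomp_linear cd // ed.
- by move=> q x hx; rewrite /= !fctE /= ct // et // scaler0 addr0.
exists (maxn N M) => q x; rewrite /= !fctE /=.
have [-> | /cN /andP[sN qN] _] := eqVneq (c q x) 0; last first.
  by rewrite !leq_max sN qN.
by rewrite scaler0 add0r => /eM /andP[sM qM]; rewrite !leq_max sM qM !orbT.
Qed.

HB.instance Definition _ :=
  GRing.isSubmodClosed.Build k cochain bim_cochains bim_cochains_submod.

Fact alg_cochains_submod : submod_closed alg_cochains.
Proof.
split; first by apply/andP; split; [exact: rpred0 | exact/asboolP].
move=> a c e /andP[cS /asboolP ca] /andP[eS /asboolP ea].
apply/andP; split; first by apply: rpredD => //; apply: rpredZ.
by apply/asboolP => q x hx; rewrite /= !fctE /= ca // ea // scaler0 addr0.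
Qed.

HB.instance Definition _ :=
  GRing.isSubmodClosed.Build k cochain alg_cochains alg_cochains_submod.

(* f .i g for f with p inputs, and g with s inputs and degree t. The Koszul   *)
(* sign of the inputs on the left of g is in koszul. Tagging the value of g   *)
(* with its type selects the components of f whose i-th input has this type.  *)
Definition circ (p s : nat) (t : int) (i : nat) (f g : mmap) : mmap := fun x =>
  let l := take i.-1 x in
  let m := take s (drop i.-1 x) in
  let r := drop (i.-1 + s) x in
  (-1) ^ ((s%:Z - 1) * (p%:Z - i%:Z) + t * (p%:Z - 1)) *:
    f ([seq (u.1, koszul t u.2) | u <- l] ++ (has fst m, g m) :: r).

(* sum_i c1 .i c2, the composite of the component of bidegree (p, q) of c1    *)
(* with the component of bidegree (s, t) of c2 being multiplied by w p q s t; *)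
(* it has p + s - 1 inputs and degree q + t.                                  *)
Definition wbrace (w : nat -> int -> nat -> int -> k) (c1 c2 : cochain) :
    cochain := fun q x =>
  let n := size x in
  \sum_(s < n.+1) \sum_(1 <= i < (n.+1 - s).+1) \sum_(t \in [set: int])
    w (n.+1 - s)%N (q - t) s t *:
      circ (n.+1 - s) s t i (c1 (q - t)) (c2 t) x.

Definition brace : cochain -> cochain -> cochain := wbrace (fun _ _ _ _ => 1).

(* c1{c2} - (-1)^((|c1|-1)(|c2|-1)) c2{c1}, extended bilinearly. *)
Definition bracket (c1 c2 : cochain) : cochain :=
  brace c1 c2 -
  wbrace (fun p q s t => (-1) ^ ((p%:Z + q - 1) * (s%:Z + t - 1))) c2 c1.

(* Sq(c) = c{c} is defined for even |c| only, except in characteristic 2. A   *)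
(* nonhomogeneous representative of a class of even degree may have an odd    *)
(* part, which is a coboundary and has to be discarded.                       *)
Definition even_part (c : cochain) : cochain := fun q x =>
  if (2 %| (size x)%:Z + q)%Z then c q x else 0.
Definition sq_cochain (c : cochain) : cochain :=
  if (2 \in [pchar k])%N then brace c c else brace (even_part c) (even_part c).

(* (-1)^(|c1|-1) m{c1,c2}, extended bilinearly, for m of bidegree (2, 0). *)
Definition cup (m c1 c2 : cochain) : cochain := fun q x =>
  let n := size x in
  \sum_(p < n.+1) \sum_(t \in [set: int])
    (-1) ^ (p%:Z + (q - t) - 1) *:
      circ p.+1 (n - p) t p.+1
        (circ 2 p (q - t) 1 (m 0) (c1 (q - t))) (c2 t) x.

Definition unit_cochain : cochain := fun q x =>
  if x is [::] then aone *+ (q == 0) else 0.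

Definition product_cochain (ok : rel bool) : cochain := fun q x =>
  if x is [:: u; v] then amul u.2 v.2 *+ ((q == 0) && ok u.1 v.1) else 0.

Definition alg_m2 : cochain := product_cochain (fun u v => ~~ u && ~~ v).

(* The product of A plus the two actions on the diagonal bimodule. *)
Definition bim_m2 : cochain := product_cochain (fun u v => ~~ (u && v)).

Definition sign_cochain (c : cochain) : cochain := fun q x =>
  (-1) ^ ((size x)%:Z + q) *: c q x.

Definition of_bidegree (p q : int) (c : cochain) : Prop :=
  forall r x, c r x != 0 -> (size x)%:Z = p /\ r = q.

Definition of_degree (n : int) (c : cochain) : Prop :=
  forall r x, c r x != 0 -> (size x)%:Z + r = n.

(* kappa c = kappa0 c + kappa1 c . eps *)
Definition kappa0 (c : cochain) : cochain := fun q x =>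
  if has fst x then 0 else c q x.

Definition kappa1 (c : cochain) : cochain := fun q x =>
  if has fst x then 0 else
  \sum_(p < (size x).+1)
    (-1) ^+ (size x - p) *: c q (take p x ++ (true, aone) :: drop p x).

End Cochains.

Arguments bim_cochains {k} A.
Arguments alg_cochains {k} A.
Arguments unit_cochain {k} A.
Arguments alg_m2 {k} A.
Arguments bim_m2 {k} A.

Section Differential.
Variables (k : fieldType) (A : gradedAlgType k).

Fact fsum_unique (V : lmodType k) (t0 : int) (F : int -> V) :
  (forall t, t != t0 -> F t = 0) -> \sum_(t \in [set: int]) F t = F t0.
Proof.
move=> F0; rewrite -(@fsbig_widen _ _ _ _ [set t0] setT) ?fsbig_set1 //.
by move=> t [_ /= tt0]; apply: F0; apply/eqP.
Qed.

Definition bilinear_at0 (m : cochain A) :=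
  (forall t x, t != 0 -> m t x = 0) /\
  (forall l r b, linear (fun u : A => m 0 (l ++ (b, u) :: r))).

Fact wbrace_linearr w (m : cochain A) : bilinear_at0 m -> linear (wbrace w m).
Proof.
move=> [m0 ml] a c e; apply/funext => q; apply/funext => x.
rewrite !fctE /wbrace /= scaler_sumr -big_split /=.
apply: eq_bigr => s _; rewrite scaler_sumr -big_split /=.
apply: eq_bigr => i _; set n := (_ - _)%N.
have sum_at (g : cochain A) :
    \sum_(t \in [set: int]) w n (q - t) s t *: circ n s t i (m (q - t)) (g t) x
    = w n 0 s q *: circ n s q i (m 0) (g q) x.
  rewrite (@fsum_unique _ q) ?subrr // => t tq.
  by rewrite /circ m0 ?scaler0 // subr_eq0 eq_sym.
rewrite !sum_at /circ ml !scalerDr !scalerA; congr (_ *: _ + _).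
by rewrite mulrC mulrA.
Qed.

Fact wbrace_linearl w (m : cochain A) a :
  bilinear_at0 m -> {in bim_cochains A &, forall c e,
    wbrace w (a *: c + e) m = a *: wbrace w c m + wbrace w e m}.
Proof.
move=> [m0 ml] c e cS eS; apply/funext => q; apply/funext => x.
rewrite !fctE /wbrace /= scaler_sumr -big_split /=.
apply: eq_bigr => s _; rewrite scaler_sumr -big_split /=.
apply: eq_bigr => i _; set n := (_ - _)%N.
have sum_at (g : cochain A) : g \in bim_cochains A ->
    \sum_(t \in [set: int]) w n (q - t) s t *: circ n s t i (g (q - t)) (m t) x
    = w n q s 0 *: circ n s 0 i (g q) (m 0) x.
  move=> /asboolP[gl _ _ _]; rewrite (@fsum_unique _ 0) ?subr0 // => t t0.
  have g0 l b r : g (q - t) (l ++ (b, 0) :: r) = 0.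
    by have := gl (q - t) l r b (-1) 0 0; rewrite !scaleN1r oppr0 addr0 addNr.
  by rewrite /circ m0 // g0 !scaler0.
have acS : a *: c + e \in bim_cochains A by apply: rpredD => //; apply: rpredZ.
have := sum_at _ acS; rewrite !fctE /= => ->; rewrite !sum_at // /circ.
rewrite !scalerDr !scalerA; congr (_ *: _ + _).
by rewrite mulrC mulrA.
Qed.

Fact bracket_linear (m : cochain A) a :
  bilinear_at0 m -> {in bim_cochains A &, forall c e,
    bracket m (a *: c + e) = a *: bracket m c + bracket m e}.
Proof.
move=> m2 c e cS eS; rewrite /bracket /brace wbrace_linearr // wbrace_linearl //.
by rewrite scalerBr opprD addrACA.
Qed.

Fact product_cochain_bilinear ok : bilinear_at0 (@product_cochain k A ok).
Proof.
split=> [t [|u [|v [|? ?]]] t0 //=|l r b a u v].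
  by rewrite (negbTE t0).
case: l => [|x [|y [|z l]]]; case: r => [|x' [|y' r]];
  rewrite /= ?scaler0 ?addr0 //.
- by rewrite amul_linearl /=; case: (ok _ _); rewrite ?scaler0 ?addr0.
- by rewrite amul_linearr /=; case: (ok _ _); rewrite ?scaler0 ?addr0.
Qed.

Definition alg_d : cochain A -> cochain A := bracket (alg_m2 A).
Definition bim_d : cochain A -> cochain A := bracket (bim_m2 A).

Fact alg_d_linear a : {in alg_cochains A &, forall c e,
  alg_d (a *: c + e) = a *: alg_d c + alg_d e}.
Proof.
move=> c e /andP[cS _] /andP[eS _].
by apply: bracket_linear => //; apply: product_cochain_bilinear.
Qed.

Fact bim_d_linear a : {in bim_cochains A &, forall c e,
  bim_d (a *: c + e) = a *: bim_d c + bim_d e}.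
Proof. by apply: bracket_linear; apply: product_cochain_bilinear. Qed.

End Differential.

Definition HH (k : fieldType) (A : gradedAlgType k) : lmodType k :=
  cohom (@alg_d_linear k A).
Definition HHbim (k : fieldType) (A : gradedAlgType k) : lmodType k :=
  cohom (@bim_d_linear k A).

(* The operations below are evaluated on chosen cocycle representatives; the  *)
(* classes obtained do not depend on this choice.                             *)
Section CohomologyOperations.
Variables (k : fieldType) (A : gradedAlgType k).
Variables (S : submodClosed (cochain A)) (d : cochain A -> cochain A).
Hypothesis d_linear :
  forall a, {in S &, forall u v, d (a *: u + v) = a *: d u + d v}.
Variable m : cochain A.
Local Notation H := (cohom d_linear).

Definition coh_bidegree (p q : int) (x : H) : Prop :=
  exists z, [/\ z \in is_cocycle S d, of_bidegree p q z & x = cls d_linear z].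
Definition coh_degree (n : int) (x : H) : Prop :=
  exists z, [/\ z \in is_cocycle S d, of_degree n z & x = cls d_linear z].

Definition coh_one : H := cls d_linear (unit_cochain A).
Definition coh_mul (x y : H) : H := cls d_linear (cup m (rep x) (rep y)).
Definition coh_bracket (x y : H) : H :=
  cls d_linear (bracket (rep x) (rep y)).
Definition coh_sq (x : H) : H := cls d_linear (sq_cochain (rep x)).
(* x |-> (-1)^|x| x *)
Definition coh_sign (x : H) : H := cls d_linear (sign_cochain (rep x)).

End CohomologyOperations.

Section GerstenhaberAlgebras.
Variables (k : fieldType) (E : lmodType k).
Variables (deg : int -> E -> Prop) (one : E) (mul br : E -> E -> E).
Variable sq : E -> E.

Local Notation sgn n := ((-1 : k) ^ (n : int)).

Definition bilinear_op (op : E -> E -> E) : Prop :=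
  (forall y, linear (fun x => op x y)) /\ (forall x, linear (op x)).

(* E is the direct sum of the subspaces deg n. *)
Definition graded_space : Prop :=
  [/\ forall n, deg n 0 /\
        (forall a x y, deg n x -> deg n y -> deg n (a *: x + y)),
      forall x, exists f : int -> E,
        [/\ forall n, deg n (f n), finite_set [set n | f n != 0]
          & x = \sum_(n \in [set: int]) f n]
    & forall f : int -> E, (forall n, deg n (f n)) ->
        finite_set [set n | f n != 0] ->
        \sum_(n \in [set: int]) f n = 0 -> forall n, f n = 0].

Definition graded_comm_algebra : Prop :=
  [/\ graded_space,
      bilinear_op mul /\
      (forall m n x y, deg m x -> deg n y -> deg (m + n) (mul x y)),
      associative mul,
      [/\ deg 0 one, left_id one mul & right_id one mul]
    & forall m n x y, deg m x -> deg n y -> mul x y = sgn (m * n) *: mul y x].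

(* A graded Lie bracket for the degree |x| - 1. The last two conditions are   *)
(* part of the notion in characteristic 2 and 3, where they do not follow     *)
(* from antisymmetry and the Jacobi identity.                                 *)
Definition shifted_lie_bracket : Prop :=
  [/\ bilinear_op br /\
      (forall m n x y, deg m x -> deg n y -> deg (m + n - 1) (br x y)),
      forall m n x y, deg m x -> deg n y ->
        br x y = - (sgn ((m - 1) * (n - 1)) *: br y x),
      forall l m n x y z, deg l x -> deg m y -> deg n z ->
        br x (br y z) = br (br x y) z + sgn ((l - 1) * (m - 1)) *: br y (br x z),
      forall n x, deg n x -> ~~ (2 %| n)%Z -> br x x = 0
    & forall n x, deg n x -> (2 %| n)%Z -> br x (br x x) = 0].

Definition gerstenhaber_bracket : Prop :=
  shifted_lie_bracket /\
  forall l m n x y z, deg l x -> deg m y -> deg n z ->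
    br x (mul y z) = mul (br x y) z + sgn ((l - 1) * m) *: mul y (br x z).

Definition gerstenhaber_square : Prop :=
  [/\ forall n x, deg n x -> deg (2 * n - 1) (sq x),
      forall n x y, deg n x -> deg n y -> sq (x + y) = sq x + sq y + br x y,
      forall m n x y, deg m x -> deg n y ->
        sq (mul x y) = mul (sq x) (mul y y) + mul (mul x (br x y)) y
                       + mul (mul x x) (sq y)
    & forall m n x y, deg m x -> deg n y -> br (sq x) y = br x (br x y)].

Definition gerstenhaber_algebra : Prop :=
  [/\ graded_comm_algebra, gerstenhaber_bracket
    & (2 \in [pchar k])%N -> gerstenhaber_square].

End GerstenhaberAlgebras.

Section Kappa.
Variables (k : fieldType) (A : gradedAlgType k).

Definition hh_bidegree : int -> int -> HH A -> Prop :=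
  @coh_bidegree k A _ _ (@alg_d_linear k A).
Definition hh_degree : int -> HH A -> Prop :=
  @coh_degree k A _ _ (@alg_d_linear k A).
Definition hh_one : HH A := coh_one (@alg_d_linear k A).
Definition hh_mul : HH A -> HH A -> HH A := coh_mul (alg_m2 A).
Definition hh_bracket : HH A -> HH A -> HH A := @coh_bracket k A _ _ _.
Definition hh_sq : HH A -> HH A := @coh_sq k A _ _ _.
Definition hh_sign : HH A -> HH A := @coh_sign k A _ _ _.

Definition hhbim_bidegree : int -> int -> HHbim A -> Prop :=
  @coh_bidegree k A _ _ (@bim_d_linear k A).
Definition hhbim_degree : int -> HHbim A -> Prop :=
  @coh_degree k A _ _ (@bim_d_linear k A).
Definition hhbim_one : HHbim A := coh_one (@bim_d_linear k A).
Definition hhbim_mul : HHbim A -> HHbim A -> HHbim A := coh_mul (bim_m2 A).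
Definition hhbim_bracket : HHbim A -> HHbim A -> HHbim A :=
  @coh_bracket k A _ _ _.
Definition hhbim_sq : HHbim A -> HHbim A := @coh_sq k A _ _ _.

(* HH(A)[eps]/(eps^2); the pair (x, y) is x + y . eps. *)
Definition HHeps : lmodType k := (HH A * HH A)%type.

Definition eps : HHeps := (0, hh_one).
Definition heps_one : HHeps := (hh_one, 0).
(* By eps . y = (-1)^|y| y . eps, the product (x' . eps) y is                 *)
(* (x' (-1)^|y| y) . eps.                                                     *)
Definition heps_mul (x y : HHeps) : HHeps :=
  (hh_mul x.1 y.1, hh_mul x.1 y.2 + hh_mul x.2 (hh_sign y.1)).
Definition heps_bidegree (p q : int) (x : HHeps) : Prop :=
  hh_bidegree p q x.1 /\ hh_bidegree (p - 1) q x.2.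
Definition heps_degree (n : int) (x : HHeps) : Prop :=
  hh_degree n x.1 /\ hh_degree (n - 1) x.2.

Definition Hkappa (x : HHbim A) : HHeps :=
  (cls (@alg_d_linear k A) (kappa0 (rep x)),
   cls (@alg_d_linear k A) (kappa1 (rep x))).

Definition Hkappa_inv (y : HHeps) : HHbim A := xget 0 [set x | Hkappa x = y].

(* The operations induced on HH(A)[eps]/(eps^2) by the bijection Hkappa. *)
Definition heps_bracket (x y : HHeps) : HHeps :=
  Hkappa (hhbim_bracket (Hkappa_inv x) (Hkappa_inv y)).
Definition heps_sq (x : HHeps) : HHeps := Hkappa (hhbim_sq (Hkappa_inv x)).

End Kappa.

Arguments eps {k} A.
Arguments heps_one {k} A.
Arguments hhbim_one {k} A.
Arguments hh_degree {k} A.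
Arguments heps_degree {k} A.

(* Main.v *)
Require Import Defs.
From HB Require Import structures.
From mathcomp Require Import all_boot all_order all_algebra.
From mathcomp Require Import boolp classical_sets functions cardinality fsbigop.
From mathcomp Require Import ring zify.

Set Implicit Arguments.
Unset Strict Implicit.
Unset Printing Implicit Defensive.

Import GRing.Theory.
Local Open Scope ring_scope.

(** Every cochain c of A extends to a cochain of the pair that also allows one
    input in the bimodule, because the diagonal bimodule is A itself ([extend]).
    This is a section of the first component of kappa, and it preserves braces
    and cup products. Let E be the identity map of the bimodule ([module_id]),
    a cocycle of bidegree (1, 0) whose image under kappa is eps. Three facts
    about E carry the proof. It is central for the bracket, since c{E} and E{c}
    both count the inputs of bimodule type, of which there is at most one
    ([bracket_module_id]). Its cup square vanishes, for want of an output with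
    two such inputs. And E{E} = E, so that Sq(eps) = eps.

    The maps kappa0 and kappa1 commute with the differentials and turn the cup
    product into the product of C(A)[eps]; for kappa1 this is a computation of
    what happens when the unit of the bimodule is inserted into a product
    ([kappa1_d], [kappa1_cup]). On extended cocycles kappa1 is the bracket with
    the unit ([kappa1_extend]), which is exact by the Leibniz rule
    [x, 1 . 1] = [x, 1] + [x, 1]. Conversely, inserting the unit of the bimodule
    on the left of the input of bimodule type, and moving this input to the
    algebra, is a homotopy between c and the product of kappa1 c by E, for
    cocycles c that vanish on inputs of the algebra ([homotopy_d]). Hence a class
    of the pair can be written uniquely as x + y . E with x and y extended, and
    H(kappa) is bijective ([Hkappa_inj], [Hkappa_sectionK]).

    The induced operations can now be read off. The Leibniz rule, antisymmetry,
    [c, eps] = 0 and [eps, eps] = 0 determine a bracket from its restriction to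
    HH(A) ([br_unique]), and the product formula for the square gives
    Sq(c eps) = Sq(c) eps^2 + c [c, eps] eps + c^2 Sq(eps) = c^2 eps.

    That the cohomology of the pair is a Gerstenhaber algebra is also proved
    ([hhbim_gerstenhaber]). The signs are controlled by passing to the
    suspension of A: the sum of the components of a cochain, with its inputs
    twisted by signs, is a function of lists ([totf]) for which the brace is an
    insertion with nothing but the Koszul sign of the inserted operation
    ([totf_brace]), and the cup product is the product of the values on the two
    halves of a list ([totf_cup]). On such functions the pre-Lie relation
    ([insert_insert]) gives the Jacobi identity, the brace a{b} is the homotopy
    for the commutativity of the cup product ([df_insert]), and the brace
    a{b, c} is the homotopy for the Leibniz rule ([insert_insert2],
    [df_insert2]). Only the parity of a shifted degree |c| - 1 enters the signs;
    it is a Boolean e, and identities extend to all cochains by splitting them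
    into their two parity components. In characteristic 2 the parity is
    irrelevant and the same identities hold for all cochains. *)

(** * Linear identities in a module *)

Section LinearExpressions.
Variables (k : fieldType) (V : lmodType k).

Inductive lexpr :=
  | LVar of nat
  | LZero
  | LAdd of lexpr & lexpr
  | LOpp of lexpr
  | LScale of k & lexpr.

Fixpoint leval (env : seq V) (e : lexpr) : V :=
  match e with
  | LVar i => nth 0 env i
  | LZero => 0
  | LAdd e1 e2 => leval env e1 + leval env e2
  | LOpp e1 => - leval env e1
  | LScale a e1 => a *: leval env e1
  end.

Fixpoint lcoef (e : lexpr) (i : nat) : k :=
  match e with
  | LVar j => if Nat.eqb j i then 1 else 0
  | LZero => 0
  | LAdd e1 e2 => lcoef e1 i + lcoef e2 i
  | LOpp e1 => - lcoef e1 i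
  | LScale a e1 => a * lcoef e1 i
  end.

Fixpoint same_coefs (e1 e2 : lexpr) (n : nat) : Prop :=
  if n is n'.+1 then lcoef e1 n' = lcoef e2 n' /\ same_coefs e1 e2 n' else True.

Lemma leval_coef env e : leval env e = \sum_(i < size env) lcoef e i *: nth 0 env i.
Proof.
elim: e => [j||e1 IH1 e2 IH2|e1 IH1|a e1 IH1] /=.
- have [jlt|jge] := ltnP j (size env).
    rewrite (bigD1 (Ordinal jlt)) //= PeanoNat.Nat.eqb_refl scale1r big1 ?addr0 //.
    move=> i /eqP ij; case: PeanoNat.Nat.eqb_spec => [e|_]; last exact: scale0r.
    by case: ij; apply: val_inj.
  rewrite nth_default // big1 // => i _.
  case: PeanoNat.Nat.eqb_spec => [e|_]; last exact: scale0r.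
  by move: jge; rewrite leqNgt e ltn_ord.
- by rewrite big1 // => i _; rewrite scale0r.
- by rewrite IH1 IH2 -big_split; apply: eq_bigr => i _; rewrite scalerDl.
- by rewrite IH1 -sumrN; apply: eq_bigr => i _; rewrite scaleNr.
- by rewrite IH1 scaler_sumr; apply: eq_bigr => i _; rewrite scalerA.
Qed.

Lemma leval_eq env e1 e2 :
  same_coefs e1 e2 (size env) -> leval env e1 = leval env e2.
Proof.
rewrite !leval_coef; move: (size env) => n eq12; apply: eq_bigr => i _.
suff -> : lcoef e1 i = lcoef e2 i by [].
case: i => i /=; elim: n eq12 => // n IH /= [eqn eq12].
by rewrite ltnS leq_eqVlt => /predU1P[->//|]; apply: IH.
Qed.

End LinearExpressions.

Ltac lmember t env :=
  lazymatch env with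
  | nil => false
  | cons t _ => true
  | cons _ ?env' => lmember t env'
  end.
Ltac lindex t env :=
  lazymatch env with
  | cons t _ => constr:(0%nat)
  | cons _ ?env' => let n := lindex t env' in constr:(S n)
  end.
Ltac latoms env t :=
  lazymatch t with
  | (?lhs + ?rhs)%R => let env1 := latoms env lhs in latoms env1 rhs
  | (- ?lhs)%R => latoms env lhs
  | (_ *: ?lhs)%R => latoms env lhs
  | 0%R => env
  | _ => let b := lmember t env in
         lazymatch b with true => env | false => constr:(cons t env) end
  end.
Ltac lreify k env t :=
  lazymatch t with
  | (?lhs + ?rhs)%R => let e1 := lreify k env lhs in let e2 := lreify k env rhs in
                   constr:(@LAdd k e1 e2)
  | (- ?lhs)%R => let e1 := lreify k env lhs in constr:(@LOpp k e1)
  | (?a *: ?lhs)%R => let e1 := lreify k env lhs in constr:(@LScale k a e1)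
  | 0%R => constr:(@LZero k)
  | _ => let n := lindex t env in constr:(@LVar k n)
  end.

(** Identities between linear combinations in a module are proved by
    comparing coefficients, which leaves identities in the field. *)
Ltac linear_coefs k V :=
  lazymatch goal with
  | |- @eq _ ?lhs ?rhs =>
    let env0 := latoms (@nil (GRing.Lmodule.sort V)) lhs in
    let env := latoms env0 rhs in
    let e1 := lreify k env lhs in
    let e2 := lreify k env rhs in
    cut (@leval k V env e1 = @leval k V env e2);
    [ cbv beta iota delta [leval nth]; exact id
    | apply: leval_eq; cbn [size same_coefs lcoef Nat.eqb]; repeat split ]
  end.
Ltac linear_comb k V := linear_coefs k V; try ring.

(** * Sums over the integers *)

Section IntegerSums.
Variables (k : fieldType) (V : lmodType k).
Implicit Types F G : int -> V.

Definition zwindow (N : nat) : seq int := [seq i%:Z - N%:Z | i <- iota 0 N.*2.+1].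

Lemma zwindow_uniq N : uniq (zwindow N).
Proof. by rewrite map_inj_uniq ?iota_uniq // => i j /addIr []. Qed.

Lemma mem_zwindow N (t : int) : (t \in zwindow N) = (`|t| <= N)%N.
Proof.
apply/mapP/idP => [[i]|tN]; first by rewrite mem_iota => /andP[_ ?] ->; lia.
by exists (absz (t + N%:Z)%R); [rewrite mem_iota|]; lia.
Qed.

Lemma fsumE (r : seq int) F : uniq r -> (forall t, t \notin r -> F t = 0) ->
  \sum_(t \in [set: int]) F t = \sum_(t <- r) F t.
Proof. move=> ru F0; rewrite (@fsbigE _ _ _ _ _ r) // => [|t _ /F0 //].
by apply: eq_bigl => t; rewrite in_setT. Qed.

Lemma fsum_window N F : (forall t, F t != 0 -> (`|t| <= N)%N) ->
  \sum_(t \in [set: int]) F t = \sum_(t <- zwindow N) F t.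
Proof.
move=> FN; apply: fsumE (zwindow_uniq N) _ => t; rewrite mem_zwindow => tN.
by apply/eqP; apply: contraNT tN; apply: FN.
Qed.

Lemma eq_fsum F G : F =1 G -> \sum_(t \in [set: int]) F t = \sum_(t \in [set: int]) G t.
Proof. by move=> FG; have -> : F = G by apply/funext. Qed.

Lemma fsum0 F : (forall t, F t = 0) -> \sum_(t \in [set: int]) F t = 0.
Proof. by move=> F0; apply: fsbig1. Qed.

Lemma fsum_neq0 F : \sum_(t \in [set: int]) F t != 0 -> exists t, F t != 0.
Proof.
have [//|noF] := pselect (exists t, F t != 0); rewrite fsum0 ?eqxx // => t.
by apply/eqP; apply: contra_notT noF => Ft; exists t.
Qed.

Lemma fsum_shift F (s : int) :
  \sum_(t \in [set: int]) F (t - s) = \sum_(t \in [set: int]) F t.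
Proof.
rewrite [RHS](@reindex_fsbigT _ _ _ _ _ (fun t => t - s)) //.
by exists (fun t => t + s) => t; rewrite ?subrK ?addrK.
Qed.

(** By the substitution a = q - t in the inner sum; the bound makes all sums
    finite, so that they can be exchanged. *)
Lemma fsum_conv N (F : int -> int -> V) :
  (forall a t, F a t != 0 -> (`|a| <= N)%N && (`|t| <= N)%N) ->
  \sum_(q \in [set: int]) \sum_(t \in [set: int]) F (q - t) t =
  \sum_(t \in [set: int]) \sum_(a \in [set: int]) F a t.
Proof.
move=> FN.
have inner q : \sum_(t \in [set: int]) F (q - t) t = \sum_(t <- zwindow N) F (q - t) t.
  by apply: fsum_window => t /FN /andP[].
under eq_fsum do rewrite inner.
rewrite (@fsum_window (N + N)%N); last first.
  move=> q qN0; suff /hasP[t _ /FN] : has (fun t => F (q - t) t != 0) (zwindow N) by lia.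
  apply/negPn; apply: contraNN qN0 => /hasPn F0.
  by rewrite big_seq big1 // => t /F0; rewrite negbK => /eqP.
rewrite exchange_big /= [RHS](@fsum_window N); last first.
  by move=> t /fsum_neq0[a /FN /andP[]].
rewrite !big_seq; apply: eq_bigr => t; rewrite mem_zwindow => tN.
rewrite -(fsum_shift (F^~ t) t) (@fsum_window (N + N)%N) // => q.
by move=> /FN; lia.
Qed.

Lemma fsum_sum (I : Type) (r : seq I) (F : I -> int -> V) N :
  (forall i t, F i t != 0 -> (`|t| <= N)%N) ->
  \sum_(t \in [set: int]) \sum_(i <- r) F i t =
  \sum_(i <- r) \sum_(t \in [set: int]) F i t.
Proof.
move=> FN; rewrite (@fsum_window N); last first.
  move=> t; apply: contraNT => tN.
  by rewrite big1 // => i _; apply/eqP; apply: contraNT tN; apply: FN.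
rewrite exchange_big; apply: eq_bigr => i _.
by rewrite (@fsum_window N) // => t; apply: FN.
Qed.

Lemma fsum_add F G : finite_set [set t | F t != 0] -> finite_set [set t | G t != 0] ->
  \sum_(t \in [set: int]) (F t + G t) =
  \sum_(t \in [set: int]) F t + \sum_(t \in [set: int]) G t.
Proof.
move=> /finite_seqP[rF FE] /finite_seqP[rG GE].
have rP t : t \notin undup (rF ++ rG) -> F t = 0 /\ G t = 0.
  rewrite mem_undup mem_cat negb_or => /andP[tF tG]; split; apply/eqP.
    apply: contraNT tF => Ft; suff : [set` rF]%classic t by [].
    by rewrite -FE.
  apply: contraNT tG => Gt; suff : [set` rG]%classic t by [].
  by rewrite -GE.
rewrite !(@fsumE (undup (rF ++ rG))) ?undup_uniq -?big_split // => t /rP[F0 G0] //.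
by rewrite F0 G0 addr0.
Qed.

Lemma finite_zset N F : (forall t, F t != 0 -> (`|t| <= N)%N) ->
  finite_set [set t | F t != 0].
Proof.
move=> FN; apply: (@sub_finite_set _ _ [set` zwindow N]) => [t /= /FN|].
  by rewrite mem_zwindow.
exact: finite_seq.
Qed.

End IntegerSums.

Lemma fsum_linear (k : fieldType) (V W : lmodType k) (f : V -> W) (F : int -> V) : linear f ->
  finite_set [set t | F t != 0] ->
  f (\sum_(t \in [set: int]) F t) = \sum_(t \in [set: int]) f (F t).
Proof.
move=> fl Ffin.
have f0 : f 0 = 0 by have := fl (-1) 0 0; rewrite !scaleN1r oppr0 addr0 addNr.
have fD u v : f (u + v) = f u + f v by rewrite -[u]scale1r fl !scale1r.
have /finite_seqP[r FE] := Ffin.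
have rF t : t \notin undup r -> F t = 0.
  rewrite mem_undup => tr; apply/eqP; apply: contraNT tr => Ft.
  by suff : [set` r]%classic t by []; rewrite -FE.
rewrite (@fsumE _ _ (undup r)) ?undup_uniq // (big_morph f fD f0).
by rewrite (@fsumE _ _ (undup r)) ?undup_uniq // => t /rF ->.
Qed.

(** * Sums over the ways of cutting a list *)

Definition cut2 (k : fieldType) (T : Type) (V : lmodType k)
    (F : seq T -> seq T -> V) (x : seq T) : V :=
  \sum_(i < (size x).+1) F (take i x) (drop i x).

Lemma cut2_exchange (k : fieldType) (T U : Type) (V : lmodType k)
    (F : seq T -> seq T -> seq U -> seq U -> V) x y :
  cut2 (fun a b => cut2 (F a b) y) x = cut2 (fun c d => cut2 (fun a b => F a b c d) x) y.
Proof. exact: exchange_big. Qed.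

Section Cuts.
Variables (k : fieldType) (T : Type) (V : lmodType k).
Implicit Types (x l m r : seq T) (F G : seq T -> seq T -> V).
Implicit Types H K : seq T -> seq T -> seq T -> V.

Definition cut3 (F : seq T -> seq T -> seq T -> V) x : V :=
  cut2 (fun l y => cut2 (F l) y) x.

Lemma cut2_nil F : cut2 F [::] = F [::] [::].
Proof. by rewrite /cut2 big_ord1. Qed.

Lemma cut2_cons F z x : cut2 F (z :: x) = F [::] (z :: x) + cut2 (fun l r => F (z :: l) r) x.
Proof. by rewrite /cut2 big_ord_recl. Qed.

Lemma eq_cut2 F G x : (forall l r, l ++ r = x -> F l r = G l r) -> cut2 F x = cut2 G x.
Proof. by move=> FG; apply: eq_bigr => i _; apply: FG; rewrite cat_take_drop. Qed.

Lemma eq_cut3 H K x : (forall l m r, l ++ m ++ r = x -> H l m r = K l m r) ->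
  cut3 H x = cut3 K x.
Proof. by move=> FG; apply: eq_cut2 => l y lyx; apply: eq_cut2 => m r myr; apply: FG; rewrite myr. Qed.

Lemma cut2_0 F x : (forall l r, l ++ r = x -> F l r = 0) -> cut2 F x = 0.
Proof. by move=> F0; rewrite /cut2 big1 // => i _; apply: F0; rewrite cat_take_drop. Qed.

Lemma cut3_0 H x : (forall l m r, l ++ m ++ r = x -> H l m r = 0) -> cut3 H x = 0.
Proof. by move=> F0; apply: cut2_0 => l y lyx; apply: cut2_0 => m r myr; apply: F0; rewrite myr. Qed.

Lemma cut2D F G x : cut2 (fun l r => F l r + G l r) x = cut2 F x + cut2 G x.
Proof. exact: big_split. Qed.

Lemma cut2Z a F x : cut2 (fun l r => a *: F l r) x = a *: cut2 F x.
Proof. by rewrite /cut2 scaler_sumr. Qed.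

Lemma cut3D H K x : cut3 (fun l m r => H l m r + K l m r) x = cut3 H x + cut3 K x.
Proof. by rewrite -cut2D; apply: eq_cut2 => l y _; apply: cut2D. Qed.

Lemma cut3Z a H x : cut3 (fun l m r => a *: H l m r) x = a *: cut3 H x.
Proof. by rewrite -cut2Z; apply: eq_cut2 => l y _; apply: cut2Z. Qed.

Lemma cut2_cat_cons F l z r : cut2 F (l ++ z :: r) =
  cut2 (fun a b => F a (b ++ z :: r)) l + cut2 (fun a b => F (l ++ z :: a) b) r.
Proof.
elim: l F => [|y l IH] F /=; first by rewrite cut2_nil cut2_cons.
by rewrite !cut2_cons IH addrA.
Qed.

Lemma cut3_cat_cons H l z r : cut3 H (l ++ z :: r) =
  cut3 (fun a b c => H a b (c ++ z :: r)) l +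
  cut2 (fun a b => cut2 (fun b' c => H a (b ++ z :: b') c) r) l +
  cut3 (fun a b c => H (l ++ z :: a) b c) r.
Proof.
rewrite /cut3 cut2_cat_cons -cut2D; congr (_ + _).
by apply: eq_cut2 => a b _; rewrite cut2_cat_cons.
Qed.

(** Both sides run over the cuts of x into three pieces. *)
Lemma cut2_assoc (F : seq T -> seq T -> seq T -> V) x :
  cut2 (fun l r => cut2 (fun a b => F a b r) l) x =
  cut2 (fun a r => cut2 (fun b c => F a b c) r) x.
Proof.
elim: x F => [|z x IH] F; first by rewrite !cut2_nil.
rewrite !cut2_cons !cut2_nil -addrA; congr (_ + _).
rewrite -IH -cut2D; apply: eq_cut2 => l r _.
by rewrite cut2_cons.
Qed.

(** Both sides run over the choices of a block m in x and of a block b on its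
    right. *)
Lemma cut3_assoc (F : seq T -> seq T -> seq T -> seq T -> seq T -> V) x :
  cut3 (fun l m r => cut3 (fun a b c => F l m a b c) r) x =
  cut3 (fun y p r => cut3 (fun l m a => F l m a p r) y) x.
Proof.
rewrite /cut3.
rewrite -[RHS](cut2_assoc (fun y p r =>
  cut2 (fun l z => cut2 (fun m a => F l m a p r) z) y)).
under [RHS]eq_cut2 => y r _ do
  rewrite (cut2_assoc (fun l z p => cut2 (fun m a => F l m a p r) z)).
rewrite [RHS](cut2_assoc (fun l w r =>
  cut2 (fun z p => cut2 (fun m a => F l m a p r) z) w)).
apply: eq_cut2 => l z _.
under [RHS]eq_cut2 => w r _ do rewrite (cut2_assoc (fun m a p => F l m a p r)).
rewrite [RHS](cut2_assoc (fun m v r => cut2 (fun a p => F l m a p r) v)).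
apply: eq_cut2 => m v _.
by rewrite [RHS](cut2_assoc (fun a p r => F l m a p r)).
Qed.

(** Both sides run over the choices of a block in x and of a block m inside
    it. *)
Lemma cut3_assoc_mid (F : seq T -> seq T -> seq T -> seq T -> seq T -> V) x :
  cut3 (fun l m r => cut2 (fun a b => cut2 (fun c d => F a b m c d) r) l) x =
  cut3 (fun a y d => cut3 (fun b m c => F a b m c d) y) x.
Proof.
rewrite /cut3.
under eq_cut2 => l w _ do rewrite cut2_exchange.
rewrite (cut2_assoc (fun a b w => cut2 (fun m r => cut2 (fun c d => F a b m c d) r) w)).
apply: eq_cut2 => a y _.
rewrite [RHS](cut2_assoc (fun b w d => cut2 (fun m c => F a b m c d) w)).
apply: eq_cut2 => b w _.
by rewrite [RHS](cut2_assoc (fun m c d => F a b m c d)).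
Qed.

Lemma cut3_left (F : seq T -> seq T -> seq T -> seq T -> V) x :
  cut3 (fun l m r => cut2 (fun a b => F a b m r) l) x =
  cut2 (fun a y => cut3 (F a) y) x.
Proof.
rewrite /cut3; under eq_cut2 => l w _ do rewrite cut2_exchange.
by rewrite (cut2_assoc (fun a b w => cut2 (fun m r => F a b m r) w)).
Qed.

Lemma cut3_right (F : seq T -> seq T -> seq T -> seq T -> V) x :
  cut3 (fun l m r => cut2 (fun a b => F l m a b) r) x =
  cut2 (fun y b => cut3 (fun l m a => F l m a b) y) x.
Proof.
rewrite /cut3 [RHS](cut2_assoc (fun l w b => cut2 (fun m a => F l m a b) w)).
apply: eq_cut2 => l v _.
by rewrite [RHS](cut2_assoc (fun m a b => F l m a b)).
Qed.

Lemma cut2_first F x : (forall z l r, F (z :: l) r = 0) -> cut2 F x = F [::] x.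
Proof.
move=> F0; case: x => [|z x]; first exact: cut2_nil.
by rewrite cut2_cons cut2_0 ?addr0.
Qed.

Lemma cut3_single H z x : (forall l m r, size m != 1%N -> H l m r = 0) ->
  cut3 H (z :: x) = H [::] [:: z] x + cut3 (fun l => H (z :: l)) x.
Proof.
move=> H0; rewrite /cut3 cut2_cons cut2_cons H0 // add0r; congr (_ + _).
by rewrite cut2_first // => z' l r; apply: H0.
Qed.

End Cuts.

Lemma cut2_map (k : fieldType) (T U : Type) (V : lmodType k) (g : T -> U)
    (F : seq U -> seq U -> V) x :
  cut2 F (map g x) = cut2 (fun l r => F (map g l) (map g r)) x.
Proof. by elim: x F => [|z x IH] F; rewrite ?cut2_nil //= !cut2_cons IH. Qed.

Lemma cut3_map (k : fieldType) (T U : Type) (V : lmodType k) (g : T -> U)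
    (F : seq U -> seq U -> seq U -> V) x :
  cut3 F (map g x) = cut3 (fun l m r => F (map g l) (map g m) (map g r)) x.
Proof. by rewrite /cut3 cut2_map; apply: eq_cut2 => l r _; rewrite cut2_map. Qed.

Lemma cut2_linear (k : fieldType) (T : Type) (V W : lmodType k) (f : V -> W)
    (F : seq T -> seq T -> V) x :
  linear f -> f (cut2 F x) = cut2 (fun l r => f (F l r)) x.
Proof.
move=> fl; have f0 : f 0 = 0 by have := fl (-1) 0 0; rewrite !scaleN1r oppr0 addr0 addNr.
have fD u v : f (u + v) = f u + f v by rewrite -[u]scale1r fl !scale1r.
by rewrite /cut2 (big_morph f fD f0).
Qed.

Lemma cut3_linear (k : fieldType) (T : Type) (V W : lmodType k) (f : V -> W)
    (F : seq T -> seq T -> seq T -> V) x :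
  linear f -> f (cut3 F x) = cut3 (fun l m r => f (F l m r)) x.
Proof.
by move=> fl; rewrite /cut3 cut2_linear //; apply: eq_cut2 => l r _; rewrite cut2_linear.
Qed.

Lemma cut3_exchange (k : fieldType) (T U : Type) (V : lmodType k)
    (F : seq T -> seq T -> seq T -> seq U -> seq U -> seq U -> V) p q :
  cut3 (fun s t u => cut3 (F s t u) q) p = 
  cut3 (fun s' t' u' => cut3 (fun s t u => F s t u s' t' u') p) q.
Proof.
rewrite /cut3; under eq_cut2 => s t _ do rewrite cut2_exchange.
rewrite cut2_exchange; apply: eq_cut2 => s' t' _.
under eq_cut2 => s t _ do rewrite cut2_exchange.
by rewrite cut2_exchange.
Qed.

(** * The sign involution of a graded algebra *)

Lemma signz_parity (R : unitRingType) (n : int) : (-1 : R) ^ n = (-1) ^+ odd `|n|.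
Proof.
case: n => n; first by rewrite -exprnP signr_odd.
rewrite [LHS]/(((-1) ^+ n.+1)^-1) /absz -signr_odd.
by case: (odd _); [exact: invrN1 | exact: invr1].
Qed.

Lemma linear_at0 (k : fieldType) (V W : lmodType k) (f : V -> W) : linear f -> f 0 = 0.
Proof. by move=> fl; have := fl (-1) 0 0; rewrite !scaleN1r oppr0 addr0 addNr. Qed.

Lemma linear_scale (k : fieldType) (V W : lmodType k) (f : V -> W) a v :
  linear f -> f (a *: v) = a *: f v.
Proof. by move=> fl; have := fl a v 0; rewrite (linear_at0 fl) !addr0. Qed.

Section Koszul.
Variables (k : fieldType) (A : gradedAlgType k).
Implicit Types (x y : A) (t i : int).

Lemma homog_hcomp i x : homog i (hcomp i x).
Proof. by rewrite /homog hcompK eqxx. Qed.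

Lemma homog_linear i a x y : homog i x -> homog i y -> homog i (a *: x + y).
Proof. by rewrite /homog hcomp_linear => -> ->. Qed.

Lemma homog0 i : homog i (0 : A).
Proof. by rewrite /homog (linear_at0 (@hcomp_linear _ _ i)). Qed.

Lemma homogZ i a x : homog i x -> homog i (a *: x).
Proof. by move=> xi; rewrite -[_ *: _]addr0; apply: homog_linear => //; apply: homog0. Qed.

Lemma homogM i j x y : homog i x -> homog j y -> homog (i + j) (amul x y).
Proof. by rewrite /homog => <- <-; rewrite hcomp_mul. Qed.

Lemma homog_sum i (I : Type) (r : seq I) (P : pred I) (F : I -> A) :
  (forall j, P j -> homog i (F j)) -> homog i (\sum_(j <- r | P j) F j).
Proof.
move=> Fi; apply: big_ind => //; first exact: homog0.
by move=> x y xi yi; rewrite -[x]scale1r; apply: homog_linear.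
Qed.

(** By decomposition into homogeneous components. *)
Lemma homog_ext (W : lmodType k) (f g : A -> W) : linear f -> linear g ->
  (forall i x, homog i x -> f x = g x) -> f =1 g.
Proof.
move=> fl gl fg x; rewrite -(hcomp_sum x).
rewrite (fsum_linear fl) ?(fsum_linear gl); try exact: hcomp_finite.
by apply: eq_fsum => i; apply/fg/homog_hcomp.
Qed.

Lemma koszul_homog t i x : homog i x -> koszul t x = (-1) ^ (t * i) *: x.
Proof.
move=> xi; rewrite /koszul (@fsum_unique _ _ i) ?xi // => j ji.
by rewrite -xi hcompK (negPf ji) scaler0.
Qed.

Lemma koszul_linear t : linear (@koszul k A t).
Proof.
move=> a x y; rewrite /koszul.
have fin b z : finite_set [set i | b i *: hcomp i z != 0 :> A].
  apply: sub_finite_set (hcomp_finite z) => i /=; apply: contraNN => /eqP ->.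
  by rewrite scaler0.
under eq_fsum do rewrite hcomp_linear scalerDr scalerA mulrC -scalerA.
rewrite fsum_add //; first last.
  apply: sub_finite_set (hcomp_finite x) => i /=; apply: contraNN => /eqP ->.
  by rewrite !scaler0.
by rewrite -(fsum_linear (f := fun v : A => a *: v)) // => b u v; rewrite scalerDr !scalerA mulrC.
Qed.

(** The sign of an operation of parity e that moves past x, when x has its
    degree decreased by 1 as in the suspension of A. *)
Definition sg (e : bool) x : A := if e then - koszul 1 x else x.

Lemma sg_linear e : linear (sg e).
Proof. by case: e => //= a x y; rewrite /sg koszul_linear opprD scalerN. Qed.

Lemma sgZ e a x : sg e (a *: x) = a *: sg e x.
Proof. exact: linear_scale (sg_linear e). Qed.

Lemma sg_homog e i x : homog i x -> sg e x = (-1) ^+ (e && ~~ odd `|i|) *: x.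
Proof.
move=> xi; case: e => //=; last by rewrite expr0 scale1r.
rewrite (koszul_homog _ xi) mul1r signz_parity.
by case: odd; rewrite /= ?expr1 ?expr0 ?scaleN1r ?scale1r ?opprK.
Qed.

Lemma homog_sg e i x : homog i x -> homog i (sg e x).
Proof. by move=> xi; rewrite (sg_homog _ xi); apply: homogZ. Qed.

Lemma sg_sg e f x : sg e (sg f x) = sg (e (+) f) x.
Proof.
move: x; apply: homog_ext => [a x y||i x xi]; rewrite ?sg_linear //.
  by apply: sg_linear.
rewrite (sg_homog f xi) sgZ !(sg_homog _ xi) scalerA.
by case: e f => [] [] /=; rewrite ?expr0 ?mul1r ?mulr1 // -expr2 sqrr_sign.
Qed.

(** The Koszul sign for the degree of x and the one for the shifted degree
    differ by a sign that depends on t only. *)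
Lemma koszul_sg t x : koszul t x = (-1) ^+ odd `|t| *: sg (odd `|t|) x.
Proof.
move: x; apply: homog_ext => [|a x y|i x xi]; first exact: koszul_linear.
  by rewrite sg_linear scalerDr !scalerA mulrC.
rewrite (koszul_homog _ xi) (sg_homog _ xi) scalerA signz_parity abszM oddM.
by case: (odd `|t|) (odd `|i|) => [] []; rewrite /= ?expr0 ?expr1 ?mulr1 // mulrNN mulr1.
Qed.

Lemma homog_koszul t i x : homog i x -> homog i (koszul t x).
Proof. by move=> xi; rewrite (koszul_homog _ xi); apply: homogZ. Qed.

Lemma sg_one e : sg e (aone : A) = (-1) ^+ e *: aone.
Proof.
by rewrite (sg_homog _ (i := 0)) ?andbT //; apply: hcomp_one.
Qed.

Lemma sg_char2 e x : (2 \in [pchar k])%N -> sg e x = x.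
Proof.
move=> k2; move: x; apply: homog_ext => [||i x xi] //; first exact: sg_linear.
rewrite (sg_homog _ xi); suff -> : (-1 : k) = 1 by rewrite expr1n scale1r.
by apply/eqP; rewrite eq_sym -addr_eq0 -(pcharf0 k2).
Qed.

End Koszul.

Arguments sg {k A} e x : simpl never.

(** * Multilinear functions of lists of inputs *)

Section Multilinear.
Variables (k : fieldType) (A : gradedAlgType k).
Implicit Types (l m r x y : seq (input A)) (f g : mmap A) (e : bool).

Definition multilinear f : Prop := forall l r b a u v,
  f (l ++ (b, a *: u + v) :: r) = a *: f (l ++ (b, u) :: r) + f (l ++ (b, v) :: r).

Lemma multilinear_slot f l r b : multilinear f -> linear (fun u => f (l ++ (b, u) :: r)).
Proof. by move=> fl a u v; apply: fl. Qed.

Lemma multilinear0 f l r b : multilinear f -> f (l ++ (b, 0) :: r) = 0.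
Proof. by move=> fl; apply: linear_at0 (multilinear_slot l r b fl). Qed.

Lemma multilinearZ f l r b a u : multilinear f ->
  f (l ++ (b, a *: u) :: r) = a *: f (l ++ (b, u) :: r).
Proof. by move=> fl; apply: (linear_scale a u (multilinear_slot l r b fl)). Qed.

Lemma multilinear_cut2 f l r b T (F : seq T -> seq T -> A) (x : seq T) : multilinear f ->
  f (l ++ (b, cut2 F x) :: r) = cut2 (fun p q => f (l ++ (b, F p q) :: r)) x.
Proof. by move=> fl; apply: (cut2_linear F x (multilinear_slot l r b fl)). Qed.

Lemma multilinear_cut3 f l r b T (F : seq T -> seq T -> seq T -> A) (x : seq T) : multilinear f ->
  f (l ++ (b, cut3 F x) :: r) = cut3 (fun p q w => f (l ++ (b, F p q w) :: r)) x.
Proof. by move=> fl; apply: (cut3_linear F x (multilinear_slot l r b fl)). Qed.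

(** Slot by slot, by decomposition into homogeneous components. *)
Lemma multilinear_ext f g : multilinear f -> multilinear g ->
  (forall x : seq (int * input A), (forall u, u \in x -> homog u.1 u.2.2) ->
    f [seq u.2 | u <- x] = g [seq u.2 | u <- x]) -> f =1 g.
Proof.
move=> fl gl fg x.
suff: forall y : seq (int * input A), (forall u, u \in y -> homog u.1 u.2.2) ->
    f ([seq u.2 | u <- y] ++ x) = g ([seq u.2 | u <- y] ++ x).
  by move=> /(_ [::]); apply.
elim: x => [|[b u] x IH] y yh; first by rewrite cats0; apply: fg.
move: u; apply: homog_ext; try exact: multilinear_slot.
move=> i u ui; have := IH (rcons y (i, (b, u))); rewrite map_rcons cat_rcons; apply.
by move=> w; rewrite mem_rcons inE => /predU1P[->|/yh].
Qed.

(** The sign of an operation of parity e that moves past all the inputs in x. *)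
Definition hat e x : seq (input A) := [seq (u.1, sg e u.2) | u <- x].

Lemma hat_cat e x y : hat e (x ++ y) = hat e x ++ hat e y.
Proof. exact: map_cat. Qed.

Lemma hat_hat e e' x : hat e (hat e' x) = hat (e (+) e') x.
Proof. by rewrite /hat -map_comp; apply: eq_map => u /=; rewrite sg_sg. Qed.

Lemma hatC e e' x : hat e (hat e' x) = hat e' (hat e x).
Proof. by rewrite !hat_hat addbC. Qed.

Lemma has_hat e x : has fst (hat e x) = has fst x.
Proof. by rewrite has_map. Qed.

Lemma hat0 x : hat false x = x.
Proof. by rewrite /hat -[RHS]map_id; apply: eq_map => -[]. Qed.

Lemma count_hat e x : count fst (hat e x) = count fst x.
Proof. by rewrite count_map. Qed.

Lemma size_hat e x : size (hat e x) = size x.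
Proof. exact: size_map. Qed.

Lemma multilinear_hat f e : multilinear f -> multilinear (fun x => f (hat e x)).
Proof. by move=> fl l r b a u v; rewrite !hat_cat /= sg_linear fl. Qed.

End Multilinear.

(** * Braces and cup products of functions of lists *)

Section Braces.
Variables (k : fieldType) (A : gradedAlgType k).
Implicit Types (l m r x y z : seq (input A)) (f g a b c d : mmap A) (e : bool).

(** The value of b on a block, tagged by its type: it is in the bimodule if
    an input is. *)
Definition out b x : input A := (has fst x, b x).

(** The brace f{b} of operations on the suspension of A, for b of parity e.
    On the suspension no sign occurs but the one of b moving past the inputs
    on its left. *)
Definition insert e b f : mmap A := fun x =>
  cut3 (fun l m r => f (hat e l ++ out b m :: r)) x.

(** The brace f{b, c}: the block of b lies on the left of the block of c. *)
Definition insert2 eb b ec c f : mmap A := fun x =>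
  cut3 (fun y p r => insert eb b (fun z => f (hat ec z ++ out c p :: r)) y) x.

(** What homogeneity of parity e contributes to sign computations. In
    contrast to a condition on degrees it applies to sums of components of
    several degrees. *)
Definition sign_homog e f : Prop := forall x,
  f (hat true x) = (-1) ^+ e *: sg true (f x).

Lemma sign_homogE e e' f x : sign_homog e f ->
  f (hat e' x) = (-1) ^+ (e && e') *: sg e' (f x).
Proof.
move=> fe; case: e' => /=; first by rewrite andbT fe.
by rewrite andbF expr0 scale1r hat0.
Qed.

Lemma has_out b l m r : has fst (l ++ out b m :: r) = has fst (l ++ m ++ r).
Proof. by rewrite !has_cat. Qed.

Lemma multilinear_left f w r : multilinear f -> multilinear (fun x => f (x ++ w :: r)).
Proof. by move=> fl l' r' t a u v; rewrite -!catA !cat_cons fl. Qed.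

Lemma multilinear_hat_left f e w r : multilinear f ->
  multilinear (fun x => f (hat e x ++ w :: r)).
Proof. by move=> fl; apply: (multilinear_hat e (multilinear_left w r fl)). Qed.

Lemma insert_hat e' eb b f x : multilinear f -> sign_homog eb b ->
  insert eb b f (hat e' x) = (-1) ^+ (eb && e') *: insert eb b (fun z => f (hat e' z)) x.
Proof.
move=> fl be; rewrite /insert cut3_map -cut3Z; apply: eq_cut3 => l m r _.
rewrite hatC hat_cat /= -multilinearZ //; congr (f (_ ++ _ :: _)).
by rewrite /out has_hat (sign_homogE _ _ be).
Qed.

Lemma insert_linearl e b (u : k) f g :
  insert e b (fun x => u *: f x + g x) = u *: insert e b f + insert e b g :> mmap A.
Proof. by apply/funext => x; rewrite !fctE /insert -cut3Z -cut3D. Qed.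

Lemma insert_linearr e f (u : k) b b' : multilinear f ->
  insert e (fun x => u *: b x + b' x) f = u *: insert e b f + insert e b' f :> mmap A.
Proof.
move=> fl; apply/funext => x; rewrite !fctE /insert -cut3Z -cut3D.
by apply: eq_cut3 => l m r _; rewrite fl.
Qed.

Lemma insert_cut3 e b T (F : seq T -> seq T -> seq T -> mmap A) (q : seq T) x :
  insert e b (fun z => cut3 (fun s t u => F s t u z) q) x =
  cut3 (fun s t u => insert e b (F s t u) x) q.
Proof. exact: cut3_exchange. Qed.

(** The block lies on the left of the marked letter w, contains it, or lies
    on its right. *)
Lemma insert_cat_cons e b f l w r : insert e b f (l ++ w :: r) =
  insert e b (fun y => f (y ++ w :: r)) l +
  cut2 (fun l' m => cut2 (fun m' r' =>
    f (hat e l' ++ out b (m ++ w :: m') :: r')) r) l +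
  cut3 (fun l' m r' => f (hat e (l ++ w :: l') ++ out b m :: r')) r.
Proof.
rewrite /insert cut3_cat_cons; congr (_ + _ + _).
by apply: eq_cut3 => l' m r' _; rewrite -catA.
Qed.

(** The block m of c lies inside the block of b, which it cuts into l2, m and
    r1. *)
Lemma insert_nested e b e' c f x : multilinear f ->
  insert e (insert e' c b) f x =
  cut3 (fun l m r => cut2 (fun l1 l2 => cut2 (fun r1 r2 =>
    f (hat e l1 ++ out b (hat e' l2 ++ out c m :: r1) :: r2)) r) l) x.
Proof.
move=> fl; rewrite cut3_assoc_mid; apply: eq_cut3 => l m r _.
rewrite {1}/out multilinear_cut3 //; apply: eq_cut3 => l2 p r1 mE.
by rewrite [in RHS]/out has_out !has_cat has_hat -!has_cat mE.
Qed.

(** The pre-Lie relation, in the form that computes the associator: the block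
    of c lies inside the block of b, on its right or on its left. *)
Lemma insert_insert eb b ec c f x : multilinear f -> sign_homog eb b ->
  insert ec c (insert eb b f) x = insert (eb (+) ec) (insert ec c b) f x +
    (-1) ^+ (eb && ec) *: insert2 eb b ec c f x + insert2 ec c eb b f x.
Proof.
move=> fl be; rewrite {1}/insert.
under eq_cut3 => l m r _ do rewrite insert_cat_cons.
rewrite !cut3D [X in X + _]addrC; congr (_ + _ + _).
- rewrite insert_nested //; apply: eq_cut3 => l m r _; rewrite cut2_map.
  by apply: eq_cut2 => l1 l2 _; rewrite hat_hat.
- rewrite -cut3Z; apply: eq_cut3 => l m r _.
  by rewrite insert_hat //; apply: multilinear_left.
rewrite cut3_assoc; apply: eq_cut3 => y p r _; apply: eq_cut3 => l m n _.
by rewrite !hat_cat /= -catA /= hatC /out.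
Qed.

(** The terms with disjoint blocks are symmetric in b and c up to sign, so
    that they cancel from the difference of the two associators. *)
Lemma prelie eb b ec c f x : multilinear f -> sign_homog eb b -> sign_homog ec c ->
  insert ec c (insert eb b f) x =
    (-1) ^+ (eb && ec) *: insert eb b (insert ec c f) x +
    insert (eb (+) ec) (insert ec c b) f x -
    (-1) ^+ (eb && ec) *: insert (eb (+) ec) (insert eb b c) f x.
Proof.
move=> fl be ce; rewrite !insert_insert // addbC (andbC ec).
by case: (eb && ec); linear_comb k A.
Qed.

Lemma eq_insert e b f g x : f =1 g -> insert e b f x = insert e b g x.
Proof. by move=> fg; apply: eq_cut3 => l m r _; apply: fg. Qed.

Lemma insertZ e b u f x : insert e b (fun z => u *: f z) x = u *: insert e b f x.
Proof. exact: cut3Z. Qed.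

Lemma insertD e b f g x : insert e b (fun z => f z + g z) x = insert e b f x + insert e b g x.
Proof. exact: cut3D. Qed.

Lemma out_hat e ec c x : sign_homog ec c ->
  out c (hat e x) = ((out c x).1, (-1) ^+ (ec && e) *: sg e (out c x).2).
Proof. by move=> ce; rewrite /out has_hat (sign_homogE _ _ ce). Qed.

Lemma insert_sum2 e b T (F : seq T -> seq T -> mmap A) (q : seq T) x :
  insert e b (fun z => cut2 (fun s t => F s t z) q) x =
  cut2 (fun s t => insert e b (F s t) x) q.
Proof.
rewrite /insert /cut3 [RHS]cut2_exchange; apply: eq_cut2 => l w _.
by rewrite [RHS]cut2_exchange.
Qed.

(** The block lies in one of the two halves of the list. *)
Lemma insert_cut2 e b (F : seq (input A) -> mmap A) x :
  insert e b (cut2 F) x = cut2 (fun y z => insert e b (F^~ z) y) x +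
    cut2 (fun y z => insert e b (F (hat e y)) z) x.
Proof.
rewrite {1}/insert.
under eq_cut3 => l m r _ do rewrite cut2_cat_cons cut2_map.
rewrite cut3D addrC; congr (_ + _).
  by rewrite (cut3_right (fun l m y z => F (hat e l ++ out b m :: y) z)).
by rewrite (cut3_left (fun y z m r => F (hat e y) (hat e z ++ out b m :: r))).
Qed.

Lemma insert2_nested eb b e c e' d f x : multilinear f ->
  insert2 eb b e (insert e' d c) f x =
  cut3 (fun l m r => cut2 (fun y p => cut2 (fun p' r' =>
    insert eb b (fun z => f (hat e z ++ out c (hat e' p ++ out d m :: p') :: r')) y) r) l) x.
Proof.
move=> fl; rewrite cut3_assoc_mid; apply: eq_cut3 => y p r _.
rewrite -insert_cut3; apply: eq_insert => z.
rewrite {1}/out multilinear_cut3 //; apply: eq_cut3 => p1 m p2 pE.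
by rewrite [in RHS]/out has_out !has_cat has_hat -!has_cat pE.
Qed.

(** Second-order analogue of the pre-Lie relation. Both sides are expanded by
    the position of the block of d relative to those of b and c; the terms
    with three disjoint blocks are the same on both sides and cancel. *)
Lemma insert_insert2 eb b ec c ed d f x : multilinear f ->
  sign_homog eb b -> sign_homog ec c -> sign_homog ed d ->
  insert ed d (insert2 eb b ec c f) x =
    (-1) ^+ (eb && ed) *: ((-1) ^+ (ec && ed) *:
      (insert2 eb b ec c (insert ed d f) x
       - insert2 eb b (ec (+) ed) (insert ec c d) f x
       - insert (eb (+) ec (+) ed) (insert2 eb b ec c d) f x)
    + insert2 eb b (ec (+) ed) (insert ed d c) f x)
    + insert2 (eb (+) ed) (insert ed d b) ec c f x
    - (-1) ^+ (eb && ed) *: insert2 (eb (+) ed) (insert eb b d) ec c f x.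
Proof.
move=> fl be ce de.
pose G p r z := f (hat ec z ++ out c p :: r).
have Gl p r : multilinear (G p r) by apply: multilinear_hat_left.
(* Of the terms in which the blocks of c and d are disjoint, X collects those *)
(* with d on the left of c, and Y those with d on the right. *)
pose X := cut3 (fun y p r => insert eb b (insert ed d (G p r)) y) x.
pose Y := cut3 (fun l m r => cut3 (fun y p r' =>
  insert eb b (fun z => f (hat ed (hat ec z ++ out c p :: r') ++ out d m :: r)) y) l) x.
have insert_first : insert ed d (insert2 eb b ec c f) x =
    (-1) ^+ (eb && ed) *: ((-1) ^+ (ec && ed) *: Y +
       insert2 eb b (ec (+) ed) (insert ed d c) f x) +
    insert2 (eb (+) ed) (insert ed d b) ec c f x +
    (-1) ^+ (eb && ed) *:
      (X - insert2 (eb (+) ed) (insert eb b d) ec c f x).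
  rewrite {1}/insert.
  under eq_cut3 => l m r _ do rewrite /insert2 cut3_cat_cons.
  rewrite !cut3D scalerDr -[RHS]addrA; congr (_ + _ + _).
  - rewrite -!cut3Z; apply: eq_cut3 => l m r _; rewrite cut3_map -!cut3Z.
    apply: eq_cut3 => y p r' _; rewrite insert_hat //; last exact: multilinear_hat_left.
    congr (_ *: _); rewrite -insertZ; apply: eq_insert => z.
    rewrite (out_hat ed p ce) multilinearZ //; congr (_ *: f _).
    by rewrite hat_cat hatC -catA.
  - rewrite insert2_nested // -cut3Z; apply: eq_cut3 => l m r _.
    rewrite cut2_map -cut2Z; apply: eq_cut2 => y p _.
    rewrite -cut2Z; apply: eq_cut2 => p' r' _.
    rewrite insert_hat //; last exact: multilinear_hat_left.
    by congr (_ *: _); apply: eq_insert => z; rewrite hat_hat.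
  rewrite (cut3_assoc (fun l m y p r => insert eb b (G p r) (hat ed l ++ out d m :: y))).
  transitivity (cut3 (fun y p r => insert ed d (insert eb b (G p r)) y) x) => //.
  under eq_cut3 => y p r _ do rewrite (prelie _ (Gl p r) be de).
  rewrite /insert2 /X scalerBr -scaleNr -!cut3Z -!cut3D; apply: eq_cut3 => y p r _.
  by rewrite -/(G p r); linear_comb k A.
have insert_last : insert2 eb b ec c (insert ed d f) x =
    (-1) ^+ (ec && ed) *: X + Y + insert2 eb b (ec (+) ed) (insert ec c d) f x +
    insert (eb (+) ec (+) ed) (insert2 eb b ec c d) f x.
  rewrite {1}/insert2.
  transitivity (cut3 (fun y p r =>
      insert eb b (fun z => insert ed d (fun w => f (w ++ out c p :: r)) (hat ec z)) y +
      insert eb b (fun z => cut2 (fun l m => cut2 (fun m' r' =>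
        f (hat ed l ++ out d (m ++ out c p :: m') :: r')) r) (hat ec z)) y +
      insert eb b (fun z => cut3 (fun l m r' =>
        f (hat ed (hat ec z ++ out c p :: l) ++ out d m :: r')) r) y) x).
    apply: eq_cut3 => y p r _; rewrite -!insertD; apply: eq_insert => z.
    exact: insert_cat_cons.
  rewrite !cut3D -!addrA; congr (_ + _).
    rewrite -cut3Z; apply: eq_cut3 => y p r _; rewrite -insertZ; apply: eq_insert => z.
    by rewrite insert_hat ?(andbC ed) //; apply: multilinear_left.
  rewrite [LHS]addrC; congr (_ + _).
    transitivity (cut3 (fun y p r => cut3 (fun l m r' => insert eb b (fun z =>
        f (hat ed (hat ec z ++ out c p :: l) ++ out d m :: r')) y) r) x).
      by apply: eq_cut3 => y p r _; apply: insert_cut3.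
    by rewrite cut3_assoc.
  transitivity (cut3 (fun y p r =>
      cut2 (fun l m => insert eb b (fun z => cut2 (fun m' r' =>
        f (hat (ec (+) ed) z ++ out d (hat ec m ++ out c p :: m') :: r')) r) l) y +
      cut2 (fun l m => insert eb b (fun z => cut2 (fun m' r' =>
        f (hat (eb (+) ec (+) ed) l ++ out d (hat ec z ++ out c p :: m') :: r')) r) m) y) x).
    apply: eq_cut3 => y p r _.
    transitivity (insert eb b (cut2 (fun l m => cut2 (fun m' r' =>
        f (hat (ec (+) ed) l ++ out d (hat ec m ++ out c p :: m') :: r')) r)) y).
      apply: eq_insert => z; rewrite cut2_map; apply: eq_cut2 => l m _.
      by rewrite hat_hat addbC.
    rewrite insert_cut2; congr (_ + _); apply: eq_cut2 => l m _; apply: eq_insert => z.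
    by rewrite hat_hat addbAC (addbC eb).
  rewrite cut3D; congr (_ + _).
    rewrite insert2_nested //; apply: eq_cut3 => y p r _; apply: eq_cut2 => l m _.
    by rewrite insert_sum2.
  transitivity (cut3 (fun l q r => cut3 (fun y p m' => insert eb b (fun z =>
      f (hat (eb (+) ec (+) ed) l ++ out d (hat ec z ++ out c p :: m') :: r)) y) q) x).
    rewrite -cut3_assoc_mid; apply: eq_cut3 => y p r _; apply: eq_cut2 => l m _.
    by rewrite insert_sum2.
  apply: eq_cut3 => l q r _; rewrite {3}/out multilinear_cut3 //.
  apply: eq_cut3 => y p m' qE; rewrite /insert multilinear_cut3 //.
  apply: eq_cut3 => s t u yE; rewrite [in LHS]/out.
  by rewrite has_out !has_cat has_hat /= has_out -!has_cat /= -qE -yE !has_cat has_hat /= !orbA.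
rewrite insert_first insert_last.
by case: (eb && ed) (ec && ed) => [] []; linear_comb k A.
Qed.

End Braces.

Section Cups.
Variables (k : fieldType) (A : gradedAlgType k).
Implicit Types (l m r x y z : seq (input A)) (f g a b c d : mmap A) (e : bool).

(** The bimodule has no product: t tells that both factors lie in it. *)
Definition tmul (t : bool) (u v : A) : A := if t then 0 else amul u v.

Lemma tmul_linearl t v : linear (fun u => tmul t u v).
Proof. by case: t => a u w /=; rewrite ?scaler0 ?addr0 //; apply: amul_linearl. Qed.

Lemma tmul_linearr t u : linear (tmul t u).
Proof. by case: t => a v w /=; rewrite ?scaler0 ?addr0 //; apply: amul_linearr. Qed.

(** The cup product on the suspension, for g of shifted parity e: the degree
    of g has parity ~~ e, which gives the sign of g moving past the inputs of
    f. *)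
Definition cupf e f g : mmap A := fun x =>
  cut2 (fun l r => tmul (has fst l && has fst r) (f (hat (~~ e) l)) (g r)) x.

Definition idf : mmap A := fun x => if x is [:: u] then u.2 else 0.

(** The product of A and its actions on the bimodule, on the suspension.
    Writing them as a cup product makes the insertion of cochains into them
    an instance of the insertion into cup products. *)
Definition m2f : mmap A := cupf false idf idf.

Definition unitf : mmap A := fun x => if x is [::] then aone else 0.

Lemma cupfA e e' f g h : cupf e' (cupf e f g) h = cupf (~~ (e (+) e')) f (cupf e' g h).
Proof.
apply/funext => x; rewrite /cupf.
transitivity (cut2 (fun y r => cut2 (fun l m =>
  if [|| has fst l && has fst m, has fst l && has fst r | has fst m && has fst r]
  then 0 else amul (f (hat (~~ e (+) ~~ e') l)) (amul (g (hat (~~ e') m)) (h r))) y) x).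
  apply: eq_cut2 => y r _; rewrite cut2_map.
  rewrite (cut2_linear _ _ (tmul_linearl _ _)); apply: eq_cut2 => l m lm.
  rewrite hat_hat !has_hat -lm has_cat /tmul.
  case: (has fst l) (has fst m) (has fst r) => [] [] [] //=;
    by rewrite ?amulA // (linear_at0 (amul_linearl _)).
rewrite (cut2_assoc (fun l m r => if [|| has fst l && has fst m, has fst l && has fst r |
  has fst m && has fst r] then 0 else
  amul (f (hat (~~ e (+) ~~ e') l)) (amul (g (hat (~~ e') m)) (h r)))).
apply: eq_cut2 => l y _; rewrite (cut2_linear _ _ (tmul_linearr _ _)).
apply: eq_cut2 => m r mr; rewrite -mr has_cat /tmul negbK addbN addNb negbK.
by case: (has fst l) (has fst m) (has fst r) => [] [] [] //=;
  rewrite // (linear_at0 (amul_linearr _)).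
Qed.

Lemma cupf_linearl e g (u : k) f f' :
  cupf e (fun x => u *: f x + f' x) g = u *: cupf e f g + cupf e f' g :> mmap A.
Proof.
apply/funext => x; rewrite !fctE /cupf -cut2Z -cut2D; apply: eq_cut2 => l r _.
exact: tmul_linearl.
Qed.

Lemma cupf_linearr e f (u : k) g g' :
  cupf e f (fun x => u *: g x + g' x) = u *: cupf e f g + cupf e f g' :> mmap A.
Proof.
apply/funext => x; rewrite !fctE /cupf -cut2Z -cut2D; apply: eq_cut2 => l r _.
exact: tmul_linearr.
Qed.

Lemma idf_size x : size x != 1%N -> idf x = 0.
Proof. by case: x => [|u [|v x]]. Qed.

Lemma insert_single e b f x : (forall y, size y != 1%N -> f y = 0) ->
  insert e b f x = f [:: out b x].
Proof.
move=> f0; rewrite /insert /cut3.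
have -> : cut2 (fun l y => cut2 (fun m r => f (hat e l ++ out b m :: r)) y) x =
    cut2 (fun m r => f (out b m :: r)) x.
  apply: cut2_first => z l y; apply: cut2_0 => m r _; apply: f0.
  by rewrite size_cat /= addnS.
rewrite /cut2 big_ord_recr /= take_size drop_size big1 ?add0r // => -[i /= ilt] _.
apply: f0; case E: (drop i x) => //=.
by move: (size_drop i x); rewrite E /=; lia.
Qed.

Lemma insert_idf e b x : insert e b idf x = b x.
Proof. by rewrite insert_single //; apply: idf_size. Qed.

(** The factors have no input in common, so that the block of c lies within
    the inputs of one of them. *)
Lemma insert_cup ec c e f g x : multilinear f -> sign_homog ec c ->
  insert ec c (cupf e f g) x =
    (-1) ^+ (ec && ~~ e) *: cupf e (insert ec c f) g x +
    cupf (e (+) ec) f (insert ec c g) x.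
Proof.
move=> fl ce; rewrite /cupf insert_cut2 -cut2Z; congr (_ + _); apply: eq_cut2 => y z yz.
  transitivity (tmul (has fst y && has fst z)
      (insert ec c (fun l => f (hat (~~ e) l)) y) (g z)).
    rewrite /insert (cut3_linear _ _ (tmul_linearl _ _)).
    by apply: eq_cut3 => l m r lmr; rewrite has_out !has_cat has_hat -!has_cat lmr.
  by rewrite (insert_hat (~~ e)) // (linear_scale _ _ (tmul_linearl _ _)) scalerA -signr_addb addbb scale1r.
rewrite /insert (cut3_linear _ _ (tmul_linearr _ _)).
apply: eq_cut3 => l m r lmr; rewrite has_out !has_cat !has_hat -!has_cat lmr.
by rewrite hat_hat addNb.
Qed.

Lemma eq_insert_tag e b f g y :
  (forall z, has fst z = has fst y -> f z = g z) -> insert e b f y = insert e b g y.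
Proof.
move=> fg; apply: eq_cut3 => l m r lmr; apply: fg.
by rewrite has_out !has_cat has_hat -!has_cat lmr.
Qed.

Lemma tmul_insertl t e b f y v :
  tmul t (insert e b f y) v = insert e b (fun z => tmul t (f z) v) y.
Proof. exact: (cut3_linear _ _ (tmul_linearl t v)). Qed.

Lemma tmul_insertr t e b f y u :
  tmul t u (insert e b f y) = insert e b (fun z => tmul t u (f z)) y.
Proof. exact: (cut3_linear _ _ (tmul_linearr t u)). Qed.

Lemma insert2_hat e eb b ec c f x : multilinear f ->
  sign_homog eb b -> sign_homog ec c ->
  insert2 eb b ec c f (hat e x) =
  (-1) ^+ (e && (eb (+) ec)) *: insert2 eb b ec c (fun z => f (hat e z)) x.
Proof.
move=> fl be ce; rewrite /insert2 cut3_map -cut3Z; apply: eq_cut3 => y p r _.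
rewrite insert_hat //; last exact: multilinear_hat_left.
rewrite -!insertZ; apply: eq_insert => z.
rewrite (out_hat e p ce) multilinearZ // scalerA hatC hat_cat -signr_addb.
by rewrite andb_addr !(andbC e).
Qed.

(** Either both blocks lie within the inputs of the same factor, or the block
    of b within those of f and the block of c within those of g. *)
Lemma insert2_cup eb b ec c e f g x : multilinear f -> multilinear g ->
  sign_homog eb b -> sign_homog ec c ->
  insert2 eb b ec c (cupf e f g) x =
    (-1) ^+ (~~ e && (eb (+) ec)) *: cupf e (insert2 eb b ec c f) g x +
    (-1) ^+ (eb && (~~ e (+) ec)) *: cupf (e (+) ec) (insert eb b f) (insert ec c g) x +
    cupf (e (+) eb (+) ec) f (insert2 eb b ec c g) x.
Proof.
move=> fl gl be ce; rewrite {1}/insert2.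
transitivity (cut3 (fun y p r =>
  cut2 (fun s t => insert eb b (fun z => tmul (has fst (y ++ p ++ s) && has fst t)
    (f (hat (~~ e) (hat ec z ++ out c p :: s))) (g t)) y) r +
  (cut2 (fun l m => insert eb b (fun l' => tmul (has fst l && has fst (m ++ p ++ r))
    (f (hat (~~ e (+) ec) l')) (g (hat ec m ++ out c p :: r))) l) y +
   cut2 (fun l m => insert eb b (fun m' => tmul (has fst l && has fst (m ++ p ++ r))
    (f (hat (~~ e (+) ec (+) eb) l)) (g (hat ec m' ++ out c p :: r))) m) y)) x).
  apply: eq_cut3 => y p r _; rewrite addrC.
  transitivity (insert eb b (fun z =>
      cut2 (fun l m => tmul (has fst l && has fst (m ++ p ++ r))
        (f (hat (~~ e (+) ec) l)) (g (hat ec m ++ out c p :: r))) z +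
      cut2 (fun s t => tmul (has fst (y ++ p ++ s) && has fst t)
        (f (hat (~~ e) (hat ec z ++ out c p :: s))) (g t)) r) y).
    apply: eq_insert_tag => z zy; rewrite /cupf cut2_cat_cons cut2_map; congr (_ + _).
      by apply: eq_cut2 => l m _; rewrite has_out !has_cat !has_hat hat_hat.
    by apply: eq_cut2 => s t _; rewrite has_out !has_cat has_hat zy.
  rewrite insertD insert_sum2 insert_cut2; congr (_ + _ + _); apply: eq_cut2 => l m _.
    by apply: eq_insert_tag => z ->.
  by apply: eq_insert_tag => z zm; rewrite has_hat hat_hat !has_cat zm.
rewrite !cut3D -addrA; congr (_ + (_ + _)).
- rewrite cut3_right /cupf -cut2Z; apply: eq_cut2 => q t _.
  rewrite insert2_hat // (linear_scale _ _ (tmul_linearl _ _)) scalerA.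
  rewrite -signr_addb addbb scale1r (cut3_linear _ _ (tmul_linearl _ _)).
  by apply: eq_cut3 => y p s <-; rewrite tmul_insertl.
- rewrite cut3_left /cupf -cut2Z; apply: eq_cut2 => l q _.
  rewrite insert_hat // (linear_scale _ _ (tmul_linearl _ _)) scalerA.
  rewrite addNb -signr_addb addbb scale1r (cut3_linear _ _ (tmul_linearr _ _)).
  by apply: eq_cut3 => m p r <-; rewrite tmul_insertl.
rewrite cut3_left /cupf; apply: eq_cut2 => l q _.
rewrite (cut3_linear _ _ (tmul_linearr _ _)); apply: eq_cut3 => m p r <-.
by rewrite tmul_insertr !addNb addbAC.
Qed.

Lemma insert2_idf eb b ec c x : insert2 eb b ec c idf x = 0.
Proof.
apply: cut3_0 => y p r _; apply: cut3_0 => l m n _; apply: idf_size.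
by rewrite size_cat size_hat !size_cat /=; lia.
Qed.

Lemma multilinear_idf : multilinear idf.
Proof.
by move=> [|w [|? l]] [|w' r] t u v c /=; rewrite ?scaler0 ?addr0.
Qed.

Lemma cupf1 e f : cupf e unitf f = f.
Proof.
apply/funext => -[|w x]; rewrite /cupf ?cut2_nil ?cut2_cons /= ?amul1 //.
by rewrite cut2_0 ?addr0 // => l r _; rewrite (linear_at0 (tmul_linearl _ _)).
Qed.

Lemma cupf1r f : cupf true f unitf = f.
Proof.
apply/funext => x; rewrite /cupf /cut2 big_ord_recr /= take_size drop_size andbF hat0.
rewrite [X in _ + X]/tmul amulr1 big1 ?add0r // => -[i /= ilt] _.
case E: (drop i x) => [|w y].
  by move: (size_drop i x); rewrite E /=; lia.
by rewrite /= (linear_at0 (tmul_linearr _ _)).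
Qed.

End Cups.

Arguments idf {k A} x.
Arguments m2f {k A} x.
Arguments unitf {k A} x.

(** * The differential on functions of lists *)

Lemma linear_add (k : fieldType) (V W : lmodType k) (f : V -> W) u v :
  linear f -> f (u + v) = f u + f v.
Proof. by move=> fl; rewrite -[u]scale1r fl !scale1r. Qed.

Lemma linear_opp (k : fieldType) (V W : lmodType k) (f : V -> W) v :
  linear f -> f (- v) = - f v.
Proof. by move=> fl; rewrite -!scaleN1r linear_scale. Qed.

Section Differential.
Variables (k : fieldType) (A : gradedAlgType k).
Implicit Types (l m r x y z : seq (input A)) (f g a b c d : mmap A) (e : bool).

Let W : lmodType k := mmap A.

Lemma cupfl e g : linear ((cupf e)^~ g : W -> W).
Proof. by move=> u f f'; apply: cupf_linearl. Qed.

Lemma cupfr e f : linear (cupf e f : W -> W).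
Proof. by move=> u g g'; apply: cupf_linearr. Qed.

Lemma insertl e b : linear (insert e b : W -> W).
Proof. by move=> u f g; apply: insert_linearl. Qed.

Lemma insertr e f : multilinear f -> linear ((insert e)^~ f : W -> W).
Proof. by move=> fl u b b'; apply: insert_linearr. Qed.

Lemma insert2l eb b ec c : linear (insert2 eb b ec c : W -> W).
Proof.
move=> u f g; apply/funext => x; rewrite !fctE /insert2 -cut3Z -cut3D.
by apply: eq_cut3 => y p r _; rewrite -insertZ -insertD.
Qed.

Lemma insert2Zr eb b ec c f (u : k) : multilinear f ->
  insert2 eb b ec (u *: c : W) f = u *: insert2 eb b ec c f :> W.
Proof.
move=> fl; apply/funext => x; rewrite !fctE /insert2 -cut3Z; apply: eq_cut3 => y p r _.
by rewrite -insertZ; apply: eq_insert => z; rewrite -multilinearZ.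
Qed.

Lemma insert2Zl eb b ec c f (u : k) : multilinear f ->
  insert2 eb (u *: b : W) ec c f = u *: insert2 eb b ec c f :> W.
Proof.
move=> fl; apply/funext => x; rewrite !fctE /insert2 -cut3Z; apply: eq_cut3 => y p r _.
have gl : multilinear (fun z => f (hat ec z ++ out c p :: r)) by apply: multilinear_hat_left.
by rewrite (linear_scale u (b : W) (insertr eb gl)).
Qed.

Lemma sgM u v : sg true (amul u v : A) = - amul (sg true u) (sg true v).
Proof.
have ml (w : A) : linear (fun u : A => - amul (sg true u) (sg true w)).
  by move=> a u' v'; rewrite sg_linear amul_linearl opprD scalerN.
move: u; apply: homog_ext => //.
  by move=> a u' v'; rewrite amul_linearl sg_linear.
move=> i u ui; move: v; apply: homog_ext => [a u' v'|a u' v'|j v vj].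
- by rewrite amul_linearr sg_linear.
- by rewrite sg_linear amul_linearr opprD scalerN.
rewrite (sg_homog _ (homogM ui vj)) (sg_homog _ ui) (sg_homog _ vj).
rewrite (linear_scale _ _ (amul_linearl _)) (linear_scale _ _ (amul_linearr _)) scalerA -scaleN1r scalerA.
congr (_ *: _); have -> : odd `|i + j| = odd `|i| (+) odd `|j| by lia.
by case: (odd `|i|) (odd `|j|) => [] [] /=; ring.
Qed.

Lemma m2f_pair u v : m2f [:: u; v] = tmul (u.1 && v.1) (sg true u.2) v.2 :> A.
Proof.
rewrite /m2f /cupf !cut2_cons cut2_nil /= andbF !orbF (linear_at0 (tmul_linearr _ _)).
by rewrite (linear_at0 (amul_linearr _)) add0r addr0.
Qed.

Lemma m2f_size x : size x != 2%N -> m2f x = 0.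
Proof.
move=> sx; apply: cut2_0 => l r lrx.
have [sl|sl] := eqVneq (size l) 1%N; last first.
  by rewrite idf_size ?size_hat // (linear_at0 (tmul_linearl _ _)).
rewrite [idf r]idf_size ?(linear_at0 (tmul_linearr _ _)) //.
by apply: contra_neq sx => sr; rewrite -lrx size_cat sl sr.
Qed.

Lemma multilinear_m2f : multilinear (@m2f k A).
Proof.
move=> l r t u v w.
have [|s2] := eqVneq (size (l ++ (t, v) :: r)) 2%N; last first.
  by rewrite !m2f_size ?scaler0 ?addr0 //; move: s2; rewrite !size_cat.
case: l => [|w1 [|w2 [|? l]]]; case: r => [|w1' [|w2' r]] //= _; rewrite !m2f_pair /=.
  by rewrite sg_linear tmul_linearl.
by rewrite tmul_linearr.
Qed.

Lemma sign_homog_m2f : sign_homog true (@m2f k A).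
Proof.
move=> x; have [|s2] := eqVneq (size x) 2%N; last first.
  by rewrite !m2f_size ?size_hat // (linear_at0 (sg_linear _)) scaler0.
case: x => [|u [|v [|? ?]]] //= _; rewrite !m2f_pair /= expr1 scaleN1r.
rewrite /tmul; case: ifP => _; first by rewrite (linear_at0 (sg_linear _)) oppr0.
by rewrite sgM opprK.
Qed.

(** The bracket with m2f, which has odd parity. *)
Definition df e f : mmap A := insert e f m2f - (-1) ^+ e *: insert true m2f f : W.

Lemma insert_m2f e b : sign_homog e b ->
  insert e b m2f = cupf e idf b + (-1) ^+ e *: cupf false b idf :> W.
Proof.
move=> be; apply/funext => x; rewrite insert_cup //; last exact: multilinear_idf.
have idE : insert e b idf = b by apply/funext => y; apply: insert_idf.
by rewrite idE andbT addrC.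
Qed.

(** The two terms are the two bracketings of a triple product. *)
Lemma insert_m2f_m2f : insert true m2f m2f = 0 :> W.
Proof.
rewrite (insert_m2f sign_homog_m2f) {2}/m2f cupfA /= -/m2f.
by rewrite expr1 scaleN1r subrr.
Qed.

Lemma insertW_cup ec c e f g : multilinear f -> sign_homog ec c ->
  insert ec c (cupf e f g) = (-1) ^+ (ec && ~~ e) *: cupf e (insert ec c f) g +
    cupf (e (+) ec) f (insert ec c g) :> W.
Proof. by move=> fl ce; apply/funext => x; apply: insert_cup. Qed.

Lemma prelieW eb b ec c f : multilinear f -> sign_homog eb b -> sign_homog ec c ->
  insert ec c (insert eb b f) =
    (-1) ^+ (eb && ec) *: insert eb b (insert ec c f) +
    insert (eb (+) ec) (insert ec c b) f -
    (-1) ^+ (eb && ec) *: insert (eb (+) ec) (insert eb b c) f :> W.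
Proof. by move=> fl be ce; apply/funext => x; apply: prelie. Qed.

Lemma df_cup e e' f g : multilinear f -> sign_homog e f -> sign_homog e' g ->
  sign_homog (~~ (e (+) e')) (cupf e' f g) ->
  df (~~ (e (+) e')) (cupf e' f g) =
    cupf e' (df e f) g + (-1) ^+ (~~ e) *: cupf (~~ e') f (df e' g) :> W.
Proof.
move=> fl fe ge fge; rewrite /df !insert_m2f // insertW_cup //; last exact: sign_homog_m2f.
rewrite !(linear_add _ _ (cupfl _ _)) !(linear_add _ _ (cupfr _ _)).
rewrite !(linear_opp _ (cupfl _ _)) !(linear_opp _ (cupfr _ _)).
rewrite !(linear_scale _ _ (cupfl _ _)) !(linear_scale _ _ (cupfr _ _)) !cupfA.
by case: e {fe fge}; case: e' {ge} => /=; linear_comb k W.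
Qed.

(** By the pre-Lie relation, the square of the bracket with m2f is the
    bracket with m2f{m2f} = 0. *)
Lemma df_df e f : multilinear f -> sign_homog e f -> df (~~ e) (df e f) = 0 :> W.
Proof.
move=> fl fe; have Ml := multilinear_m2f; have Me := sign_homog_m2f.
rewrite /df (linear_add _ _ (insertr _ Ml)) (linear_add _ _ (insertl _ _)).
rewrite !(linear_opp _ (insertr _ Ml)) !(linear_opp _ (insertl _ _)).
rewrite !(linear_scale _ _ (insertr _ Ml)) !(linear_scale _ _ (insertl _ _)).
have -> : insert true m2f (insert true m2f f) = 0 :> W.
  apply/funext => x; rewrite insert_insert // insert_m2f_m2f.
  rewrite [insert _ 0 f x]cut3_0 ?add0r ?expr1 ?scaleN1r ?addNr // => l m r _.
  by rewrite /out multilinear0.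
rewrite (prelieW Ml fe Me) insert_m2f_m2f (linear_at0 (insertl _ _)).
by case: e {fe} => /=; linear_comb k W.
Qed.

(** The bracket with m2f is a derivation of insertion, up to the terms in
    which both a and b fill inputs of m2f. These are the cup products of a
    and b, so that a{b} is a homotopy for graded commutativity. *)
Lemma df_insert ea a eb b : multilinear a -> sign_homog ea a -> sign_homog eb b ->
  sign_homog (ea (+) eb) (insert eb b a) ->
  df (ea (+) eb) (insert eb b a) =
    insert eb b (df ea a) + (-1) ^+ ea *: insert (~~ eb) (df eb b) a
    - (-1) ^+ (~~ ea && eb) *: cupf ea b a + (-1) ^+ (~~ ea) *: cupf eb a b :> W.
Proof.
move=> al ae be abe; rewrite /df insert_m2f // (prelieW al be (sign_homog_m2f)).
rewrite (linear_add _ _ (insertl _ _)) (linear_opp _ (insertl _ _)).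
rewrite (linear_scale _ _ (insertl _ _)) (insert_m2f ae) (linear_add _ _ (insertl _ _)).
rewrite (linear_scale _ _ (insertl _ _)) (insertW_cup ea a (@multilinear_idf k A) be) (insertW_cup false idf al be).
rewrite (linear_add _ _ (insertr _ al)) (linear_opp _ (insertr _ al)).
rewrite (linear_scale _ _ (insertr _ al)).
have -> : insert eb b idf = b by apply/funext => y; apply: insert_idf.
by case: ea {ae abe}; case: eb {be} => /=; linear_comb k W.
Qed.

Lemma insert_cocycle e a : df e a = 0 :> W ->
  insert true m2f a = (-1) ^+ e *: insert e a m2f :> W.
Proof.
move=> /eqP; rewrite subr_eq0 => /eqP ->; rewrite scalerA.
by case: e; linear_comb k W.
Qed.

(** As in df_insert, what is left of the derivation rule for a{b, c} are the
    terms in which blocks fill inputs of m2f. For cocycles these are the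
    three terms of the Leibniz rule. *)
Lemma df_insert2 ea a eb b ec c : multilinear a -> multilinear b ->
  sign_homog ea a -> sign_homog eb b -> sign_homog ec c ->
  sign_homog (ea (+) eb (+) ec) (insert2 eb b ec c a) ->
  df ea a = 0 :> W -> df eb b = 0 :> W -> df ec c = 0 :> W ->
  df (ea (+) eb (+) ec) (insert2 eb b ec c a) =
    (-1) ^+ (ea (+) eb (+) (eb && ec)) *:
    (insert (~~ (eb (+) ec)) (cupf ec b c) a - cupf ec (insert eb b a) c
     - (-1) ^+ (ea && ~~ eb) *: cupf (ea (+) ec) b (insert ec c a)) :> W.
Proof.
move=> al bl ae be ce abce da db dc; have Me := sign_homog_m2f.
have idE e d : insert e d idf = d by apply/funext => y; apply: insert_idf.
have id2 : insert2 eb b ec c idf = 0 by apply/funext => y; apply: insert2_idf.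
have cup2 e f g : multilinear f -> multilinear g -> insert2 eb b ec c (cupf e f g) =
    (-1) ^+ (~~ e && (eb (+) ec)) *: cupf e (insert2 eb b ec c f) g +
    (-1) ^+ (eb && (~~ e (+) ec)) *: cupf (e (+) ec) (insert eb b f) (insert ec c g) +
    cupf (e (+) eb (+) ec) f (insert2 eb b ec c g) :> W.
  by move=> fl gl; apply/funext => x; apply: insert2_cup.
have il := @multilinear_idf k A.
have Mbc : insert2 eb b ec c m2f = (-1) ^+ (eb && ~~ ec) *: cupf ec b c :> W.
  rewrite /m2f cup2 // id2 !idE (linear_at0 (cupfl _ _)) (linear_at0 (cupfr _ _)).
  by case: eb {be abce db cup2 id2}; case: ec {ce dc} => /=; linear_comb k W.
have aM : insert true m2f (insert2 eb b ec c a) = (-1) ^+ (eb (+) ec) *: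
    (insert2 eb b ec c (insert true m2f a)
     - insert (~~ (eb (+) ec)) (insert2 eb b ec c m2f) a) :> W.
  apply/funext => x; rewrite insert_insert2 // !addbT !andbT (insert_cocycle dc) (insert_cocycle db).
  rewrite insert2Zr // insert2Zl // !fctE.
  by case: eb {be abce db cup2 id2 Mbc}; case: ec {ce dc} => /=; linear_comb k A.
rewrite /df insert_m2f // aM (insert_cocycle da) insert_m2f // Mbc.
rewrite !(linear_scale _ _ (insert2l _ _ _ _)) (linear_add _ _ (insert2l _ _ _ _)).
rewrite !(linear_scale _ _ (insert2l _ _ _ _)) !cup2 // id2 !idE.
rewrite (linear_at0 (cupfl _ _)) (linear_at0 (cupfr _ _)) (linear_scale _ _ (insertr _ al)).
by case: ea {ae abce da aM}; case: eb {be db cup2 id2 Mbc}; case: ec {ce dc} => /=; linear_comb k W.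
Qed.

End Differential.

(** * Operations on cochains as sums over cuts *)

Section CutForms.
Variables (k : fieldType) (A : gradedAlgType k).
Implicit Types (l m r x y z : seq (input A)) (c : cochain A) (q t : int).

(** The Koszul sign of an operation of degree t that moves past the inputs in
    x, these having their degree in A. *)
Definition kz t x : seq (input A) := [seq (u.1, koszul t u.2) | u <- x].

Lemma size_kz t x : size (kz t x) = size x. Proof. exact: size_map. Qed.
Lemma has_kz t x : has fst (kz t x) = has fst x. Proof. by rewrite has_map. Qed.
Lemma count_kz t x : count fst (kz t x) = count fst x. Proof. by rewrite count_map. Qed.
Lemma kz_cat t x y : kz t (x ++ y) = kz t x ++ kz t y. Proof. exact: map_cat. Qed.

Lemma triangle_sum (V : zmodType) n (G : nat -> nat -> V) :
  \sum_(s < n.+1) \sum_(j < n.+1 - s) G s j = \sum_(j < n.+1) \sum_(s < (n - j).+1) G s j.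
Proof.
transitivity (\sum_(s < n.+1) \sum_(j < n.+1 | (j < n.+1 - s)%N) G s j).
  by apply: eq_bigr => s _; rewrite -(big_ord_widen _ (G s)) // leq_subr.
rewrite (exchange_big_dep xpredT) //=; apply: eq_bigr => j _.
rewrite (big_ord_widen n.+1 (G^~ j)) ?ltnS ?leq_subr //; apply: eq_bigl => s.
by have := ltn_ord s; have := ltn_ord j; lia.
Qed.

Definition wterm (w : nat -> int -> nat -> int -> k) c1 c2 q t l m r : A :=
  w (size l + size r).+1 (q - t) (size m) t *:
  ((-1) ^ (((size m)%:Z - 1) * (size r)%:Z + t * (size l + size r)%N%:Z) *:
   c1 (q - t) (kz t l ++ out (c2 t) m :: r)).

(** The two indices of wbrace that give the position and the size of the
    block parametrize the cuts of x into three pieces. *)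
Lemma wbraceE w c1 c2 q x : wbrace w c1 c2 q x =
  cut3 (fun l m r => \sum_(t \in [set: int]) wterm w c1 c2 q t l m r) x.
Proof.
rewrite /wbrace /=; set n := size x.
pose G (s j : nat) : A := \sum_(t \in [set: int]) w (n.+1 - s)%N (q - t) s t *:
  circ (n.+1 - s) s t j.+1 (c1 (q - t)) (c2 t) x.
transitivity (\sum_(s < n.+1) \sum_(j < n.+1 - s) G s j).
  by apply: eq_bigr => s _; rewrite big_add1 big_mkord.
rewrite triangle_sum /cut3 /cut2; apply: eq_bigr => -[j /= jn] _.
have sd : size (drop j x) = (n - j)%N by rewrite size_drop.
rewrite sd; apply: eq_bigr => -[s /= sn] _; apply: eq_fsum => t.
have sl : size (take j x) = j by rewrite size_takel.
have sm : size (take s (drop j x)) = s by rewrite size_takel // sd.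
have sr : size (drop s (drop j x)) = (n - j - s)%N by rewrite size_drop sd.
rewrite /wterm /circ sl sm sr drop_drop (addnC s) /=.
have -> : (n.+1 - s)%N%:Z - j.+1%:Z = (n - j - s)%N%:Z by lia.
have -> : (n.+1 - s)%N%:Z - 1 = (j + (n - j - s))%N%:Z by lia.
by have -> : (j + (n - j - s)).+1 = (n.+1 - s)%N by lia.
Qed.

Lemma cupE ok c1 c2 q x : cup (product_cochain ok) c1 c2 q x =
  cut2 (fun l r => \sum_(t \in [set: int]) (-1) ^ (t * (size l)%:Z) *:
    tmul (~~ ok (has fst l) (has fst r)) (c1 (q - t) (kz t l)) (c2 t r)) x.
Proof.
rewrite /cup /cut2 /=; set n := size x.
apply: eq_bigr => -[p /= pn] _; apply: eq_fsum => t.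
rewrite {1}/circ /= size_takel //.
have -> : take (n - p) (drop p x) = drop p x by rewrite -size_drop take_size.
have -> : drop (p + (n - p)) x = [::] by rewrite drop_oversize // subnKC.
rewrite /circ /= take0 drop0 /= -/(kz t (take p x)) add0n.
have sl : size (kz t (take p x)) = p by rewrite size_kz size_takel.
rewrite take_size_cat // drop_size_cat //= has_kz !scalerA.
have -> : amul (c1 (q - t) (kz t (take p x))) (c2 t (drop p x))
    *+ ok (has fst (take p x)) (has fst (drop p x)) =
  tmul (~~ ok (has fst (take p x)) (has fst (drop p x)))
    (c1 (q - t) (kz t (take p x))) (c2 t (drop p x)) by rewrite /tmul; case: ok.
congr (_ *: _); rewrite !signz_parity -!signr_addb; congr ((-1) ^+ nat_of_bool _).
lia.
Qed.

End CutForms.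

Section Closure.
Variables (k : fieldType) (A : gradedAlgType k).
Implicit Types (l m r x y z : seq (input A)) (c : cochain A) (q t : int).

Lemma bimP c : reflect [/\ multilinear_cochain c, degree_cochain c,
  typed_cochain c & finite_cochain c] (c \in bim_cochains A).
Proof. exact: asboolP. Qed.

Lemma bim_multilinear c q : c \in bim_cochains A -> multilinear (c q).
Proof. by move=> /bimP[cl _ _ _] l r b a u v; apply: cl. Qed.

Lemma bim_finite c : c \in bim_cochains A ->
  exists N : nat, forall q x, c q x != 0 -> (size x <= N)%N && (`|q| <= N)%N.
Proof. by move=> /bimP[_ _ _]. Qed.

Lemma bim_typed c q x : c \in bim_cochains A -> (1 < count fst x)%N -> c q x = 0.
Proof. by move=> /bimP[_ _ ct _]; apply: ct. Qed.

Lemma bim_degree c q (x : seq (int * input A)) : c \in bim_cochains A ->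
  (forall u, u \in x -> homog u.1 u.2.2) ->
  homog (\sum_(u <- x) u.1 + q) (c q [seq u.2 | u <- x]).
Proof. by move=> /bimP[_ cd _ _]; apply: cd. Qed.

Lemma multilinear_cut2_fun (F : seq (input A) -> seq (input A) -> A) :
  (forall r, multilinear (F^~ r)) -> (forall l, multilinear (F l)) ->
  multilinear (cut2 F).
Proof.
move=> Fl Fr l r b a u v; rewrite !cut2_cat_cons scalerDr addrACA -!cut2Z -!cut2D.
by congr (_ + _); apply: eq_cut2 => y z _; [apply: Fr | apply: Fl].
Qed.

Lemma multilinear_cut3_fun (F : seq (input A) -> seq (input A) -> seq (input A) -> A) :
  (forall m r, multilinear (fun l => F l m r)) ->
  (forall l r, multilinear (fun m => F l m r)) ->
  (forall l m, multilinear (F l m)) -> multilinear (cut3 F).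
Proof.
move=> F1 F2 F3; apply: multilinear_cut2_fun => [y|l]; last exact: multilinear_cut2_fun.
move=> l r b a u v; rewrite -cut2Z -cut2D; apply: eq_cut2 => m r' _; exact: F1.
Qed.

Lemma multilinear_fsum (F : int -> mmap A) (N : nat) :
  (forall t, multilinear (F t)) -> (forall t x, F t x != 0 -> (`|t| <= N)%N) ->
  multilinear (fun x => \sum_(t \in [set: int]) F t x).
Proof.
move=> Fl FN l r b a u v; rewrite !(fsum_window (N := N)) => [|t|t|t]; try exact: FN.
by rewrite scaler_sumr -big_split; apply: eq_bigr => t _; apply: Fl.
Qed.

Lemma multilinear_kz f t w r : multilinear f -> multilinear (fun x => f (kz t x ++ w :: r)) .
Proof. by move=> fl l' r' b a u v; rewrite !kz_cat /= -!catA !cat_cons koszul_linear fl. Qed.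

Lemma multilinear_right f w l : multilinear f -> multilinear (fun x => f (l ++ w :: x)).
Proof. by move=> fl l' r' b a u v; have := fl (l ++ w :: l') r' b a u v; rewrite -!catA. Qed.

Lemma multilinear_mid f g t l r : multilinear f -> multilinear g ->
  multilinear (fun x => f (kz t l ++ out g x :: r)).
Proof. by move=> fl gl l' r' b a u v; rewrite /out gl fl !has_cat. Qed.

Lemma multilinear_sized f (s : nat -> k) : multilinear f ->
  multilinear (fun x => s (size x) *: f x).
Proof.
move=> fl l r b a u v; rewrite fl !size_cat /= scalerDr !scalerA; congr (_ *: _ + _).
by rewrite mulrC.
Qed.

Lemma wterm_neq0 w c1 c2 q t l m r : c1 \in bim_cochains A ->
  wterm w c1 c2 q t l m r != 0 ->
  c1 (q - t) (kz t l ++ out (c2 t) m :: r) != 0 /\ c2 t m != 0.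
Proof.
move=> c1S nz; split; apply: contra_neq nz => z0; rewrite /wterm ?z0 ?scaler0 //.
by rewrite /out z0 multilinear0 ?scaler0 //; apply: bim_multilinear.
Qed.

Lemma homog_fsum i (F : int -> A) : (forall t, homog i (F t)) ->
  homog i (\sum_(t \in [set: int]) F t).
Proof. by move=> Fi; apply: homog_sum => t _; apply: Fi. Qed.

Lemma homog_cut2 i T (F : seq T -> seq T -> A) (p : seq T) :
  (forall s s', s ++ s' = p -> homog i (F s s')) -> homog i (cut2 F p).
Proof. by move=> Fi; apply: homog_sum => j _; apply: Fi; apply: cat_take_drop. Qed.

Lemma eq_multilinear (f g : mmap A) : f =1 g -> multilinear g -> multilinear f.
Proof. by move=> fg gl l r b a u v; rewrite !fg; apply: gl. Qed.

Lemma wbrace_bim w c1 c2 : c1 \in bim_cochains A -> c2 \in bim_cochains A ->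
  wbrace w c1 c2 \in bim_cochains A.
Proof.
move=> c1S c2S; have [N1 c1N] := bim_finite c1S; have [N2 c2N] := bim_finite c2S.
have l1 q : multilinear (c1 q) by apply: bim_multilinear.
have l2 q : multilinear (c2 q) by apply: bim_multilinear.
apply/bimP; split.
- move=> q; suff : multilinear (wbrace w c1 c2 q) by [].
  have -> : wbrace w c1 c2 q =
      cut3 (fun l m r => \sum_(t \in [set: int]) wterm w c1 c2 q t l m r).
    by apply/funext => x; apply: wbraceE.
  apply: multilinear_cut3_fun => [m r|l r|l m]; apply: (@multilinear_fsum _ N2) => [t|t x];
    try by move=> /(wterm_neq0 c1S)[_ /c2N /andP[]].
  + pose g n := w (n + size r).+1 (q - t) (size m) t * (-1) ^ (((size m)%:Z - 1) *
       (size r)%:Z + t * (n + size r)%N%:Z).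
    have := multilinear_sized g (multilinear_kz t (out (c2 t) m) r (l1 (q - t))).
    by apply: eq_multilinear => y; rewrite /wterm scalerA.
  + pose g n := w (size l + size r).+1 (q - t) n t * (-1) ^ ((n%:Z - 1) *
       (size r)%:Z + t * (size l + size r)%N%:Z).
    have := multilinear_sized g (multilinear_mid t l r (l1 (q - t)) (l2 t)).
    by apply: eq_multilinear => y; rewrite /wterm scalerA.
  + pose g n := w (size l + n).+1 (q - t) (size m) t * (-1) ^ (((size m)%:Z - 1) *
       n%:Z + t * (size l + n)%N%:Z).
    have := multilinear_sized g (multilinear_right (out (c2 t) m) (kz t l) (l1 (q - t))).
    by apply: eq_multilinear => y; rewrite /wterm scalerA.
- move=> q x xh; rewrite wbraceE cut3_map.
  apply: homog_cut2 => l y lyx; apply: homog_cut2 => m r mry; apply: homog_fsum => t.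
  rewrite /wterm; do 2!apply: homogZ.
  pose x' := [seq (u.1, (u.2.1, koszul t u.2.2)) | u <- l] ++
    (\sum_(u <- m) u.1 + t, out (c2 t) [seq u.2 | u <- m]) :: r.
  have -> : kz t [seq u.2 | u <- l] ++ out (c2 t) [seq u.2 | u <- m] :: [seq u.2 | u <- r] =
      [seq u.2 | u <- x'] by rewrite /x' map_cat /= /kz -!map_comp.
  have -> : \sum_(u <- x) u.1 + q = \sum_(u <- x') u.1 + (q - t).
    rewrite -lyx -mry /x' !big_cat big_cons big_map /=; ring.
  apply: bim_degree => // u; rewrite mem_cat inE => /or3P[/mapP[v vl ->]|/eqP->|ur] /=.
  + by apply: homog_koszul; apply: xh; rewrite -lyx mem_cat vl.
  + by apply: bim_degree => // v vm; apply: xh; rewrite -lyx -mry !mem_cat vm orbT.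
  + by apply: xh; rewrite -lyx -mry !mem_cat ur !orbT.
- move=> q x cx; rewrite wbraceE; apply: cut3_0 => l m r lmr; apply: fsum0 => t.
  apply/eqP; apply: contraT => /(wterm_neq0 c1S)[nz1 nz2]; move: cx; rewrite -lmr.
  have m1 : (count fst m <= 1)%N by rewrite leqNgt; apply: contra_neqN nz2 => /(bim_typed _ c2S).
  have : (count fst (kz t l ++ out (c2 t) m :: r) <= 1)%N.
    by rewrite leqNgt; apply: contra_neqN nz1 => /(bim_typed _ c1S).
  rewrite !count_cat /= count_kz has_count; move: m1; set p := count _ m.
  by case: p => [|[|p]] //= _ ? ?; lia.
exists (N1 + N2)%N => q x; rewrite wbraceE => nz.
have [l [m [r [t [lmr nzt]]]]] : exists l m r t, l ++ m ++ r = x /\ wterm w c1 c2 q t l m r != 0.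
  apply: contrapT => no; move/eqP: nz; apply; apply: cut3_0 => l m r lmr; apply: fsum0 => t.
  by apply/eqP; apply: contra_notT no => nz; exists l, m, r, t.
have [/c1N/andP[s1 q1] /c2N/andP[s2 q2]] := wterm_neq0 c1S nzt.
by move: s1; rewrite -lmr !size_cat /= size_kz; lia.
Qed.

End Closure.

Section CupClosure.
Variables (k : fieldType) (A : gradedAlgType k).
Implicit Types (l m r x y z : seq (input A)) (c : cochain A) (q t : int).

Definition cterm c1 c2 q t l r : A := (-1) ^ (t * (size l)%:Z) *:
  tmul (has fst l && has fst r) (c1 (q - t) (kz t l)) (c2 t r).

Lemma bim_cupE c1 c2 q x : cup (bim_m2 A) c1 c2 q x =
  cut2 (fun l r => \sum_(t \in [set: int]) cterm c1 c2 q t l r) x.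
Proof. by rewrite cupE; apply: eq_cut2 => l r _; apply: eq_fsum => t; rewrite negbK. Qed.

Lemma cterm_neq0 c1 c2 q t l r : cterm c1 c2 q t l r != 0 ->
  [/\ c1 (q - t) (kz t l) != 0, c2 t r != 0 & ~~ (has fst l && has fst r)].
Proof.
move=> nz; split; [| |apply: contraNN nz]; last by rewrite /cterm => -> /=; rewrite scaler0.
  apply: contra_neq nz; rewrite /cterm => ->.
  by rewrite (linear_at0 (tmul_linearl _ _)) scaler0.
apply: contra_neq nz; rewrite /cterm => ->.
by rewrite (linear_at0 (tmul_linearr _ _)) scaler0.
Qed.

Lemma cup_bim c1 c2 : c1 \in bim_cochains A -> c2 \in bim_cochains A ->
  cup (bim_m2 A) c1 c2 \in bim_cochains A.
Proof.
move=> c1S c2S; have [N1 c1N] := bim_finite c1S; have [N2 c2N] := bim_finite c2S.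
have l1 q : multilinear (c1 q) by apply: bim_multilinear.
have l2 q : multilinear (c2 q) by apply: bim_multilinear.
apply/bimP; split.
- move=> q; suff : multilinear (cup (bim_m2 A) c1 c2 q) by [].
  apply: (eq_multilinear (bim_cupE c1 c2 q)).
  apply: multilinear_cut2_fun => [r|l]; apply: (@multilinear_fsum _ _ _ N2) => [t|t x];
    try by move=> /cterm_neq0[_ /c2N /andP[]].
  + move=> l' r' b a u v; rewrite /cterm !kz_cat /= koszul_linear l1 !has_cat /=.
    by rewrite tmul_linearl !size_cat scalerDr !scalerA mulrC.
  + move=> l' r' b a u v; rewrite /cterm l2 !has_cat /=.
    by rewrite tmul_linearr scalerDr !scalerA mulrC.
- move=> q x xh; rewrite bim_cupE cut2_map.
  apply: homog_cut2 => l r lrx; apply: homog_fsum => t; apply: homogZ.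
  rewrite /tmul; case: ifP => _; first exact: homog0.
  pose l' := [seq (u.1, (u.2.1, koszul t u.2.2)) | u <- l].
  have -> : kz t [seq u.2 | u <- l] = [seq u.2 | u <- l'] by rewrite /l' /kz -!map_comp.
  have -> : \sum_(u <- x) u.1 + q =
      (\sum_(u <- l') u.1 + (q - t)) + (\sum_(u <- r) u.1 + t).
    by rewrite -lrx /l' big_cat big_map /=; ring.
  apply: homogM; apply: bim_degree => // u.
    by move=> /mapP[v vl ->] /=; apply: homog_koszul; apply: xh; rewrite -lrx mem_cat vl.
  by move=> ur; apply: xh; rewrite -lrx mem_cat ur orbT.
- move=> q x cx; rewrite bim_cupE; apply: cut2_0 => l r lrx; apply: fsum0 => t.
  apply/eqP; apply: contraT => /cterm_neq0[nz1 nz2]; rewrite !has_count => nt.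
  have : (count fst (kz t l) <= 1)%N.
    by rewrite leqNgt; apply: contra_neqN nz1 => /(bim_typed _ c1S).
  have : (count fst r <= 1)%N.
    by rewrite leqNgt; apply: contra_neqN nz2 => /(bim_typed _ c2S).
  by move: cx nt; rewrite -lrx count_cat count_kz; lia.
exists (N1 + N2)%N => q x; rewrite bim_cupE => nz.
have [l [r [t [lrx nzt]]]] : exists l r t, l ++ r = x /\ cterm c1 c2 q t l r != 0.
  apply: contrapT => no; move/eqP: nz; apply; apply: cut2_0 => l r lrx; apply: fsum0 => t.
  by apply/eqP; apply: contra_notT no => nz; exists l, r, t.
have [/c1N/andP[s1 q1] /c2N/andP[s2 q2] _] := cterm_neq0 nzt.
by move: s1; rewrite -lrx size_cat size_kz; lia.
Qed.

End CupClosure.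

(** * Sign-free form of the operations on cochains *)

Section Total.
Variables (k : fieldType) (A : gradedAlgType k).
Implicit Types (l m r x y z : seq (input A)) (c : cochain A) (q t : int) (e : bool).

(** The sign of the isomorphism between operations on A and on its
    suspension: an input gets the sign of its shifted degree once for each
    input on its right. *)
Fixpoint twist x : seq (input A) :=
  if x is u :: r then (u.1, sg (odd (size r)) u.2) :: twist r else [::].

Lemma size_twist x : size (twist x) = size x.
Proof. by elim: x => //= u x ->. Qed.

Lemma has_twist x : has fst (twist x) = has fst x.
Proof. by elim: x => //= u x ->. Qed.

Lemma twist_hat e x : twist (hat e x) = hat e (twist x).
Proof. by elim: x => //= u x ->; rewrite size_hat !sg_sg addbC. Qed.

Lemma twist_cat l r : twist (l ++ r) = hat (odd (size r)) (twist l) ++ twist r.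
Proof.
by elim: l => //= u l ->; rewrite sg_sg size_cat oddD addbC.
Qed.

Lemma twist_mid l w r : twist (l ++ w :: r) =
  hat (~~ odd (size r)) (twist l) ++ (w.1, sg (odd (size r)) w.2) :: twist r.
Proof. by rewrite twist_cat. Qed.

Lemma twistK x : twist (twist x) = x.
Proof.
by elim: x => //= u x ->; rewrite size_twist sg_sg addbb; case: u.
Qed.

Lemma cut2_twist (F : seq (input A) -> seq (input A) -> A) x :
  cut2 F (twist x) = cut2 (fun l r => F (hat (odd (size r)) (twist l)) (twist r)) x.
Proof.
elim: x F => [|u x IH] F; first by rewrite !cut2_nil.
rewrite /= !cut2_cons IH; congr (_ + _); apply: eq_cut2 => l r <- /=.
by rewrite sg_sg size_cat oddD addbC.
Qed.

(** The operation on the suspension of A induced by a cochain. The components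
    of all degrees are added, which loses nothing by totf_inj. *)
Definition totf c : mmap A := fun x => \sum_(q \in [set: int]) c q (twist x).

(** The parity of the shifted total degree |c| - 1 is e. In characteristic 2
    signs are void and every cochain has both parities. *)
Definition par e c : Prop := forall q x, c q x != 0 ->
  (2 \in [pchar k])%N || (odd `|(size x)%:Z + q| == ~~ e).

Lemma sum_odd_homog (x : seq (int * input A)) e :
  (forall u, u \in x -> homog u.1 u.2.2) -> forall f : mmap A, multilinear f ->
  f (hat e [seq u.2 | u <- x]) =
  (-1) ^+ (e && odd `|\sum_(u <- x) u.1 + (size x)%:Z|) *: f [seq u.2 | u <- x].
Proof.
elim: x => [|[i [b u]] x IH] xh f fl; first by rewrite big_nil andbF scale1r.
rewrite /= (sg_homog e (i := i)); last by apply: (xh (i, (b, u))); rewrite inE eqxx.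
rewrite -[_ :: hat _ _]cat0s multilinearZ //=.
rewrite (IH _ (fun y => f ((b, u) :: y))); first last.
- by move=> l r b' a' u' v'; have := fl ((b, u) :: l) r b' a' u' v'.
- by move=> v vx; apply: xh; rewrite inE vx orbT.
rewrite scalerA -signr_addb big_cons -andb_addr /=; congr ((-1) ^+ nat_of_bool (_ && _) *: _).
set s := \sum_(u <- x) _; lia.
Qed.

Lemma bim_hat c q e x : c \in bim_cochains A ->
  c q (hat e x) = (-1) ^+ (e && ~~ odd `|(size x)%:Z + q|) *: sg e (c q x).
Proof.
move=> cS; have cl := bim_multilinear q cS; move: x; apply: multilinear_ext.
- exact: multilinear_hat.
- move=> l r b a u v; rewrite !size_cat /= cl sg_linear scalerDr !scalerA; congr (_ *: _ + _).
  by rewrite mulrC.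
move=> x xh; rewrite (sum_odd_homog e xh cl) (sg_homog e (bim_degree q cS xh)).
rewrite scalerA -signr_addb -andb_addr size_map; congr ((-1) ^+ nat_of_bool (_ && _) *: _).
lia.
Qed.

Lemma koszul_slots c q t l x : c \in bim_cochains A ->
  c q (kz t l ++ x) = (-1) ^+ (odd `|t| && odd (size l)) *: c q (hat (odd `|t|) l ++ x).
Proof.
move=> cS; have cl := bim_multilinear q cS.
suff H y : c q (y ++ kz t l ++ x) =
    (-1) ^+ (odd `|t| && odd (size l)) *: c q (y ++ hat (odd `|t|) l ++ x) by apply: (H [::]).
elim: l y => [|u l IH] y /=; first by rewrite andbF scale1r.
rewrite koszul_sg multilinearZ // -!cat_rcons IH scalerA -signr_addb.
by congr ((-1) ^+ nat_of_bool _ *: _); case: (odd `|t|) => //=; case: (odd _).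
Qed.

Lemma multilinear_totf c : c \in bim_cochains A -> multilinear (totf c).
Proof.
move=> cS; have [N cN] := bim_finite cS.
apply: (@multilinear_fsum _ _ (fun q x => c q (twist x)) N) => [q|q x /cN /andP[] //].
move=> l r b a u v; rewrite !twist_mid /= sg_linear.
exact: (bim_multilinear q cS).
Qed.

Lemma sign_homog_totf e c : c \in bim_cochains A -> par e c -> sign_homog e (totf c).
Proof.
move=> cS ce x; rewrite /totf twist_hat; have [N cN] := bim_finite cS.
have cN' q : c q (twist x) != 0 -> (`|q| <= N)%N by move=> /cN/andP[].
rewrite -(linear_scale _ _ (sg_linear true)).
rewrite (fsum_linear (f := fun v : A => sg true ((-1) ^+ e *: v))); first last.
- exact: finite_zset cN'.
- by move=> a u v; rewrite scalerDr !scalerA mulrC -scalerA sg_linear.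
apply: eq_fsum => q; rewrite bim_hat //= (linear_scale _ _ (sg_linear true)).
have [->|nz] := eqVneq (c q (twist x)) 0; first by rewrite (linear_at0 (sg_linear _)) !scaler0.
have /orP[k2|/eqP ->] := ce _ _ nz; last by rewrite negbK.
have -> : (-1 : k) = 1 by apply/eqP; rewrite eq_sym -addr_eq0 -(pcharf0 k2).
by rewrite !expr1n.
Qed.

End Total.

Section TotalOperations.
Variables (k : fieldType) (A : gradedAlgType k).
Implicit Types (l m r x y z : seq (input A)) (c : cochain A) (q t : int) (e : bool).

Lemma cut3_twist (F : seq (input A) -> seq (input A) -> seq (input A) -> A) x :
  cut3 F (twist x) = cut3 (fun l m r => F (hat (odd (size (m ++ r))) (twist l))
    (hat (odd (size r)) (twist m)) (twist r)) x.
Proof.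
rewrite /cut3 cut2_twist; apply: eq_cut2 => l y _; rewrite cut2_twist.
by apply: eq_cut2 => m r ->.
Qed.

Lemma signr_char2 (b : bool) : (2 \in [pchar k])%N -> (-1 : k) ^+ b = 1.
Proof.
move=> k2; suff -> : (-1 : k) = 1 by rewrite expr1n.
by apply/eqP; rewrite eq_sym -addr_eq0 -(pcharf0 k2).
Qed.

Lemma hat_char2 e x : (2 \in [pchar k])%N -> hat e x = x.
Proof.
by move=> k2; rewrite /hat -[RHS]map_id; apply: eq_map => -[b u]; rewrite /= sg_char2.
Qed.

Lemma fsum_cut2 (F : int -> seq (input A) -> seq (input A) -> A) N x :
  (forall t l r, F t l r != 0 -> (`|t| <= N)%N) ->
  \sum_(t \in [set: int]) cut2 (F t) x =
  cut2 (fun l r => \sum_(t \in [set: int]) F t l r) x.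
Proof. by move=> FN; rewrite /cut2 (@fsum_sum _ _ _ _ _ N) // => i t; apply: FN. Qed.

Lemma fsum_cut3 (F : int -> seq (input A) -> seq (input A) -> seq (input A) -> A) N x :
  (forall t l m r, F t l m r != 0 -> (`|t| <= N)%N) ->
  \sum_(t \in [set: int]) cut3 (F t) x =
  cut3 (fun l m r => \sum_(t \in [set: int]) F t l m r) x.
Proof.
move=> FN; rewrite /cut3 (@fsum_cut2 _ N) => [|t l r].
  by apply: eq_cut2 => l y _; apply: (@fsum_cut2 _ N) => t m r; apply: FN.
by apply: contraNT => tN; apply/eqP/cut2_0 => m r' _; apply/eqP; apply: contraNT tN; apply: FN.
Qed.

Lemma odd_absD (a b : int) : odd `|a + b| = odd `|a| (+) odd `|b|.
Proof. lia. Qed.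

(** The sign in the definition of the composition is the effect of the twist,
    except for the sign of c2 moving past the inputs on its left. *)
Lemma totf_brace e c1 c2 : c1 \in bim_cochains A -> c2 \in bim_cochains A ->
  par e c2 -> totf (brace c1 c2) = insert e (totf c2) (totf c1) :> mmap A.
Proof.
move=> c1S c2S c2e; have [N1 c1N] := bim_finite c1S; have [N2 c2N] := bim_finite c2S.
have t1l := multilinear_totf c1S; apply/funext => x; rewrite /totf.
under eq_fsum do rewrite /brace wbraceE cut3_twist.
pose G a t l m r : A := c1 a (twist (hat e l ++ (has fst m, c2 t (twist m)) :: r)).
(* The signs of wterm and of the twists of the three pieces cancel, up to the *)
(* hat on l, by the condition on the parity of c2. *)
have GE q t l m r : wterm (fun _ _ _ _ => 1) c1 c2 q t (hat (odd (size (m ++ r))) (twist l))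
    (hat (odd (size r)) (twist m)) (twist r) = G (q - t) t l m r.
  rewrite /wterm scale1r /G twist_mid twist_hat /out !size_hat !size_twist has_hat has_twist.
  rewrite koszul_slots // size_hat size_twist bim_hat // !hat_hat /=.
  have l1 := bim_multilinear (q - t) c1S; rewrite multilinearZ // !scalerA.
  have [->|nz] := eqVneq (c2 t (twist m)) 0.
    by rewrite (linear_at0 (sg_linear _)) !multilinear0 ?scaler0.
  have := c2e _ _ nz; rewrite size_twist => /orP[k2|/eqP pe].
    rewrite signz_parity !signr_char2 // !mulr1 scale1r; congr (c1 _ (_ ++ _)).
    by rewrite !hat_char2.
  rewrite signz_parity -!signr_addb.
  have -> : odd `|t| (+) odd (size (m ++ r)) = ~~ odd (size r) (+) e.
    by move: pe; rewrite size_cat; case: e {c2e G} => /=; lia.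
  set b := _ (+) _; have -> : b = false; last by rewrite scale1r.
  rewrite /b; clear b; move: pe; set p := size l; set s := size m; set n := size r.
  have eqb (u v : bool) : u (+) v = ~~ (u == v) by case: u v => [] [].
  move=> pe; have -> : odd `|(s%:Z - 1) * n%:Z + t * (p + n)%N%:Z| =
    ((~~ odd s) && odd n) (+) (odd `|t| && (odd p (+) odd n)).
    by rewrite odd_absD !abszM !oddM /= oddD; congr ((_ && _) (+) _); lia.
  have -> : odd s = odd `|t| (+) ~~ e by move: pe; case: e {c2e G}; lia.
  have -> : ~~ odd `|s%:Z + t| = e by rewrite pe negbK.
  by case: e {c2e G pe} => /=; case: (odd n) (odd `|t|) (odd p) => [] [] [].
transitivity (cut3 (fun l m r => \sum_(q \in [set: int]) \sum_(t \in [set: int])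
    G (q - t) t l m r) x).
  rewrite -(@fsum_cut3 _ (N1 + N2)%N).
    apply: eq_fsum => q; apply: eq_cut3 => l m r _; apply: eq_fsum => t.
    exact: GE.
  move=> q l m r /fsum_neq0[t]; rewrite -GE => /(wterm_neq0 c1S)[/c1N /andP[_ ?] /c2N /andP[_ ?]]; lia.
apply: eq_cut3 => l m r _.
rewrite (fsum_conv (N := maxn N1 N2) (F := fun a t => G a t l m r)); last first.
  move=> a t; rewrite /G => nz.
  have /c2N : c2 t (twist m) != 0.
    by apply: contra_neq nz => ->; rewrite twist_mid (linear_at0 (sg_linear _)) multilinear0 //; apply: bim_multilinear.
  by move: nz => /c1N; lia.
rewrite -/(totf c1 _) /out (fsum_linear (multilinear_slot (hat e l) r (has fst m) t1l)) //.
by apply: (finite_zset (N := N2)) => t /c2N /andP[].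
Qed.

Lemma totf_cup e c1 c2 : c1 \in bim_cochains A -> c2 \in bim_cochains A ->
  par e c2 -> totf (cup (bim_m2 A) c1 c2) = cupf e (totf c1) (totf c2) :> mmap A.
Proof.
move=> c1S c2S c2e; have [N1 c1N] := bim_finite c1S; have [N2 c2N] := bim_finite c2S.
apply/funext => x; rewrite /totf.
under eq_fsum do rewrite bim_cupE cut2_twist.
pose G a t l r : A := tmul (has fst l && has fst r) (c1 a (twist (hat (~~ e) l))) (c2 t (twist r)).
have GE q t l r : cterm c1 c2 q t (hat (odd (size r)) (twist l)) (twist r) = G (q - t) t l r.
  rewrite /cterm /G has_hat !has_twist size_hat size_twist.
  rewrite -[kz _ _]cats0 koszul_slots // size_hat size_twist cats0.
  have [->|nz] := eqVneq (c2 t (twist r)) 0.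
    by rewrite !(linear_at0 (tmul_linearr _ _)) scaler0.
  rewrite (linear_scale _ _ (tmul_linearl _ _)) scalerA signz_parity abszM oddM -signr_addb.
  rewrite addbb scale1r twist_hat hat_hat; have := c2e _ _ nz.
  rewrite size_twist => /orP[k2|/eqP pe]; first by rewrite !hat_char2.
  by congr (tmul _ (c1 _ (hat _ _)) _); rewrite -pe; lia.
transitivity (cut2 (fun l r => \sum_(q \in [set: int]) \sum_(t \in [set: int])
    G (q - t) t l r) x).
  rewrite -(@fsum_cut2 _ (N1 + N2)%N).
    by apply: eq_fsum => q; apply: eq_cut2 => l r _; apply: eq_fsum => t; apply: GE.
  move=> q l r /fsum_neq0[t]; rewrite -GE => /cterm_neq0[/c1N /andP[_ ?] /c2N /andP[_ ?] _]; lia.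
apply: eq_cut2 => l r _.
have Gnz a t : G a t l r != 0 -> (`|a| <= N1)%N && (`|t| <= N2)%N.
  move=> nz; apply/andP; split.
    have /c1N/andP[_ //] : c1 a (twist (hat (~~ e) l)) != 0.
    by apply: contra_neq nz; rewrite /G => ->; rewrite (linear_at0 (tmul_linearl _ _)).
  have /c2N/andP[_ //] : c2 t (twist r) != 0.
  by apply: contra_neq nz; rewrite /G => ->; rewrite (linear_at0 (tmul_linearr _ _)).
rewrite (fsum_conv (N := maxn N1 N2) (F := fun a t => G a t l r)) => [|a t /Gnz]; last lia.
rewrite (fsum_linear (tmul_linearr _ _)); last first.
  by apply: (finite_zset (N := N2)) => t /c2N /andP[].
apply: eq_fsum => t; rewrite (fsum_linear (tmul_linearl _ _)) //.
by apply: (finite_zset (N := N1)) => a /c1N /andP[].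
Qed.

End TotalOperations.

Section CochainAlgebra.
Variables (k : fieldType) (A : gradedAlgType k).
Implicit Types (l m r x y z : seq (input A)) (c : cochain A) (q t : int) (e : bool).

Let W : lmodType k := mmap A.
Let C : lmodType k := cochain A.
Local Notation bim := (bim_cochains A).
Local Notation m2 := (bim_m2 A).

Lemma fsum_lin_window (V : lmodType k) N a (F G : int -> V) :
  (forall t, F t != 0 -> (`|t| <= N)%N) -> (forall t, G t != 0 -> (`|t| <= N)%N) ->
  \sum_(t \in [set: int]) (a *: F t + G t) =
  a *: \sum_(t \in [set: int]) F t + \sum_(t \in [set: int]) G t.
Proof.
move=> FN GN; rewrite (fsum_window FN) (fsum_window GN) (@fsum_window _ _ N).
  by rewrite scaler_sumr -big_split.
move=> t; apply: contraNT => tN.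
have -> : F t = 0 by apply/eqP; apply: contraNT tN; apply: FN.
have -> : G t = 0 by apply/eqP; apply: contraNT tN; apply: GN.
by rewrite scaler0 addr0.
Qed.

Lemma bim_finite2 c c' : c \in bim -> c' \in bim ->
  exists N : nat, (forall q x, c q x != 0 -> (size x <= N)%N && (`|q| <= N)%N) /\
                  (forall q x, c' q x != 0 -> (size x <= N)%N && (`|q| <= N)%N).
Proof.
move=> /bim_finite[N cN] /bim_finite[N' cN']; exists (maxn N N').
by split=> q x => [/cN|/cN']; lia.
Qed.

Lemma wbrace_linl w c c1 c1' a : c1 \in bim -> c1' \in bim -> c \in bim ->
  wbrace w (a *: c1 + c1' : C) c = a *: wbrace w c1 c + wbrace w c1' c :> C.
Proof.
move=> c1S c1S' cS; have [N cN] := bim_finite cS.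
apply/funext => q; apply/funext => x; rewrite !fctE !wbraceE -cut3Z -cut3D.
apply: eq_cut3 => l m r _; rewrite -(@fsum_lin_window _ N); first last.
- by move=> t /(wterm_neq0 c1S')[_ /cN /andP[]].
- by move=> t /(wterm_neq0 c1S)[_ /cN /andP[]].
by apply: eq_fsum => t; rewrite /wterm !fctE !scalerDr !scalerA; congr (_ *: _ + _); ring.
Qed.

Lemma wbrace_linr w c c2 c2' a : c2 \in bim -> c2' \in bim -> c \in bim ->
  wbrace w c (a *: c2 + c2' : C) = a *: wbrace w c c2 + wbrace w c c2' :> C.
Proof.
move=> c2S c2S' cS; have [N [cN cN']] := bim_finite2 c2S c2S'.
apply/funext => q; apply/funext => x; rewrite !fctE !wbraceE -cut3Z -cut3D.
apply: eq_cut3 => l m r _; rewrite -(@fsum_lin_window _ N); first last.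
- by move=> t /(wterm_neq0 cS)[_ /cN' /andP[]].
- by move=> t /(wterm_neq0 cS)[_ /cN /andP[]].
apply: eq_fsum => t; have cl := bim_multilinear (q - t) cS.
by rewrite /wterm /out !fctE cl !scalerDr !scalerA; congr (_ *: _ + _); ring.
Qed.

Lemma cup_linl c c1 c1' a : c1 \in bim -> c1' \in bim -> c \in bim ->
  cup m2 (a *: c1 + c1' : C) c = a *: cup m2 c1 c + cup m2 c1' c :> C.
Proof.
move=> c1S c1S' cS; have [N cN] := bim_finite cS.
apply/funext => q; apply/funext => x; rewrite !fctE !bim_cupE -cut2Z -cut2D.
apply: eq_cut2 => l r _; rewrite -(@fsum_lin_window _ N); first last.
- by move=> t /cterm_neq0[_ /cN /andP[]].
- by move=> t /cterm_neq0[_ /cN /andP[]].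
by apply: eq_fsum => t; rewrite /cterm !fctE tmul_linearl !scalerDr !scalerA mulrC.
Qed.

Lemma cup_linr c c2 c2' a : c2 \in bim -> c2' \in bim -> c \in bim ->
  cup m2 c (a *: c2 + c2' : C) = a *: cup m2 c c2 + cup m2 c c2' :> C.
Proof.
move=> c2S c2S' cS; have [N [cN cN']] := bim_finite2 c2S c2S'.
apply/funext => q; apply/funext => x; rewrite !fctE !bim_cupE -cut2Z -cut2D.
apply: eq_cut2 => l r _; rewrite -(@fsum_lin_window _ N); first last.
- by move=> t /cterm_neq0[_ /cN' /andP[]].
- by move=> t /cterm_neq0[_ /cN /andP[]].
by apply: eq_fsum => t; rewrite /cterm !fctE tmul_linearr !scalerDr !scalerA mulrC.
Qed.

Lemma totf_linear a c c' : c \in bim -> c' \in bim ->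
  totf (a *: c + c' : C) = a *: totf c + totf c' :> W.
Proof.
move=> cS cS'; have [N [cN cN']] := bim_finite2 cS cS'.
apply/funext => x; rewrite !fctE /totf -(@fsum_lin_window _ N) //.
  by move=> t /cN /andP[].
by move=> t /cN' /andP[].
Qed.

(** On homogeneous inputs the components of different degrees take values in
    different degrees, so that their sum determines each of them. *)
Lemma totf_inj c c' : c \in bim -> c' \in bim -> totf c = totf c' :> mmap A -> c = c'.
Proof.
move=> cS cS' cc'; apply/funext => q; apply/funext.
apply: multilinear_ext; try exact: bim_multilinear.
move=> x xh.
have E b : b \in bim -> b q [seq u.2 | u <- x] =
    hcomp (\sum_(u <- x) u.1 + q) (totf b (twist [seq u.2 | u <- x])).
  move=> bS; have [N bN] := bim_finite bS.
  rewrite /totf twistK (fsum_linear (@hcomp_linear _ _ _)); last first.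
    by apply: (finite_zset (N := N)) => t /bN /andP[].
  rewrite (@fsum_unique _ _ q); first by rewrite (bim_degree q bS xh).
  move=> t tq; rewrite -(bim_degree t bS xh) hcompK; case: eqP => // /addrI qt.
  by rewrite qt eqxx in tq.
by rewrite !E // cc'.
Qed.

Lemma par_brace e1 e2 c1 c2 : c1 \in bim -> par e1 c1 -> par e2 c2 ->
  par (e1 (+) e2) (brace c1 c2).
Proof.
move=> c1S c1e c2e q x nz.
have [l [m [r [t [lmr nzt]]]]] : exists l m r t, l ++ m ++ r = x /\
    wterm (fun _ _ _ _ => 1) c1 c2 q t l m r != 0.
  apply: contrapT => no; move/eqP: nz; apply; rewrite /brace wbraceE; apply: cut3_0 => l m r lmr.
  apply: fsum0 => t; by apply/eqP; apply: contra_notT no => nz; exists l, m, r, t.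
have [/c1e/orP[-> //|p1] /c2e/orP[-> //|p2]] := wterm_neq0 c1S nzt.
apply/orP; right; move: p1 p2; rewrite -lmr !size_cat /= size_kz.
by case: e1 {c1e}; case: e2 {c2e} => /=; lia.
Qed.

Lemma par_cup e1 e2 c1 c2 : par e1 c1 -> par e2 c2 ->
  par (~~ (e1 (+) e2)) (cup m2 c1 c2).
Proof.
move=> c1e c2e q x nz.
have [l [r [t [lr nzt]]]] : exists l r t, l ++ r = x /\ cterm c1 c2 q t l r != 0.
  apply: contrapT => no; move/eqP: nz; apply; rewrite bim_cupE; apply: cut2_0 => l r lr.
  apply: fsum0 => t; by apply/eqP; apply: contra_notT no => nz; exists l, r, t.
have [/c1e/orP[-> //|p1] /c2e/orP[-> //|p2] _] := cterm_neq0 nzt.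
apply/orP; right; move: p1 p2; rewrite -lr size_cat size_kz.
by case: e1 {c1e}; case: e2 {c2e} => /=; lia.
Qed.

Lemma par_lin e a c c' : par e c -> par e c' -> par e (a *: c + c' : C).
Proof.
move=> ce ce' q x; rewrite !fctE; have [->|/ce //] := eqVneq (c q x) 0.
by rewrite scaler0 add0r => /ce'.
Qed.

(** The weight depends on the parities of the shifted degrees only. *)
Lemma wbrace_sign e1 e2 c1 c2 : c1 \in bim -> par e1 c1 -> par e2 c2 ->
  wbrace (fun p q s t => (-1) ^ ((p%:Z + q - 1) * (s%:Z + t - 1))) c1 c2 =
  (-1) ^+ (e1 && e2) *: brace c1 c2 :> C.
Proof.
move=> c1S c1e c2e; apply/funext => q; apply/funext => x.
rewrite !fctE /brace !wbraceE -cut3Z; apply: eq_cut3 => l m r _.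
rewrite (fsum_linear (f := fun v : A => (-1) ^+ (e1 && e2) *: v)); first last.
- have [N c1N] := bim_finite c1S; apply: (@finite_zset _ _ (N + `|q|)) => t.
  by move=> /(wterm_neq0 c1S)[/c1N /andP[_] + _]; lia.
- by move=> a u v; rewrite scalerDr !scalerA mulrC.
apply: eq_fsum => t; set v := wterm (fun _ _ _ _ => 1) _ _ _ _ _ _ _.
have -> : wterm (fun p q s t => (-1) ^ ((p%:Z + q - 1) * (s%:Z + t - 1))) c1 c2 q t l m r =
    (-1) ^ (((size l + size r).+1%:Z + (q - t) - 1) * ((size m)%:Z + t - 1)) *: v.
  by rewrite /v /wterm scale1r.
have [->|nz] := eqVneq v 0; first by rewrite !scaler0.
congr (_ *: _); rewrite signz_parity.
have [/c1e/orP[k2|p1] /c2e/orP[k2'|p2]] := wterm_neq0 c1S nz;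
  try by rewrite !signr_char2.
rewrite abszM oddM; congr ((-1) ^+ nat_of_bool (_ && _)).
  by move: p1; rewrite size_cat /= size_kz; case: e1 {c1e}; lia.
by case: e2 p2 {c2e}; lia.
Qed.

Lemma bracket_par e1 e2 c1 c2 : c1 \in bim -> c2 \in bim -> par e1 c1 -> par e2 c2 ->
  bracket c1 c2 = brace c1 c2 - (-1) ^+ (e1 && e2) *: brace c2 c1 :> C.
Proof.
by move=> c1S c2S c1e c2e; rewrite andbC -(wbrace_sign c2S c2e c1e).
Qed.

End CochainAlgebra.

(** * Functions that come from cochains *)

Section Realization.
Variables (k : fieldType) (A : gradedAlgType k).
Implicit Types (l m r x y z : seq (input A)) (c : cochain A) (f g a b : mmap A).
Implicit Types (q t : int) (e : bool).

Let W : lmodType k := mmap A.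
Let C : lmodType k := cochain A.
Local Notation bim := (bim_cochains A).

(** The functions that come from cochains concentrated in degree q. *)
Definition pure q f : Prop :=
  [/\ multilinear f,
      forall x : seq (int * input A), (forall u, u \in x -> homog u.1 u.2.2) ->
        homog (\sum_(u <- x) u.1 + q) (f [seq u.2 | u <- x]),
      forall x, (1 < count fst x)%N -> f x = 0
    & exists N : nat, forall x, f x != 0 -> (size x <= N)%N].

(** The brace with two arguments is defined on functions of lists only;
    realizability gives the cochain that is needed as a homotopy. *)
Definition realizable f : Prop := exists2 c, c \in bim & totf c = f.

Lemma homog_twist (x : seq (int * input A)) : (forall u, u \in x -> homog u.1 u.2.2) ->
  exists y : seq (int * input A), [/\ forall u, u \in y -> homog u.1 u.2.2,
    twist [seq u.2 | u <- x] = [seq u.2 | u <- y] & \sum_(u <- y) u.1 = \sum_(u <- x) u.1].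
Proof.
elim: x => [|[i [b u]] x IH] xh; first by exists [::].
have [y [yh yE ys]] := IH (fun v vx => xh v (mem_behead (s := _ :: _) vx)).
exists ((i, (b, sg (odd (size x)) u)) :: y); split.
- move=> v; rewrite inE => /predU1P[->|/yh //] /=; apply: homog_sg.
  by apply: (xh (i, (b, u))); rewrite mem_head.
- by rewrite /= yE size_map.
by rewrite !big_cons ys.
Qed.

Lemma count_twist x : count fst (twist x) = count fst x.
Proof. by elim: x => //= u x ->. Qed.

Lemma multilinear_twist f : multilinear f -> multilinear (fun x => f (twist x)).
Proof. by move=> fl l r b a u v; rewrite !twist_mid /= sg_linear fl. Qed.

Lemma pure_twist q f : pure q f -> pure q (fun x => f (twist x)).
Proof.
move=> [fl fh ft [N fN]]; split; first exact: multilinear_twist.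
- by move=> x /homog_twist[y [yh -> <-]]; apply: fh.
- by move=> x cx; apply: ft; rewrite count_twist.
by exists N => x /fN; rewrite size_twist.
Qed.

Lemma realizable_pure q f : pure q f -> realizable f.
Proof.
move=> /pure_twist[fl fh ft [N fN]].
exists (fun q' x => if q' == q then f (twist x) else 0).
  apply/bimP; split.
  - by move=> q' l r b a u v; case: eqP => _; rewrite ?fl ?scaler0 ?addr0.
  - by move=> q' x xh; case: eqP => [->|_]; [apply: fh | apply: homog0].
  - by move=> q' x cx; case: eqP => // _; apply: ft.
  exists (maxn N `|q|) => q' x; case: (q' =P q) => [->|_]; last by rewrite eqxx.
  by move=> /fN; lia.
apply/funext => x; rewrite /totf (@fsum_unique _ _ q) ?eqxx ?twistK // => t.
by move=> /negPf ->.
Qed.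

Lemma realizableD f g : realizable f -> realizable g -> realizable (f + g : W).
Proof.
move=> [c cS <-] [c' cS' <-]; exists (c + c' : C); first exact: rpredD.
by have := totf_linear 1 cS cS'; rewrite !scale1r.
Qed.

Lemma realizable0 : realizable (0 : W).
Proof.
exists 0; first exact: rpred0.
by apply/funext => x; rewrite /totf fsum0.
Qed.

(** A function realized by a cochain is a finite sum of pure functions, which
    reduces closure under multiadditive operations to pure functions. *)
Lemma totf_pure (P : mmap A -> Prop) c : c \in bim -> P (0 : W) ->
  (forall f g, P f -> P g -> P (f + g : W)) -> (forall q f, pure q f -> P f) ->
  P (totf c).
Proof.
move=> cS P0 PD Pp; have [N cN] := bim_finite cS.
have -> : totf c = \sum_(q <- zwindow N) (fun x => c q (twist x)) :> W.
  apply/funext => x; rewrite fct_sumE; apply: fsum_window => q /cN /andP[] //.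
apply: big_ind => // q _; apply: (Pp q); apply: (@pure_twist q (c q)); split.
- exact: bim_multilinear.
- by move=> x; apply: bim_degree.
- by move=> x; apply: bim_typed.
by exists N => x /cN /andP[].
Qed.

Lemma multilinear_insert e b f : multilinear b -> multilinear f -> multilinear (insert e b f).
Proof.
move=> bl fl; apply: multilinear_cut3_fun => [m r|l r|l m].
- exact: multilinear_hat_left.
- have := multilinear_mid 0 (hat e l) r fl bl; apply: eq_multilinear => y.
  by rewrite /kz; congr (f (_ ++ _)); rewrite -[LHS]map_id; apply: eq_map => -[t u]; rewrite koszul_sg scale1r.
exact: multilinear_right.
Qed.

Lemma count_out_le1 b l m r :
  (count fst m <= 1)%N -> count fst (l ++ out b m :: r) = count fst (l ++ m ++ r).
Proof.
by rewrite !count_cat /= has_count; case: (count fst m) => [|[|]].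
Qed.

Lemma pure_insert2 eb b ec (c : mmap A) f s t u : pure s b -> pure t c -> pure u f ->
  pure (u + s + t) (insert2 eb b ec c f).
Proof.
move=> [bl bh bt [Nb bN]] [cl ch ct [Nc cN]] [fl fh ft [Nf fN]].
have gl p r : multilinear (fun z => f (hat ec z ++ out c p :: r)).
  exact: multilinear_hat_left.
have nz x : insert2 eb b ec c f x != 0 -> exists l m n p r,
  [/\ x = (l ++ m ++ n) ++ p ++ r, b m != 0, c p != 0 &
      f (hat ec (hat eb l ++ out b m :: n) ++ out c p :: r) != 0].
  move=> nz; apply: contrapT => no; move/eqP: nz; apply; apply: cut3_0 => y p r ypr.
  apply: cut3_0 => l m n lmn; apply/eqP; apply: contra_notT no => nz.
  exists l, m, n, p, r; split; rewrite ?lmn ?ypr //.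
    apply: contra_neq nz => b0; rewrite hat_cat /out /= b0 (linear_at0 (sg_linear _)).
    by rewrite -catA multilinear0.
  by apply: contra_neq nz => c0; rewrite /out c0 multilinear0.
split.
- apply: multilinear_cut3_fun => [p r|y r|y p].
  + exact: multilinear_insert.
  + move=> l' r' t' a v w; rewrite -insertZ -insertD; apply: eq_insert => z.
    by rewrite /out cl fl !has_cat.
  move=> l' r' t' a v w; rewrite -insertZ -insertD; apply: eq_insert => z.
  exact: multilinear_right.
- move=> x xh; rewrite /insert2 cut3_map; apply: homog_cut2 => y w ywx.
  apply: homog_cut2 => p r prw; rewrite /insert cut3_map.
  apply: homog_cut2 => l v lvy; apply: homog_cut2 => m n mnv.
  pose sgs e := map (fun u : int * input A => (u.1, (u.2.1, sg e u.2.2))).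
  pose x' := sgs ec (sgs eb l ++ (\sum_(u <- m) u.1 + s, out b [seq u.2 | u <- m]) :: n) ++
    (\sum_(u <- p) u.1 + t, out c [seq u.2 | u <- p]) :: r.
  have xE : x = (l ++ m ++ n) ++ p ++ r by rewrite mnv lvy prw.
  have -> : hat ec (hat eb [seq u.2 | u <- l] ++ out b [seq u.2 | u <- m] :: [seq u.2 | u <- n])
     ++ out c [seq u.2 | u <- p] :: [seq u.2 | u <- r] = [seq u.2 | u <- x'].
    by rewrite /x' /sgs /hat ?map_cat /= ?map_cat /= -?map_comp.
  have -> : \sum_(u <- x) u.1 + (u + s + t) = \sum_(u <- x') u.1 + u.
    rewrite xE /x' /sgs !map_cat !big_cat /= !big_cons !big_map /=; ring.
  apply: fh => i; rewrite mem_cat inE => /or3P[/mapP[j + ->]|/eqP ->|ir] /=.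
  + rewrite mem_cat inE => jin; apply: homog_sg.
    case/or3P: jin => [/mapP[j' j'l ->] /=|/eqP -> /=|jn].
    * by apply: homog_sg; apply: xh; rewrite xE !mem_cat j'l.
    * by apply: bh => h hm; apply: xh; rewrite xE !mem_cat hm !orbT.
    by apply: xh; rewrite xE !mem_cat jn !orbT.
  + by apply: ch => h hm; apply: xh; rewrite xE !mem_cat hm !orbT.
  by apply: xh; rewrite xE !mem_cat ir !orbT.
- move=> x cx; apply/eqP; apply: contraT => /nz[l [m [n [p [r [xE b0 c0 f0]]]]]].
  have mle : (count fst m <= 1)%N by rewrite leqNgt; apply: contra_neqN b0; apply: bt.
  have ple : (count fst p <= 1)%N by rewrite leqNgt; apply: contra_neqN c0; apply: ct.
  move: cx f0; rewrite xE => cx /eqP[]; apply: ft; rewrite count_out_le1 //.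
  by rewrite count_cat count_hat count_out_le1 // !count_cat count_hat -!count_cat.
exists (Nf + Nb + Nc)%N => x /nz[l [m [n [p [r [-> /bN ? /cN ? /fN]]]]]].
by rewrite !size_cat /= !size_hat !size_cat /= !size_hat; lia.
Qed.

Lemma insert2_linearr eb b ec f (u : k) (c c' : mmap A) : multilinear f ->
  insert2 eb b ec (u *: c + c' : W) f = u *: insert2 eb b ec c f + insert2 eb b ec c' f :> W.
Proof.
move=> fl; apply/funext => x; rewrite !fctE /insert2 -cut3Z -cut3D; apply: eq_cut3 => y p r _.
by rewrite -insertZ -insertD; apply: eq_insert => z; rewrite /out ?fctE fl.
Qed.

Lemma insert2_linearm eb ec (c : mmap A) f (u : k) b b' : multilinear f ->
  insert2 eb (u *: b + b' : W) ec c f = u *: insert2 eb b ec c f + insert2 eb b' ec c f :> W.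
Proof.
move=> fl; apply/funext => x; rewrite !fctE /insert2 -cut3Z -cut3D; apply: eq_cut3 => y p r _.
have gl : multilinear (fun z => f (hat ec z ++ out c p :: r)) by apply: multilinear_hat_left.
by rewrite (@insertr _ _ eb _ gl).
Qed.

Lemma realizable_insert2 eb c1 ec c2 c : c1 \in bim -> c2 \in bim -> c \in bim ->
  realizable (insert2 eb (totf c1) ec (totf c2) (totf c)).
Proof.
move=> c1S c2S cS; have fl := multilinear_totf cS.
have closed (f : W -> W) : linear f -> realizable (f 0) /\
    forall g g', realizable (f g) -> realizable (f g') -> realizable (f (g + g')).
  move=> lf; split; first by rewrite (linear_at0 lf); apply: realizable0.
  by move=> g g' fg fg'; rewrite (linear_add _ _ lf); apply: realizableD.
have [|z1 add1] := closed (fun b => insert2 eb b ec (totf c2) (totf c)).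
  by move=> a b b'; apply: insert2_linearm.
apply: (totf_pure c1S z1 add1) => s b bp.
have [|z2 add2] := closed (fun b' => insert2 eb b ec b' (totf c)).
  by move=> a b' b''; apply: insert2_linearr.
apply: (totf_pure c2S z2 add2) => t b' bp'.
have [|z3 add3] := closed (insert2 eb b ec b'); first exact: insert2l.
apply: (totf_pure cS z3 add3) => u f fp.
exact: realizable_pure (pure_insert2 eb ec bp bp' fp).
Qed.

End Realization.

Section HomogeneousParts.
Variables (k : fieldType) (A : gradedAlgType k).
Implicit Types (l m r x y z : seq (input A)) (c : cochain A) (f : mmap A).
Implicit Types (q t : int) (e : bool).

Let W : lmodType k := mmap A.
Let C : lmodType k := cochain A.
Local Notation bim := (bim_cochains A).
Local Notation m2 := (bim_m2 A).

Lemma dvdz2 (n : int) : (2 %| n)%Z = ~~ odd `|n|.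
Proof. by rewrite dvdzE dvdn2. Qed.

Lemma even_part_linear a c c' :
  even_part (a *: c + c' : C) = a *: even_part c + even_part c' :> C.
Proof.
apply/funext => q; apply/funext => x; rewrite !fctE /even_part.
by case: ifP => _; rewrite ?scaler0 ?addr0.
Qed.

Lemma even_part_bim c : c \in bim -> even_part c \in bim.
Proof.
move=> cS; apply/bimP; split.
- move=> q l r b a u v; rewrite /even_part !size_cat /=; case: ifP => _.
    exact: bim_multilinear.
  by rewrite scaler0 addr0.
- move=> q x xh; rewrite /even_part; case: ifP => _; [exact: bim_degree | exact: homog0].
- by move=> q x cx; rewrite /even_part (bim_typed q cS cx) if_same.
have [N cN] := bim_finite cS; exists N => q x; rewrite /even_part.
by case: ifP => [_ /cN //|_]; rewrite eqxx.
Qed.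

Lemma par_even_part c : par true (even_part c).
Proof.
move=> q x; rewrite /even_part dvdz2; case: ifP => [ev _|_]; last by rewrite eqxx.
by rewrite (negPf ev) orbT.
Qed.

Lemma par_odd_part c : par false (c - even_part c : C).
Proof.
move=> q x; rewrite !fctE /even_part dvdz2; case: ifP => [_|]; first by rewrite subrr eqxx.
by move=> /negbFE -> _; rewrite orbT.
Qed.

Lemma par_char2 e c : (2 \in [pchar k])%N -> par e c.
Proof. by move=> k2 q x _; rewrite k2. Qed.

Lemma par_split e c : c \in bim -> exists c0 c1 : C,
  [/\ c0 \in bim, c1 \in bim, par e c0, par (~~ e) c1 & c = c0 + c1].
Proof.
move=> cS; have eS := even_part_bim cS.
have oS : c - even_part c \in bim by apply: rpredB.
case: e.
  exists (even_part c), (c - even_part c : C); split=> //.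
  - exact: par_even_part.
  - exact: par_odd_part.
  by rewrite addrC subrK.
exists (c - even_part c : C), (even_part c); split=> //.
- exact: par_odd_part.
- exact: par_even_part.
by rewrite subrK.
Qed.

Lemma totfD c c' : c \in bim -> c' \in bim -> totf (c + c' : C) = totf c + totf c' :> W.
Proof. by move=> cS cS'; have := totf_linear 1 cS cS'; rewrite !scale1r. Qed.

Lemma totf0 : totf (0 : C) = 0 :> W.
Proof. by apply/funext => x; apply: fsum0. Qed.

Lemma totfZ a c : c \in bim -> totf (a *: c : C) = a *: totf c :> W.
Proof. by move=> cS; have := totf_linear a cS (rpred0 _); rewrite !addr0 totf0 addr0. Qed.

Lemma totfN c : c \in bim -> totf (- c : C) = - totf c :> W.
Proof. by move=> cS; rewrite -!scaleN1r totfZ. Qed.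

Lemma totfB c c' : c \in bim -> c' \in bim -> totf (c - c' : C) = totf c - totf c' :> W.
Proof. by move=> cS cS'; rewrite totfD ?totfN ?rpredN. Qed.

(** In characteristic other than 2, sign homogeneity of parity e annihilates
    the component of the other parity. *)
Lemma realizable_par e f : realizable f -> sign_homog e f ->
  exists c : C, [/\ c \in bim, par e c & totf c = f].
Proof.
move=> [c cS <-] fe; have [k2|k2] := boolP (2 \in [pchar k])%N.
  by exists c; split=> //; apply: par_char2.
have [c0 [c1 [c0S c1S c0e c1e cE]]] := par_split e cS.
exists c0; split=> //; suff c10 : totf c1 = 0 :> W by rewrite cE totfD // c10 addr0.
apply/funext => x; have := fe x; rewrite cE totfD // !fctE.
rewrite (sign_homog_totf c0S c0e) (sign_homog_totf c1S c1e).
rewrite (linear_add _ _ (sg_linear true)) scalerDr => /addrI.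
have -> : (-1 : k) ^+ (~~ e) = - (-1) ^+ e by case: e {fe c0e c1e} => /=; ring.
set s := (-1) ^+ e; set v := sg true _ => sv.
have : (2%:R * s) *: v = 0.
  by move/eqP: sv; rewrite scaleNr eq_sym -subr_eq0 opprK => /eqP; rewrite mulr_natl mulr2n scalerDl.
move/eqP; rewrite scaler_eq0 mulf_eq0 signr_eq0 orbF.
have -> : (2%:R == 0 :> k) = false by apply: contraNF k2 => k20; rewrite inE /=.
move=> /= /eqP v0; have := sg_sg true true (totf c1 x).
by rewrite -/v v0 (linear_at0 (sg_linear true)).
Qed.

Lemma bim_m2_bim : m2 \in bim.
Proof.
apply/bimP; split.
- move=> q; have [m20 m2l] := product_cochain_bilinear A (fun u v => ~~ (u && v)).
  have [->|q0] := eqVneq q 0.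
    by move=> l r b a u v; have := m2l l r b a u v.
  by move=> l r b a u v; rewrite /m2 !m20 // scaler0 addr0.
- move=> q [|[i u] [|[j v] [|w x]]] xh; try exact: homog0.
  rewrite /= !big_cons big_nil addr0; case: eqP => [->|_]; last exact: homog0.
  case: (~~ _); last exact: homog0.
  rewrite addr0; apply: homogM; [apply: (xh (i, u))|apply: (xh (j, v))];
    by rewrite !inE eqxx ?orbT.
- move=> q [|u [|v [|w x]]] //=; case: u.1 => //; case: v.1 => //= _.
  by rewrite andbF.
exists 2%N => q [|u [|v [|w x]]] /=; rewrite ?eqxx //.
by case: (q =P 0) => [-> //|_]; rewrite eqxx.
Qed.

Lemma par_m2 : par true m2.
Proof.
move=> q [|u [|v [|w x]]] /=; rewrite ?eqxx //.
by case: (q =P 0) => [->|_]; rewrite ?eqxx ?orbT.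
Qed.

Lemma totf_m2 : totf m2 = m2f.
Proof.
apply/funext => x; rewrite /totf (@fsum_unique _ _ 0); last first.
  by move=> t t0; apply: (product_cochain_bilinear A _).1.
have [|sx] := eqVneq (size x) 2%N; last first.
  rewrite m2f_size //; have := size_twist x; case: (twist x) => [|u [|v [|w y]]] //= sE.
  by move: sx; rewrite -sE.
case: x => [|u [|v [|w x]]] //= _; rewrite m2f_pair /tmul /= [sg false _]/sg.
by case: (u.1 && v.1).
Qed.

Lemma unit_bim : unit_cochain A \in bim.
Proof.
apply/bimP; split.
- by move=> q [|? l] r b a u v; rewrite scaler0 addr0.
- move=> q [|u x] xh; last exact: homog0.
  rewrite /= big_nil add0r; case: eqP => [->|_]; last exact: homog0.
  exact: hcomp_one.
- by move=> q [].
by exists 0%N => q [|u x] /=; rewrite ?eqxx //; case: (q =P 0) => [->|]; rewrite ?eqxx.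
Qed.

Lemma par_unit : par true (unit_cochain A).
Proof.
by move=> q [|u x] /=; rewrite ?eqxx //; case: (q =P 0) => [->|]; rewrite ?eqxx ?orbT.
Qed.

Lemma totf_unit : totf (unit_cochain A) = unitf.
Proof.
apply/funext => x; rewrite /totf (@fsum_unique _ _ 0).
  by case: x.
by move=> t t0; case: x => //=; rewrite (negPf t0).
Qed.

End HomogeneousParts.

Arguments bim_m2_bim {k A}.
Arguments par_m2 {k A}.
Arguments unit_bim {k A}.
Arguments par_unit {k A}.

(** * The dg algebra of cochains and its Lie bracket *)

Section DGAlgebra.
Variables (k : fieldType) (A : gradedAlgType k).
Implicit Types (q t : int) (e : bool).

Let W : lmodType k := mmap A.
Let C : lmodType k := cochain A.
Implicit Types (f g : W) (a b c z : C).
Local Notation bim := (bim_cochains A).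
Local Notation m2 := (bim_m2 A).
Local Notation d := (@bim_d k A).

Lemma brace_bim a b : a \in bim -> b \in bim -> brace a b \in bim.
Proof. exact: wbrace_bim. Qed.

Lemma bracket_bim a b : a \in bim -> b \in bim -> bracket a b \in bim.
Proof. by move=> aS bS; apply: (@rpredB _ bim); apply: wbrace_bim. Qed.

Lemma d_bim c : c \in bim -> d c \in bim.
Proof. by apply: bracket_bim; apply: bim_m2_bim. Qed.

Lemma bim_add a b : a \in bim -> b \in bim -> a + b \in bim.
Proof. exact: rpredD. Qed.
Lemma bim_sub a b : a \in bim -> b \in bim -> a - b \in bim.
Proof. exact: rpredB. Qed.
Lemma bim_opp a : a \in bim -> - a \in bim.
Proof. by rewrite rpredN. Qed.
Lemma bim_scale (u : k) a : a \in bim -> u *: a \in bim.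
Proof. exact: rpredZ. Qed.
Lemma bim_0 : (0 : C) \in bim.
Proof. exact: rpred0. Qed.

Hint Resolve bim_add bim_sub bim_opp bim_scale bim_0 brace_bim bracket_bim d_bim cup_bim
  bim_m2_bim unit_bim : bim.

Lemma braceDl a b c : a \in bim -> b \in bim -> c \in bim ->
  brace (a + b) c = brace a c + brace b c :> C.
Proof. by move=> aS bS cS; have := wbrace_linl (fun _ _ _ _ => 1) 1 aS bS cS; rewrite !scale1r. Qed.

Lemma braceDr a b c : a \in bim -> b \in bim -> c \in bim ->
  brace c (a + b) = brace c a + brace c b :> C.
Proof. by move=> aS bS cS; have := wbrace_linr (fun _ _ _ _ => 1) 1 aS bS cS; rewrite !scale1r. Qed.

Lemma cupDl a b c : a \in bim -> b \in bim -> c \in bim ->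
  cup m2 (a + b) c = cup m2 a c + cup m2 b c :> C.
Proof. by move=> aS bS cS; have := cup_linl 1 aS bS cS; rewrite !scale1r. Qed.

Lemma cupDr a b c : a \in bim -> b \in bim -> c \in bim ->
  cup m2 c (a + b) = cup m2 c a + cup m2 c b :> C.
Proof. by move=> aS bS cS; have := cup_linr 1 aS bS cS; rewrite !scale1r. Qed.

Lemma bracket_linl (u : k) a b c : a \in bim -> b \in bim -> c \in bim ->
  bracket (u *: a + b) c = u *: bracket a c + bracket b c :> C.
Proof.
move=> aS bS cS; rewrite /bracket /brace (wbrace_linl _ u aS bS cS) (wbrace_linr _ u aS bS cS).
by rewrite scalerBr opprD addrACA.
Qed.

Lemma bracket_linr (u : k) a b c : a \in bim -> b \in bim -> c \in bim ->
  bracket c (u *: a + b) = u *: bracket c a + bracket c b :> C.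
Proof.
move=> aS bS cS; rewrite /bracket /brace (wbrace_linl _ u aS bS cS) (wbrace_linr _ u aS bS cS).
by rewrite scalerBr opprD addrACA.
Qed.

Lemma bracketDl a b c : a \in bim -> b \in bim -> c \in bim ->
  bracket (a + b) c = bracket a c + bracket b c :> C.
Proof. by move=> aS bS cS; have := bracket_linl 1 aS bS cS; rewrite !scale1r. Qed.

Lemma bracketDr a b c : a \in bim -> b \in bim -> c \in bim ->
  bracket c (a + b) = bracket c a + bracket c b :> C.
Proof. by move=> aS bS cS; have := bracket_linr 1 aS bS cS; rewrite !scale1r. Qed.

Lemma dD a b : a \in bim -> b \in bim -> d (a + b) = d a + d b :> C.
Proof. by move=> aS bS; apply: bracketDr => //; apply: bim_m2_bim. Qed.

Lemma dB a b : a \in bim -> b \in bim -> d (a - b) = d a - d b :> C.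
Proof.
move=> aS bS; have := bim_d_linear (-1) bS aS.
by rewrite !scaleN1r addrC => ->; rewrite addrC.
Qed.

Lemma d0 : d 0 = 0 :> C.
Proof. by have := dB bim_0 bim_0; rewrite !subrr. Qed.

Lemma dZ (u : k) a : a \in bim -> d (u *: a) = u *: d a :> C.
Proof.
by move=> aS; have := bim_d_linear u aS bim_0; rewrite addr0 d0 addr0.
Qed.

Lemma par_bracket ea eb a b : a \in bim -> b \in bim -> par ea a -> par eb b ->
  par (ea (+) eb) (bracket a b).
Proof.
move=> aS bS ae be; rewrite (bracket_par aS bS ae be) addrC -scaleNr.
by apply: par_lin; [rewrite addbC|]; apply: par_brace.
Qed.

Lemma par_d e c : c \in bim -> par e c -> par (~~ e) (d c).
Proof. by move=> cS ce; have := par_bracket bim_m2_bim cS par_m2 ce. Qed.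

Definition brf ea f eb g : W := insert eb g f - (-1) ^+ (ea && eb) *: insert ea f g.

Lemma totf_bracket ea eb a b : a \in bim -> b \in bim -> par ea a -> par eb b ->
  totf (bracket a b) = brf ea (totf a) eb (totf b) :> W.
Proof.
move=> aS bS ae be; rewrite (bracket_par aS bS ae be) totfB ?totfZ; auto with bim.
by rewrite (totf_brace aS bS be) (totf_brace bS aS ae).
Qed.

Lemma totf_d e c : c \in bim -> par e c -> totf (d c) = df e (totf c) :> W.
Proof.
by move=> cS ce; rewrite (totf_bracket bim_m2_bim cS par_m2 ce) totf_m2.
Qed.

Lemma brf_jacobi ea eb ec f g (h : W) :
  multilinear f -> multilinear g -> multilinear h ->
  sign_homog ea f -> sign_homog eb g -> sign_homog ec h ->
  brf ea f (eb (+) ec) (brf eb g ec h) =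
    brf (ea (+) eb) (brf ea f eb g) ec h +
    (-1) ^+ (ea && eb) *: brf eb g (ea (+) ec) (brf ea f ec h).
Proof.
move=> fl gl hl fe ge he; rewrite /brf.
rewrite (linear_add _ _ (insertr _ fl)) (linear_add _ _ (insertr _ gl)) (linear_add _ _ (insertr _ hl)).
rewrite !(linear_opp _ (insertr _ fl)) !(linear_opp _ (insertr _ gl)) !(linear_opp _ (insertr _ hl)).
rewrite !(linear_scale _ _ (insertr _ fl)) !(linear_scale _ _ (insertr _ gl)) !(linear_scale _ _ (insertr _ hl)).
rewrite !(linear_add _ _ (insertl _ _)) !(linear_opp _ (insertl _ _)) !(linear_scale _ _ (insertl _ _)).
rewrite (prelieW fl ge he) (prelieW gl fe he) (prelieW hl fe ge).
by case: ea {fe}; case: eb {ge}; case: ec {he} => /=; linear_comb k W.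
Qed.

End DGAlgebra.

Arguments bim_0 {k A}.
Arguments d0 {k A}.

Ltac bim := repeat lazymatch goal with
  | H : is_true (?x \in _) |- is_true (?x \in _) => exact: H
  | |- is_true (brace _ _ \in _) => apply: brace_bim
  | |- is_true (bracket _ _ \in _) => apply: bracket_bim
  | |- is_true (bim_d _ \in _) => apply: d_bim
  | |- is_true (cup _ _ _ \in _) => apply: cup_bim
  | |- is_true (bim_m2 _ \in _) => exact: bim_m2_bim
  | |- is_true (unit_cochain _ \in _) => exact: unit_bim
  | |- is_true ((_ + _) \in _) => apply: bim_add
  | |- is_true ((- _) \in _) => apply: bim_opp
  | |- is_true ((_ *: _) \in _) => apply: bim_scale
  | |- is_true (0 \in _) => exact: bim_0
  end.

(** * Cocycles and homotopies *)

Section Cocycles.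
Variables (k : fieldType) (A : gradedAlgType k).
Implicit Types (q t : int) (e : bool).

Let W : lmodType k := mmap A.
Let C : lmodType k := cochain A.
Implicit Types (f g : W) (a b c z : C).
Local Notation bim := (bim_cochains A).
Local Notation m2 := (bim_m2 A).
Local Notation d := (@bim_d k A).

#[local] Opaque bim_d bracket brace cup.

Lemma d_brace ea eb a b : a \in bim -> b \in bim -> par ea a -> par eb b ->
  d (brace a b) = brace (d a) b + (-1) ^+ ea *: brace a (d b)
    - (-1) ^+ (~~ ea && eb) *: cup m2 b a + (-1) ^+ (~~ ea) *: cup m2 a b :> C.
Proof.
move=> aS bS ae be; have abe := par_brace aS ae be; have abS := brace_bim aS bS.
have ah := sign_homog_totf aS ae; have bh := sign_homog_totf bS be.
have abh := sign_homog_totf abS abe.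
apply: totf_inj; [bim | bim |].
rewrite (totf_d abS abe) (totf_brace aS bS be) df_insert ?(totf_brace aS bS be) //; first last.
- by move: abh; rewrite (totf_brace aS bS be).
- exact: multilinear_totf.
rewrite !totfD ?totfN ?totfZ; try bim.
rewrite (totf_brace (d_bim aS) bS be) (totf_brace aS (d_bim bS) (par_d bS be)).
rewrite (totf_cup bS aS ae) (totf_cup aS bS be).
by rewrite (totf_d aS ae) (totf_d bS be).
Qed.

Lemma d_cup ea eb a b : a \in bim -> b \in bim -> par ea a -> par eb b ->
  d (cup m2 a b) = cup m2 (d a) b + (-1) ^+ (~~ ea) *: cup m2 a (d b) :> C.
Proof.
move=> aS bS ae be; have abe := par_cup ae be; have abS := cup_bim aS bS.
have abh := sign_homog_totf abS abe.
apply: totf_inj; [bim | bim |].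
rewrite (totf_d abS abe) (totf_cup aS bS be) df_cup.
- rewrite totfD ?totfZ; try bim.
  rewrite (totf_cup (d_bim aS) bS be) (totf_cup aS (d_bim bS) (par_d bS be)).
  by rewrite (totf_d aS ae) (totf_d bS be).
- exact: multilinear_totf.
- exact: sign_homog_totf.
- exact: sign_homog_totf.
by rewrite -(totf_cup aS bS be).
Qed.

Lemma bim_ind (P : C -> Prop) :
  (forall a b, a \in bim -> b \in bim -> P a -> P b -> P (a + b)) ->
  (forall e a, a \in bim -> par e a -> P a) -> forall a, a \in bim -> P a.
Proof.
move=> PD Pe a aS; have [b [c [bS cS be ce ->]]] := par_split true aS.
by apply: PD => //; [apply: (Pe true) | apply: (Pe false)].
Qed.

Lemma d_d a : a \in bim -> d (d a) = 0 :> C.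
Proof.
move: a; apply: bim_ind => [b c bS cS db dc|e b bS be].
  by rewrite (dD bS cS) dD ?db ?dc ?addr0 //; bim.
apply: totf_inj; [bim | bim |].
rewrite (totf_d (d_bim bS) (par_d bS be)) (totf_d bS be) df_df ?totf0 //.
  exact: multilinear_totf.
exact: sign_homog_totf.
Qed.

Definition Z c : Prop := c \in bim /\ d c = 0.
Definition B c : Prop := exists2 b, b \in bim & c = d b.

Lemma par_sum0 e b c : (2 \notin [pchar k])%N -> par e b -> par (~~ e) c ->
  b + c = 0 -> b = 0.
Proof.
move=> k2 be ce bc; apply/funext => q; apply/funext => x; apply/eqP; apply: contraT => bn.
have := be _ _ bn; have : c q x != 0.
  apply: contra_neq bn => c0; have : (b + c) q x = 0 by rewrite bc.
  by rewrite !fctE c0 addr0.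
by move=> /ce; rewrite (negPf k2) /= => /eqP ->; case: e {be ce}.
Qed.

(** The differential reverses the parity, so that the parity components of a
    cocycle are cocycles. *)
Lemma Z_split e z : Z z -> exists z0 z1, [/\ Z z0, Z z1, par e z0, par (~~ e) z1 & z = z0 + z1].
Proof.
move=> [zS dz]; have [k2|k2] := boolP (2 \in [pchar k])%N.
  exists z, 0; split; rewrite ?addr0 //; try exact: par_char2.
  by split; [bim | apply: d0].
have [b [c [bS cS be ce zE]]] := par_split e zS.
have dbc : d b + d c = 0 by rewrite -dD // -zE.
exists b, c; split=> //; split=> //.
  exact: (par_sum0 k2 (par_d bS be) (par_d cS ce) dbc).
have be' : par (~~ ~~ ~~ e) (d b) by rewrite negbK; apply: (par_d bS be).
by apply: (par_sum0 k2 (par_d cS ce) be'); rewrite addrC.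
Qed.

Lemma Z_ind (P : C -> Prop) : (forall a b, Z a -> Z b -> P a -> P b -> P (a + b)) ->
  (forall e a, Z a -> par e a -> P a) -> forall a, Z a -> P a.
Proof.
move=> PD Pe a /(Z_split true)[b [c [bZ cZ be ce ->]]].
by apply: PD => //; [apply: (Pe true) | apply: (Pe false)].
Qed.

Lemma ZD a b : Z a -> Z b -> Z (a + b).
Proof. by move=> [aS da] [bS db]; split; [bim | rewrite dD // da db addr0]. Qed.
Lemma ZZ (u : k) a : Z a -> Z (u *: a).
Proof. by move=> [aS da]; split; [bim | rewrite dZ // da scaler0]. Qed.
Lemma ZN a : Z a -> Z (- a).
Proof. by rewrite -scaleN1r; apply: ZZ. Qed.
Lemma ZB a b : Z a -> Z b -> Z (a - b).
Proof. by move=> aZ bZ; apply/ZD/ZN. Qed.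
Lemma BD a b : B a -> B b -> B (a + b).
Proof. by move=> [a' aS ->] [b' bS ->]; exists (a' + b'); [bim | rewrite dD]. Qed.
Lemma BZ (u : k) a : B a -> B (u *: a).
Proof. by move=> [a' aS ->]; exists (u *: a'); [bim | rewrite dZ]. Qed.
Lemma B0 : B 0.
Proof. by exists 0; [bim | rewrite d0]. Qed.
Lemma BZc a : B a -> Z a.
Proof. by move=> [b bS ->]; split; [bim | apply: d_d]. Qed.
Lemma Bscale (u : k) a : u != 0 -> B (u *: a) -> B a.
Proof. by move=> u0 /(BZ u^-1); rewrite scalerA mulVf ?scale1r. Qed.

Lemma cup0l a : a \in bim -> cup m2 0 a = 0 :> C.
Proof. by move=> aS; have := cup_linl (-1) bim_0 bim_0 aS; rewrite !scaleN1r oppr0 addr0 addNr. Qed.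
Lemma cup0r a : a \in bim -> cup m2 a 0 = 0 :> C.
Proof. by move=> aS; have := cup_linr (-1) bim_0 bim_0 aS; rewrite !scaleN1r oppr0 addr0 addNr. Qed.
Lemma brace0l a : a \in bim -> brace 0 a = 0 :> C.
Proof. by move=> aS; have := wbrace_linl (fun _ _ _ _ => 1) (-1) bim_0 bim_0 aS; rewrite !scaleN1r oppr0 addr0 addNr. Qed.
Lemma brace0r a : a \in bim -> brace a 0 = 0 :> C.
Proof. by move=> aS; have := wbrace_linr (fun _ _ _ _ => 1) (-1) bim_0 bim_0 aS; rewrite !scaleN1r oppr0 addr0 addNr. Qed.

Lemma Z_bim a : Z a -> a \in bim. Proof. by case. Qed.

Lemma Z_ind2 (P : C -> C -> Prop) :
  (forall a b c, Z a -> Z b -> Z c -> P a c -> P b c -> P (a + b) c) ->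
  (forall a b c, Z a -> Z b -> Z c -> P a b -> P a c -> P a (b + c)) ->
  (forall ea eb a b, Z a -> Z b -> par ea a -> par eb b -> P a b) ->
  forall a b, Z a -> Z b -> P a b.
Proof.
move=> Pl Pr Pe a b aZ bZ; move: b bZ; apply: Z_ind => [b c bZ cZ|eb b bZ be].
  exact: Pr.
by move: a aZ; apply: Z_ind => [a c aZ cZ|ea a aZ ae]; [apply: Pl | apply: (Pe ea eb)].
Qed.

Lemma bimZ_ind2 (P : C -> C -> Prop) :
  (forall a b c, a \in bim -> b \in bim -> Z c -> P a c -> P b c -> P (a + b) c) ->
  (forall a b c, a \in bim -> Z b -> Z c -> P a b -> P a c -> P a (b + c)) ->
  (forall ea eb a b, a \in bim -> Z b -> par ea a -> par eb b -> P a b) ->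
  forall a b, a \in bim -> Z b -> P a b.
Proof.
move=> Pl Pr Pe a b aS bZ; move: b bZ; apply: Z_ind => [b c bZ cZ|eb b bZ be].
  exact: Pr.
by move: a aS; apply: bim_ind => [a c aS cS|ea a aS ae]; [apply: Pl | apply: (Pe ea eb)].
Qed.

Lemma cup_Z a b : Z a -> Z b -> Z (cup m2 a b).
Proof.
move: a b; apply: Z_ind2 => [a b c [aS _] [bS _] [cS _] ac bc|a b c [aS _] [bS _] [cS _] ab ac|].
- by rewrite cupDl //; apply: ZD.
- by rewrite cupDr //; apply: ZD.
move=> ea eb a b [aS da] [bS db] ae be; split; first bim.
by rewrite (d_cup aS bS ae be) da db cup0l // cup0r // scaler0 addr0.
Qed.

Lemma cup_BZ a b : a \in bim -> Z b -> B (cup m2 (d a) b).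
Proof.
move: a b; apply: bimZ_ind2 => [a b c aS bS [cS _] ac bc|a b c aS [bS _] [cS _] ab ac|].
- by rewrite dD // cupDl; try bim; apply: BD.
- by rewrite cupDr; try bim; apply: BD.
move=> ea eb a b aS [bS db] ae be; exists (cup m2 a b); first bim.
by rewrite (d_cup aS bS ae be) db cup0r // scaler0 addr0.
Qed.

Lemma cup_ZB a b : a \in bim -> Z b -> B (cup m2 b (d a)).
Proof.
move: a b; apply: bimZ_ind2 => [a b c aS bS [cS _] ac bc|a b c aS [bS _] [cS _] ab ac|].
- by rewrite dD // cupDr; try bim; apply: BD.
- by rewrite cupDl; try bim; apply: BD.
move=> ea eb a b aS [bS db] ae be; apply: (@Bscale ((-1) ^+ ~~ eb)); first by rewrite signr_eq0.
exists (cup m2 b a); first bim.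
by rewrite (d_cup bS aS be ae) db cup0l // add0r.
Qed.

Lemma bracketC ea eb a b : a \in bim -> b \in bim -> par ea a -> par eb b ->
  bracket a b = - ((-1) ^+ (ea && eb) *: bracket b a) :> C.
Proof.
move=> aS bS ae be; rewrite (bracket_par aS bS ae be) (bracket_par bS aS be ae).
by case: ea {ae}; case: eb {be} => /=; linear_comb k C.
Qed.

Lemma d_bracket ea eb a b : a \in bim -> b \in bim -> par ea a -> par eb b ->
  d (bracket a b) = bracket (d a) b + (-1) ^+ ea *: bracket a (d b) :> C.
Proof.
move=> aS bS ae be; rewrite (bracket_par aS bS ae be) dB ?dZ; try bim.
rewrite (bracket_par (d_bim aS) bS (par_d aS ae) be) (bracket_par aS (d_bim bS) ae (par_d bS be)).
rewrite (d_brace aS bS ae be) (d_brace bS aS be ae).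
by case: ea {ae}; case: eb {be} => /=; linear_comb k C.
Qed.

Lemma bracket0l a : a \in bim -> bracket 0 a = 0 :> C.
Proof. by move=> aS; have := bracket_linl (-1) bim_0 bim_0 aS; rewrite !scaleN1r oppr0 addr0 addNr. Qed.
Lemma bracket0r a : a \in bim -> bracket a 0 = 0 :> C.
Proof. by move=> aS; have := bracket_linr (-1) bim_0 bim_0 aS; rewrite !scaleN1r oppr0 addr0 addNr. Qed.

Lemma bracket_Z a b : Z a -> Z b -> Z (bracket a b).
Proof.
move: a b; apply: Z_ind2 => [a b c [aS _] [bS _] [cS _] ac bc|a b c [aS _] [bS _] [cS _] ab ac|].
- by rewrite bracketDl //; apply: ZD.
- by rewrite bracketDr //; apply: ZD.
move=> ea eb a b [aS da] [bS db] ae be; split; first bim.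
by rewrite (d_bracket aS bS ae be) da db bracket0l // bracket0r // scaler0 addr0.
Qed.

Lemma bracket_BZ a b : a \in bim -> Z b -> B (bracket (d a) b).
Proof.
move: a b; apply: bimZ_ind2 => [a b c aS bS [cS _] ac bc|a b c aS [bS _] [cS _] ab ac|].
- by rewrite dD // bracketDl; try bim; apply: BD.
- by rewrite bracketDr; try bim; apply: BD.
move=> ea eb a b aS [bS db] ae be; exists (bracket a b); first bim.
by rewrite (d_bracket aS bS ae be) db bracket0r // scaler0 addr0.
Qed.

Lemma bracket_ZB a b : a \in bim -> Z b -> B (bracket b (d a)).
Proof.
move: a b; apply: bimZ_ind2 => [a b c aS bS [cS _] ac bc|a b c aS [bS _] [cS _] ab ac|].
- by rewrite dD // bracketDr; try bim; apply: BD.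
- by rewrite bracketDl; try bim; apply: BD.
move=> ea eb a b aS [bS db] ae be; apply: (@Bscale ((-1) ^+ eb)); first by rewrite signr_eq0.
exists (bracket b a); first bim.
by rewrite (d_bracket bS aS be ae) db bracket0l // add0r.
Qed.

(** The homotopy is the brace of a and b. *)
Lemma cup_comm ea eb a b : Z a -> Z b -> par ea a -> par eb b ->
  B (cup m2 a b - (-1) ^+ (~~ ea && ~~ eb) *: cup m2 b a).
Proof.
move=> [aS da] [bS db] ae be; exists ((-1) ^+ (~~ ea) *: brace a b); first bim.
rewrite dZ; try bim; rewrite (d_brace aS bS ae be) da db brace0l // brace0r //.
by case: ea {ae}; case: eb {be} => /=; linear_comb k C.
Qed.

Lemma sign_homog_insert2 ea eb ec a b c : a \in bim -> b \in bim -> c \in bim ->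
  par ea a -> par eb b -> par ec c ->
  sign_homog (ea (+) eb (+) ec) (insert2 eb (totf b) ec (totf c) (totf a)).
Proof.
move=> aS bS cS ae be ce x; have al := multilinear_totf aS.
rewrite (insert2_hat true x al (sign_homog_totf bS be) (sign_homog_totf cS ce)) /=.
have E : (fun x => totf a (hat true x)) = (-1) ^+ ea *: (fun x => sg true (totf a x) : A) :> W.
  by apply/funext => y; rewrite (sign_homog_totf aS ae).
rewrite E (linear_scale _ _ (insert2l _ _ _ _)) fctE scalerA -signr_addb.
rewrite addbC -addbA; congr (_ *: _); rewrite /insert2.
rewrite (cut3_linear _ _ (sg_linear true)); apply: eq_cut3 => y p r _.
by rewrite /insert (cut3_linear _ _ (sg_linear true)).
Qed.

(** The homotopy is the brace a{b, c}, realized by a cochain. *)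
Lemma brace_cup ea eb ec a b c : Z a -> Z b -> Z c -> par ea a -> par eb b -> par ec c ->
  B (brace a (cup m2 b c) - cup m2 (brace a b) c
     - (-1) ^+ (ea && ~~ eb) *: cup m2 b (brace a c)).
Proof.
move=> [aS da] [bS db] [cS dc] ae be ce.
have hh := sign_homog_insert2 aS bS cS ae be ce.
have [h [hS he hE]] := realizable_par (realizable_insert2 eb ec bS cS aS) hh.
exists ((-1) ^+ (ea (+) eb (+) (eb && ec)) *: h); first bim.
have tot0 e z : z \in bim -> par e z -> d z = 0 -> df e (totf z) = 0 :> W.
  by move=> zS ze dz; rewrite -(totf_d zS ze) dz totf0.
rewrite dZ //; apply: totf_inj; [bim | bim |].
rewrite totfZ ?(totf_d hS he) ?hE; try bim.
rewrite df_insert2 ?scalerA //; try exact: multilinear_totf; try exact: sign_homog_totf;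
  try exact: tot0.
rewrite -signr_addb addbb scale1r !totfB ?totfZ; try bim.
rewrite (totf_brace aS (cup_bim bS cS) (par_cup be ce)) (totf_cup bS cS ce).
rewrite (totf_cup (brace_bim aS bS) cS ce) (totf_brace aS bS be).
by rewrite (totf_cup bS (brace_bim aS cS) (par_brace aS ae ce)) (totf_brace aS cS ce).
Qed.

(** In contrast to brace_cup this holds on the nose, as insertion into a cup
    product is insertion into one of the factors. *)
Lemma cup_brace ea eb ec a b c : a \in bim -> b \in bim -> c \in bim ->
  par ea a -> par eb b -> par ec c ->
  brace (cup m2 a b) c = (-1) ^+ (ec && ~~ eb) *: cup m2 (brace a c) b +
    cup m2 a (brace b c) :> C.
Proof.
move=> aS bS cS ae be ce; apply: totf_inj; [bim | bim |].
rewrite totfD ?totfZ; try bim.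
rewrite (totf_brace (cup_bim aS bS) cS ce) (totf_cup aS bS be).
rewrite insertW_cup; [|exact: multilinear_totf|exact: sign_homog_totf].
rewrite (totf_cup (brace_bim aS cS) bS be) (totf_brace aS cS ce).
by rewrite (totf_cup aS (brace_bim bS cS) (par_brace bS be ce)) (totf_brace bS cS ce).
Qed.

Lemma bracket_cup ea eb ec a b c : Z a -> Z b -> Z c -> par ea a -> par eb b -> par ec c ->
  B (bracket a (cup m2 b c) - cup m2 (bracket a b) c
     - (-1) ^+ (ea && ~~ eb) *: cup m2 b (bracket a c)).
Proof.
move=> aZ bZ cZ ae be ce; have [aS bS cS] := And3 (Z_bim aZ) (Z_bim bZ) (Z_bim cZ).
have := brace_cup aZ bZ cZ ae be ce; congr B.
rewrite (bracket_par aS (cup_bim bS cS) ae (par_cup be ce)).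
rewrite (bracket_par aS bS ae be) (bracket_par aS cS ae ce) (cup_brace bS cS aS be ce ae).
have -> : cup m2 (brace a b - (-1) ^+ (ea && eb) *: brace b a) c =
    cup m2 (brace a b) c - (-1) ^+ (ea && eb) *: cup m2 (brace b a) c :> C.
  by rewrite addrC -scaleNr cup_linl ?scaleNr 1?addrC //; bim.
have -> : cup m2 b (brace a c - (-1) ^+ (ea && ec) *: brace c a) =
    cup m2 b (brace a c) - (-1) ^+ (ea && ec) *: cup m2 b (brace c a) :> C.
  by rewrite addrC -scaleNr cup_linr ?scaleNr 1?addrC //; bim.
by case: ea {ae}; case: eb {be}; case: ec {ce} => /=; linear_comb k C.
Qed.

End Cocycles.

(** * The square operation on cochains *)

Section Squares.
Variables (k : fieldType) (A : gradedAlgType k).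
Implicit Types (q t : int) (e : bool).

Let W : lmodType k := mmap A.
Let C : lmodType k := cochain A.
Implicit Types (f g : W) (a b c x y z : C).
Local Notation bim := (bim_cochains A).
Local Notation m2 := (bim_m2 A).
Local Notation d := (@bim_d k A).

#[local] Opaque bim_d bracket brace cup.

Lemma cupA ea eb ec a b c : a \in bim -> b \in bim -> c \in bim ->
  par ea a -> par eb b -> par ec c -> cup m2 (cup m2 a b) c = cup m2 a (cup m2 b c) :> C.
Proof.
move=> aS bS cS ae be ce; apply: totf_inj; [bim | bim |].
rewrite (totf_cup (cup_bim aS bS) cS ce) (totf_cup aS bS be) cupfA.
by rewrite (totf_cup aS (cup_bim bS cS) (par_cup be ce)) (totf_cup bS cS ce).
Qed.

Lemma cup_unitl e a : a \in bim -> par e a -> cup m2 (unit_cochain A) a = a :> C.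
Proof.
move=> aS ae; apply: totf_inj => //; first bim.
by rewrite (totf_cup unit_bim aS ae) totf_unit cupf1.
Qed.

Lemma cup_unitr a : a \in bim -> cup m2 a (unit_cochain A) = a :> C.
Proof.
move=> aS; apply: totf_inj => //; first bim.
by rewrite (totf_cup aS unit_bim par_unit) totf_unit cupf1r.
Qed.

Lemma unit_Z : Z (unit_cochain A).
Proof.
have uh := sign_homog_totf unit_bim (@par_unit k A); rewrite totf_unit in uh.
split; first bim; apply: totf_inj; [bim | bim |].
rewrite (totf_d unit_bim par_unit) totf0 totf_unit /df insert_m2f // expr1.
have -> : insert true m2f unitf = 0 :> W.
  apply/funext => x; apply: cut3_0 => l m r _; rewrite /unitf.
  by case: (hat true l).
by rewrite cupf1 cupf1r scaleN1r subrr scaler0 subr0.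
Qed.

Lemma bracket_jacobi ea eb ec a b c : a \in bim -> b \in bim -> c \in bim ->
  par ea a -> par eb b -> par ec c ->
  bracket a (bracket b c) =
    bracket (bracket a b) c + (-1) ^+ (ea && eb) *: bracket b (bracket a c) :> C.
Proof.
move=> aS bS cS ae be ce; apply: totf_inj; [bim | bim |].
rewrite totfD ?totfZ; try bim.
rewrite (totf_bracket aS (bracket_bim bS cS) ae (par_bracket bS cS be ce)).
rewrite (totf_bracket bS cS be ce).
rewrite (totf_bracket (bracket_bim aS bS) cS (par_bracket aS bS ae be) ce).
rewrite (totf_bracket aS bS ae be).
rewrite (totf_bracket bS (bracket_bim aS cS) be (par_bracket aS cS ae ce)).
rewrite (totf_bracket aS cS ae ce).
by apply: brf_jacobi; first [exact: multilinear_totf | exact: sign_homog_totf].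
Qed.

(** The two ways to insert b twice in disjoint places cancel, because b has
    odd parity. *)
Lemma brace_brace e a b : a \in bim -> b \in bim -> par e a -> par true b ->
  brace (brace a b) b = brace a (brace b b) :> C.
Proof.
move=> aS bS ae be; apply: totf_inj; [bim | bim |].
rewrite (totf_brace (brace_bim aS bS) bS be) (totf_brace aS bS be).
rewrite (totf_brace aS (brace_bim bS bS) (par_brace bS be be)) (totf_brace bS bS be).
apply/funext => x; rewrite insert_insert /=; first by rewrite expr1 scaleN1r addrNK.
  exact: multilinear_totf.
exact: sign_homog_totf.
Qed.

Lemma brace_prelie ea eb ec a b c : a \in bim -> b \in bim -> c \in bim ->
  par ea a -> par eb b -> par ec c ->
  brace (brace a b) c = (-1) ^+ (eb && ec) *: brace (brace a c) b +
    brace a (brace b c) - (-1) ^+ (eb && ec) *: brace a (brace c b) :> C.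
Proof.
move=> aS bS cS ae be ce; apply: totf_inj; [bim | bim |].
rewrite !totfD ?totfN ?totfZ; try bim.
rewrite (totf_brace (brace_bim aS bS) cS ce) (totf_brace aS bS be).
rewrite (totf_brace (brace_bim aS cS) bS be) (totf_brace aS cS ce).
rewrite (totf_brace aS (brace_bim bS cS) (par_brace bS be ce)) (totf_brace bS cS ce).
rewrite (totf_brace aS (brace_bim cS bS) (par_brace cS ce be)) (totf_brace cS bS be).
rewrite prelieW ?(addbC ec eb) //; first [exact: multilinear_totf | exact: sign_homog_totf].
Qed.

Lemma bracket_self a : a \in bim -> par false a -> bracket a a = 0 :> C.
Proof. by move=> aS ae; rewrite (bracket_par aS aS ae ae) scale1r subrr. Qed.

Lemma bracket_odd a b : a \in bim -> b \in bim -> par true a -> par true b ->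
  bracket a b = brace a b + brace b a :> C.
Proof. by move=> aS bS ae be; rewrite (bracket_par aS bS ae be) expr1 scaleN1r opprK. Qed.

Lemma bracket_sq a b : a \in bim -> b \in bim -> par true a -> par true b ->
  bracket (brace a a) b = bracket a (bracket a b) :> C.
Proof.
move=> aS bS ae be; rewrite (bracket_odd aS bS ae be).
rewrite (bracket_par (brace_bim aS aS) bS (par_brace aS ae ae) be).
have abe : par false (brace a b + brace b a).
  by rewrite -(bracket_odd aS bS ae be); apply: (par_bracket aS bS ae be).
have abS := brace_bim aS bS; have baS := brace_bim bS aS.
rewrite (bracket_par aS (bim_add abS baS) ae abe).
rewrite (braceDl abS baS aS) (braceDr abS baS aS).
rewrite (brace_prelie aS aS bS ae ae be) (brace_brace bS aS be ae).
by rewrite /= !expr0 !expr1; linear_comb k C.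
Qed.

Lemma bracket_bracket_self a : a \in bim -> par true a -> bracket a (bracket a a) = 0 :> C.
Proof.
move=> aS ae; have aaS := brace_bim aS aS.
rewrite -bracket_sq // (bracket_par aaS aS (par_brace aS ae ae) ae) /= expr0.
by rewrite (brace_brace aS aS ae ae); linear_comb k C.
Qed.

(** The two cup products of a with itself in the differential of a{a} cancel,
    as a has even degree. *)
Lemma sq_Z a : Z a -> par true a -> Z (brace a a).
Proof.
move=> [aS da] ae; split; first bim.
rewrite (d_brace aS aS ae ae) da brace0l // brace0r //.
by rewrite /= !expr0; linear_comb k C.
Qed.

Lemma sqD a b : a \in bim -> b \in bim -> par true a -> par true b ->
  brace (a + b) (a + b) = brace a a + brace b b + bracket a b :> C.
Proof.
move=> aS bS ae be; rewrite (bracket_odd aS bS ae be).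
have abS := bim_add aS bS; rewrite (braceDl aS bS abS) !braceDr //.
by linear_comb k C.
Qed.

(** Polarization leaves the square of d b, which is exact, and a bracket of a
    with d b. *)
Lemma sq_B a b : Z a -> par true a -> b \in bim -> par false b ->
  B (brace (a + d b) (a + d b) - brace a a).
Proof.
move=> aZ ae bS be; have [aS da] := aZ; have dbS := d_bim bS.
have dbe : par true (d b) := par_d bS be.
rewrite sqD // [X in B X](_ : _ = brace (d b) (d b) + bracket a (d b)); last by linear_comb k C.
apply: BD; last exact: bracket_ZB.
(* The differential of b{d b} is (d b){d b} up to two cup products of b and *)
(* d b, which are the differential of the cup square of b. *)
exists (brace b (d b) - cup m2 b b); first bim.
rewrite dB; try bim; rewrite (d_brace bS dbS be dbe) (d_cup bS bS be be) d_d // brace0r //.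
by rewrite /= !expr0 !expr1; linear_comb k C.
Qed.

Lemma cup_Bl a b : B a -> Z b -> B (cup m2 a b).
Proof. by move=> [a' aS ->]; apply: cup_BZ. Qed.

Lemma cup_Br a b : Z a -> B b -> B (cup m2 a b).
Proof. by move=> aZ [b' bS ->]; apply: cup_ZB. Qed.

(** The Leibniz rule is used on the nose in the outer variable of the brace,
    and up to homotopy in the inner one. *)
Lemma sq_cup a b : Z a -> Z b -> par true a -> par true b ->
  B (brace (cup m2 a b) (cup m2 a b) -
     (cup m2 (brace a a) (cup m2 b b) + cup m2 (cup m2 a (bracket a b)) b +
      cup m2 (cup m2 a a) (brace b b))).
Proof.
move=> aZ bZ ae be; have [aS _] := aZ; have [bS _] := bZ.
have abS := cup_bim aS bS; have abe : par true (cup m2 a b) := par_cup ae be.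
rewrite (cup_brace aS bS abS ae be abe) (bracket_odd aS bS ae be) /= expr0 scale1r.
have aaS := brace_bim aS aS; have bbS := brace_bim bS bS.
have aabS := brace_bim aS bS; have bbaS := brace_bim bS aS.
have [u uB ->] : exists2 u, B u &
    brace a (cup m2 a b) = u + (cup m2 (brace a a) b + cup m2 a (brace a b)) :> C.
  exists (brace a (cup m2 a b) - (cup m2 (brace a a) b + cup m2 a (brace a b))); last by rewrite subrK.
  by have := brace_cup aZ aZ bZ ae ae be; rewrite /= expr0 scale1r opprD addrA.
have [v vB ->] : exists2 v, B v &
    brace b (cup m2 a b) = v + (cup m2 (brace b a) b + cup m2 a (brace b b)) :> C.
  exists (brace b (cup m2 a b) - (cup m2 (brace b a) b + cup m2 a (brace b b))); last by rewrite subrK.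
  by have := brace_cup bZ aZ bZ be ae be; rewrite /= expr0 scale1r opprD addrA.
have aae : par false (brace a a) := par_brace aS ae ae.
have bbe : par false (brace b b) := par_brace bS be be.
have abe' : par false (brace a b) := par_brace aS ae be.
have bae' : par false (brace b a) := par_brace bS be ae.
have [uS _] := BZc uB; have [vS _] := BZc vB.
rewrite !(cupDl, cupDr); try bim.
rewrite (cupA aaS bS bS aae be be) (cupA aS bbaS bS ae bae' be) (cupA aS aS bbS ae ae bbe).
rewrite [X in B X](_ : _ = cup m2 u b + cup m2 a v); last by linear_comb k C.
by apply: BD; [apply: cup_Bl | apply: cup_Br].
Qed.

End Squares.

(** * Cohomology classes *)

Section Classes.
Variables (k : fieldType) (V : lmodType k) (S : submodClosed V) (d : V -> V).
Hypothesis d_linear : forall a, {in S &, forall u v, d (a *: u + v) = a *: d u + d v}.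
Local Notation H := (cohom d_linear).
Local Notation cls := (cls d_linear).

Lemma rep_cocycle (x : H) : rep x \in is_cocycle S d.
Proof. exact: (valP (repr x)). Qed.

Lemma cls_rep (x : H) : cls (rep x) = x.
Proof. by rewrite /cls /rep valKd reprK. Qed.

Lemma insubd_cocycle (u0 : cocycle S d) v (vZ : v \in is_cocycle S d) :
  insubd u0 v = Cocycle vZ.
Proof. by apply: val_inj; rewrite insubdK. Qed.

Lemma clsE v (vZ : v \in is_cocycle S d) : cls v = (\pi_(cohom d_linear) (Cocycle vZ))%qT.
Proof. by rewrite /cls insubd_cocycle. Qed.

Lemma cls_linear a u v : u \in is_cocycle S d -> v \in is_cocycle S d ->
  cls (a *: u + v) = a *: cls u + cls v.
Proof.
move=> uZ vZ.
have wZ : a *: u + v \in is_cocycle S d.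
  by have [_ sub] := is_cocycle_submod d_linear; apply: sub.
rewrite (clsE wZ) (clsE uZ) (clsE vZ).
apply: esym; rewrite [X in X + _]pi_cohom_scale pi_cohomD; congr (\pi_(cohom d_linear) _)%qT.
exact: val_inj.
Qed.

Lemma cls_eq u v : u \in is_cocycle S d -> v \in is_cocycle S d ->
  (cls u = cls v) <-> exists2 b, b \in S & u - v = d b.
Proof.
move=> uZ vZ; rewrite (clsE uZ) (clsE vZ); split=> [/eqP|[b bS uv]].
  by rewrite -Quotient.idealrBE => /asboolP[b bS uv]; exists b.
by apply/eqP; rewrite -Quotient.idealrBE; apply/asboolP; exists b.
Qed.

End Classes.

(** * The Gerstenhaber algebra structure on the bimodule cohomology *)

Section Degrees.
Variables (k : fieldType) (A : gradedAlgType k).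
Implicit Types (q t n : int) (e : bool).

Let C : lmodType k := cochain A.
Implicit Types (a b c z : C).
Local Notation bim := (bim_cochains A).
Local Notation m2 := (bim_m2 A).
Local Notation d := (@bim_d k A).

Lemma wbrace_neq0 w a b q x : a \in bim -> wbrace w a b q x != 0 ->
  exists q1 x1 q2 x2, [/\ a q1 x1 != 0, b q2 x2 != 0,
    (size x1 + size x2)%N = (size x).+1 & q1 + q2 = q].
Proof.
move=> aS nz.
have [l [m [r [t [lmr nzt]]]]] : exists l m r t, l ++ m ++ r = x /\ wterm w a b q t l m r != 0.
  apply: contrapT => no; move/eqP: nz; apply; rewrite wbraceE; apply: cut3_0 => l m r lmr.
  by apply: fsum0 => t; apply/eqP; apply: contra_notT no => nz; exists l, m, r, t.
have [nz1 nz2] := wterm_neq0 aS nzt.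
do 4!eexists; split; [exact: nz1|exact: nz2| |by rewrite subrK].
by rewrite -lmr !size_cat /= size_kz; lia.
Qed.

Lemma cup_neq0 a b q x : cup m2 a b q x != 0 ->
  exists q1 x1 q2 x2, [/\ a q1 x1 != 0, b q2 x2 != 0,
    (size x1 + size x2)%N = size x & q1 + q2 = q].
Proof.
move=> nz; have [l [r [t [lr nzt]]]] : exists l r t, l ++ r = x /\ cterm a b q t l r != 0.
  apply: contrapT => no; move/eqP: nz; apply; rewrite bim_cupE; apply: cut2_0 => l r lr.
  by apply: fsum0 => t; apply/eqP; apply: contra_notT no => nz; exists l, r, t.
have [nz1 nz2 _] := cterm_neq0 nzt.
do 4!eexists; split; [exact: nz1|exact: nz2| |by rewrite subrK].
by rewrite -lr size_cat size_kz.
Qed.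

Lemma add_neq0 a b q x : (a + b) q x != 0 -> a q x != 0 \/ b q x != 0.
Proof.
rewrite !fctE; have [->|] := eqVneq (a q x) 0; last by left.
by rewrite add0r; right.
Qed.

Lemma scale_neq0 (u : k) a q x : (u *: a) q x != 0 -> a q x != 0.
Proof. by rewrite !fctE; apply: contra_neq => ->; rewrite scaler0. Qed.

Lemma opp_neq0 a q x : (- a) q x != 0 -> a q x != 0.
Proof. by rewrite !fctE oppr_eq0. Qed.

Lemma bracket_neq0 a b q x : a \in bim -> b \in bim -> bracket a b q x != 0 ->
  exists q1 x1 q2 x2, [/\ a q1 x1 != 0, b q2 x2 != 0,
    (size x1 + size x2)%N = (size x).+1 & q1 + q2 = q].
Proof.
move=> aS bS; rewrite /bracket => /(@add_neq0 (brace a b)) [|/opp_neq0] /wbrace_neq0; first exact.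
move=> /(_ bS)[q1 [x1 [q2 [x2 [n1 n2 s <-]]]]].
by exists q2, x2, q1, x1; split; rewrite // 1?addnC 1?addrC.
Qed.

Lemma m2_neq0 q x : m2 q x != 0 -> size x = 2%N /\ q = 0.
Proof.
case: x => [|u [|v [|w x]]] //=; rewrite ?eqxx //.
by case: (q =P 0) => [-> //|_]; rewrite eqxx.
Qed.

Lemma d_neq0 b q x : b \in bim -> d b q x != 0 ->
  exists q2 x2, [/\ b q2 x2 != 0, (size x2).+1 = size x & q2 = q].
Proof.
move=> bS /(bracket_neq0 bim_m2_bim bS)[q1 [x1 [q2 [x2 [/m2_neq0[s1 ->] n2 s <-]]]]].
by exists q2, x2; split; rewrite ?add0r //; lia.
Qed.

Lemma of_degree_bracket m n a b : a \in bim -> b \in bim -> of_degree m a -> of_degree n b ->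
  of_degree (m + n - 1) (bracket a b).
Proof.
move=> aS bS am bn q x /(bracket_neq0 aS bS)[q1 [x1 [q2 [x2 [/am <- /bn <- s <-]]]]]; lia.
Qed.

Lemma of_degree_brace m n a b : a \in bim -> of_degree m a -> of_degree n b ->
  of_degree (m + n - 1) (brace a b).
Proof.
move=> aS am bn q x /(wbrace_neq0 aS)[q1 [x1 [q2 [x2 [/am <- /bn <- s <-]]]]]; lia.
Qed.

Lemma of_degree_cup m n a b : of_degree m a -> of_degree n b -> of_degree (m + n) (cup m2 a b).
Proof.
move=> am bn q x /cup_neq0[q1 [x1 [q2 [x2 [/am <- /bn <- s <-]]]]]; lia.
Qed.

Lemma of_bidegree_cup m n m' n' a b : of_bidegree m n a -> of_bidegree m' n' b ->
  of_bidegree (m + m') (n + n') (cup m2 a b).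
Proof.
move=> am bn q x /cup_neq0[q1 [x1 [q2 [x2 [/am[s1 t1] /bn[s2 t2] s <-]]]]].
by split; lia.
Qed.

Lemma of_degree_lin n (u : k) a b : of_degree n a -> of_degree n b -> of_degree n (u *: a + b).
Proof. by move=> an bn q x /add_neq0[/scale_neq0/an|/bn]. Qed.

Lemma of_degree0 n : of_degree n (0 : C).
Proof. by move=> q x; rewrite eqxx. Qed.

Lemma of_degree_par n c : of_degree n c -> par (~~ odd `|n|) c.
Proof. by move=> cn q x /cn <-; rewrite negbK eqxx orbT. Qed.

Definition deg_part n c : C := fun q x => if (size x)%:Z + q == n then c q x else 0.

Lemma deg_part_linear n (u : k) a b :
  deg_part n (u *: a + b) = u *: deg_part n a + deg_part n b.
Proof.
apply/funext => q; apply/funext => x; rewrite !fctE /deg_part.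
by case: ifP => _; rewrite ?scaler0 ?addr0.
Qed.

Lemma deg_part_bim n c : c \in bim -> deg_part n c \in bim.
Proof.
move=> cS; apply/bimP; split.
- move=> q l r b a u v; rewrite /deg_part !size_cat /=; case: ifP => _.
    exact: bim_multilinear.
  by rewrite scaler0 addr0.
- by move=> q x xh; rewrite /deg_part; case: ifP => _; [exact: bim_degree | exact: homog0].
- by move=> q x cx; rewrite /deg_part (bim_typed q cS cx) if_same.
have [N cN] := bim_finite cS; exists N => q x; rewrite /deg_part.
by case: ifP => [_ /cN //|_]; rewrite eqxx.
Qed.

Lemma of_degree_part n c : of_degree n (deg_part n c).
Proof. by move=> q x; rewrite /deg_part; case: (_ =P n) => [-> //|_]; rewrite eqxx. Qed.

Lemma deg_part_id n c : of_degree n c -> deg_part n c = c.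
Proof.
move=> cn; apply/funext => q; apply/funext => x; rewrite /deg_part; case: eqP => // ne.
by apply/eqP; rewrite eq_sym; apply: contraT => /cn.
Qed.

Lemma deg_part0 n c : (forall q x, c q x != 0 -> (size x)%:Z + q != n) -> deg_part n c = 0.
Proof.
move=> cn; apply/funext => q; apply/funext => x; rewrite /deg_part; case: eqP => // en.
by apply/eqP; apply: contraT => /cn; rewrite en eqxx.
Qed.

Lemma deg_part_d n c : c \in bim -> deg_part (n + 1) (d c) = d (deg_part n c).
Proof.
move=> cS; have pS := deg_part_bim n cS; have qS := bim_sub cS pS.
have {1}-> : c = 1 *: deg_part n c + (c - deg_part n c) by rewrite scale1r addrC subrK.
rewrite (bim_d_linear 1 pS qS) deg_part_linear !scale1r.
rewrite deg_part_id; last first.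
  by move=> q x /(d_neq0 pS)[q2 [x2 [/of_degree_part <- <- ->]]]; lia.
rewrite [X in _ + X]deg_part0 ?addr0 // => q x /(d_neq0 qS)[q2 [x2 [nz <- <-]]].
apply: contra_neq nz => en; rewrite !fctE /deg_part ifT ?subrr //.
by apply/eqP; lia.
Qed.

Lemma sum_deg_part N c : (forall q x, c q x != 0 -> (absz ((size x)%:Z + q)%R <= N)%N) ->
  \sum_(n <- zwindow N) deg_part n c = c.
Proof.
move=> cN; apply/funext => q; apply/funext => x; rewrite !fct_sumE.
have [cz|nz] := eqVneq (c q x) 0.
  by rewrite big1 // => n _; rewrite /deg_part cz if_same.
rewrite (bigD1_seq ((size x)%:Z + q)) ?zwindow_uniq ?mem_zwindow ?cN //=.
rewrite {1}/deg_part eqxx big1 ?addr0 // => n ne.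
by rewrite /deg_part eq_sym (negPf ne).
Qed.

Lemma Z_deg_part n c : Z c -> Z (deg_part n c).
Proof.
move=> [cS dc]; split; first exact: deg_part_bim.
by rewrite -deg_part_d // dc deg_part0 // => q x; rewrite eqxx.
Qed.

End Degrees.

Section BimoduleCohomology.
Variables (k : fieldType) (A : gradedAlgType k).
Implicit Types (q t n : int) (e : bool).

Let C : lmodType k := cochain A.
Implicit Types (a b c z : C).
Local Notation bim := (bim_cochains A).
Local Notation m2 := (bim_m2 A).
Local Notation d := (@bim_d k A).
Local Notation H := (HHbim A).
Local Notation cl := (cls (@bim_d_linear k A)).
Local Notation mul := (@hhbim_mul k A).
Local Notation br := (@hhbim_bracket k A).
Local Notation sq := (@hhbim_sq k A).
Local Notation deg := (@hhbim_degree k A).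
Implicit Types x y : H.

#[local] Opaque bim_d bracket brace cup.

Lemma cocycleP z : (z \in is_cocycle (bim_cochains A) (@bim_d k A)) <-> Z z.
Proof. by rewrite inE; split=> [/andP[? /eqP]|[-> ->]] //; rewrite eqxx. Qed.

Lemma cl_rep_Z x : Z (rep x).
Proof. exact/cocycleP/rep_cocycle. Qed.

Lemma cl_surj x : exists2 z, Z z & x = cl z.
Proof. by exists (rep x); [apply: cl_rep_Z | rewrite cls_rep]. Qed.

Lemma cl_lin (u : k) a b : Z a -> Z b -> cl (u *: a + b) = u *: cl a + cl b.
Proof. by move=> /cocycleP aZ /cocycleP bZ; apply: cls_linear. Qed.

Lemma cl_eq a b : Z a -> Z b -> cl a = cl b <-> B (a - b).
Proof. by move=> /cocycleP aZ /cocycleP bZ; apply: cls_eq. Qed.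

Lemma clD a b : Z a -> Z b -> cl (a + b) = cl a + cl b.
Proof. by move=> aZ bZ; have := cl_lin 1 aZ bZ; rewrite !scale1r. Qed.

Lemma Z0 : Z (0 : C).
Proof. exact: BZc (B0 A). Qed.

Lemma cl0 : cl 0 = 0.
Proof. by have := cl_lin (-1) Z0 Z0; rewrite !scaleN1r oppr0 addr0 addNr. Qed.

Lemma clZ (u : k) a : Z a -> cl (u *: a) = u *: cl a.
Proof. by move=> aZ; have := cl_lin u aZ Z0; rewrite cl0 !addr0. Qed.

Lemma clN a : Z a -> cl (- a) = - cl a.
Proof. by move=> aZ; rewrite -!scaleN1r clZ. Qed.

Lemma cl_B a : B a -> cl a = 0.
Proof. by move=> aB; rewrite -cl0; apply/(cl_eq (BZc aB) Z0); rewrite subr0. Qed.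

Lemma cl_rep a : Z a -> exists2 b, b \in bim & rep (cl a) = a + d b.
Proof.
move=> aZ; have /(cl_eq (cl_rep_Z _) aZ)[b bS ab] : cl (rep (cl a)) = cl a by apply: cls_rep.
by exists b; rewrite // -ab addrC subrK.
Qed.

Lemma mul_cl a b : Z a -> Z b -> mul (cl a) (cl b) = cl (cup m2 a b).
Proof.
move=> aZ bZ; rewrite /hhbim_mul /coh_mul.
have [a' aS aE] := cl_rep aZ; have [b' bS bE] := cl_rep bZ.
have aZ' := cl_rep_Z (cl a); have bZ' := cl_rep_Z (cl b).
apply/cl_eq; [exact: cup_Z | exact: cup_Z |].
rewrite [X in B X](_ : _ = cup m2 (rep (cl a)) (d b') + cup m2 (d a') b).
  by apply: BD; [apply: cup_ZB | apply: cup_BZ].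
have [aS0 _] := aZ; have [bS0 _] := bZ.
have aS' := d_bim aS; have bS' := d_bim bS.
rewrite {1}bE cupDr //; last exact: (proj1 aZ').
by rewrite {1}aE cupDl //; linear_comb k C.
Qed.

Lemma br_cl a b : Z a -> Z b -> br (cl a) (cl b) = cl (bracket a b).
Proof.
move=> aZ bZ; rewrite /hhbim_bracket /coh_bracket.
have [a' aS aE] := cl_rep aZ; have [b' bS bE] := cl_rep bZ.
have aZ' := cl_rep_Z (cl a); have bZ' := cl_rep_Z (cl b).
apply/cl_eq; [exact: bracket_Z | exact: bracket_Z |].
rewrite [X in B X](_ : _ = bracket (rep (cl a)) (d b') + bracket (d a') b).
  by apply: BD; [apply: bracket_ZB | apply: bracket_BZ].
have [aS0 _] := aZ; have [bS0 _] := bZ.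
have aS' := d_bim aS; have bS' := d_bim bS.
rewrite {1}bE bracketDr //; last exact: (proj1 aZ').
by rewrite {1}aE bracketDl //; linear_comb k C.
Qed.

Lemma even_part_id c : (2 \notin [pchar k])%N -> par true c -> even_part c = c.
Proof.
move=> k2 ce; apply/funext => q; apply/funext => x; rewrite /even_part dvdz2.
case: ifP => // /negbFE od; apply/esym/eqP; apply: contraT => /ce.
by rewrite (negPf k2) od.
Qed.

Lemma even_part0 c : (2 \notin [pchar k])%N -> par false c -> even_part c = 0.
Proof.
move=> k2 ce; apply/funext => q; apply/funext => x; rewrite /even_part dvdz2.
case: ifP => // ev; apply/eqP; apply: contraT => /ce.
by rewrite (negPf k2) (negPf ev).
Qed.

Lemma even_partD a b : even_part (a + b) = even_part a + even_part b :> C.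
Proof. by have := even_part_linear 1 a b; rewrite !scale1r. Qed.

(** A representative of cl a may have an odd component, which is exact;
    without it the representative differs from a by the coboundary of an odd
    cochain, so that sq_B applies. *)
Lemma sq_cl a : Z a -> par true a -> sq (cl a) = cl (brace a a).
Proof.
move=> aZ ae; rewrite /hhbim_sq /coh_sq /sq_cochain.
have [b bS aE] := cl_rep aZ.
have [b' [bS' be' ->]] : exists b' : C, [/\ b' \in bim, par false b' &
    (if (2 \in [pchar k])%N then brace (rep (cl a)) (rep (cl a)) else
     brace (even_part (rep (cl a))) (even_part (rep (cl a)))) =
    brace (a + d b') (a + d b')].
  rewrite aE; case: ifP => [k2|/negbT k2]; first by exists b; split=> //; apply: par_char2.
  have [b0 [b1 [b0S b1S b0e b1e bE]]] := par_split false bS.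
  exists b0; split=> //; suff -> : even_part (a + d b) = a + d b0 :> C by [].
  rewrite bE (dD b0S b1S) (even_partD a) (even_part_id k2 ae) (even_partD (d b0)).
  by rewrite (even_part_id k2 (par_d b0S b0e)) (even_part0 k2 (par_d b1S b1e)) addr0.
have sB := sq_B aZ ae bS' be'; apply/cl_eq => //; last exact: sq_Z.
by rewrite -[brace _ _](subrK (brace a a)); apply: ZD (BZc sB) (sq_Z aZ ae).
Qed.

Lemma deg_cl n x : deg n x <-> exists z, [/\ Z z, of_degree n z & x = cl z].
Proof. by split=> -[z [zZ zn ->]]; exists z; split=> //; apply/cocycleP. Qed.

End BimoduleCohomology.

Section Gerstenhaber.
Variables (k : fieldType) (A : gradedAlgType k).
Implicit Types (q t n : int) (e : bool).

Let C : lmodType k := cochain A.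
Implicit Types (a b c z : C).
Local Notation bim := (bim_cochains A).
Local Notation m2 := (bim_m2 A).
Local Notation d := (@bim_d k A).
Local Notation H := (HHbim A).
Local Notation cl := (cls (@bim_d_linear k A)).
Local Notation mul := (@hhbim_mul k A).
Local Notation br := (@hhbim_bracket k A).
Local Notation sq := (@hhbim_sq k A).
Local Notation deg := (@hhbim_degree k A).
Implicit Types x y : H.

#[local] Opaque bim_d bracket brace cup.

Lemma mul_bilinear : bilinear_op mul.
Proof.
split=> [y u x x'|x u y y'].
  have [b bZ ->] := cl_surj y; have [a aZ ->] := cl_surj x; have [a' aZ' ->] := cl_surj x'.
  rewrite -cl_lin // !mul_cl //; last by apply: ZD => //; apply: ZZ.
  by rewrite (cup_linl u (proj1 aZ) (proj1 aZ') (proj1 bZ)) cl_lin //; apply: cup_Z.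
have [b bZ ->] := cl_surj y; have [a aZ ->] := cl_surj x; have [b' bZ' ->] := cl_surj y'.
rewrite -cl_lin // !mul_cl //; last by apply: ZD => //; apply: ZZ.
by rewrite (cup_linr u (proj1 bZ) (proj1 bZ') (proj1 aZ)) cl_lin //; apply: cup_Z.
Qed.

Lemma br_bilinear : bilinear_op br.
Proof.
split=> [y u x x'|x u y y'].
  have [b bZ ->] := cl_surj y; have [a aZ ->] := cl_surj x; have [a' aZ' ->] := cl_surj x'.
  rewrite -cl_lin // !br_cl //; last by apply: ZD => //; apply: ZZ.
  by rewrite (bracket_linl u (proj1 aZ) (proj1 aZ') (proj1 bZ)) cl_lin //; apply: bracket_Z.
have [b bZ ->] := cl_surj y; have [a aZ ->] := cl_surj x; have [b' bZ' ->] := cl_surj y'.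
rewrite -cl_lin // !br_cl //; last by apply: ZD => //; apply: ZZ.
by rewrite (bracket_linr u (proj1 bZ) (proj1 bZ') (proj1 aZ)) cl_lin //; apply: bracket_Z.
Qed.

Lemma cl_sum (I : eqType) (r : seq I) (F : I -> C) : (forall i, Z (F i)) ->
  Z (\sum_(i <- r) F i) /\ cl (\sum_(i <- r) F i) = \sum_(i <- r) cl (F i).
Proof.
move=> FZ; elim: r => [|i r [rZ rE]]; first by rewrite !big_nil cl0; split=> //; apply: Z0.
by rewrite !big_cons clD // rE; split=> //; apply: ZD.
Qed.

Lemma deg_part_sum (I : Type) (r : seq I) (F : I -> C) n :
  deg_part n (\sum_(i <- r) F i) = \sum_(i <- r) deg_part n (F i) :> C.
Proof.
elim: r => [|i r IH]; first by rewrite !big_nil; apply: deg_part0 => q x; rewrite eqxx.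
by rewrite !big_cons -IH -[F i]scale1r deg_part_linear !scale1r.
Qed.

(** The homogeneous components of a cocycle are cocycles, and those of a
    coboundary are coboundaries of homogeneous cochains. *)
Lemma hhbim_graded : graded_space deg.
Proof.
split=> [n|x|f fdeg ffin f0 n].
- split; first by apply/deg_cl; exists 0; split; rewrite ?cl0 //; [exact: Z0 | exact: of_degree0].
  move=> u x y /deg_cl[a [aZ an ->]] /deg_cl[b [bZ bn ->]]; apply/deg_cl.
  exists (u *: a + b); rewrite cl_lin //; split=> //; last exact: of_degree_lin.
  by apply: ZD => //; apply: ZZ.
- have [z zZ ->] := cl_surj x; exists (fun n => cl (deg_part n z)).
  have [N zN] := bim_finite (proj1 zZ).
  have zN' q w : z q w != 0 -> (absz ((size w)%:Z + q)%R <= N + N)%N.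
    by move=> /zN; lia.
  have supp n : cl (deg_part n z) != 0 -> (`|n| <= N + N)%N.
    apply: contraNT => nN; rewrite deg_part0 ?cl0 // => q w /zN'.
    by apply: contraTneq => ->.
  split; [|exact: finite_zset supp|].
    move=> n; apply/deg_cl; exists (deg_part n z).
    by split; [exact: Z_deg_part | exact: of_degree_part |].
  rewrite (fsum_window supp) -(proj2 (cl_sum _ _)) ?sum_deg_part // => n.
  exact: Z_deg_part.
have /choice[z zE] : forall n, exists w : C, [/\ Z w, of_degree n w & f n = cl w].
  by move=> m; apply/deg_cl.
have zZ m : Z (z m) by have [] := zE m.
have /finite_seqP[r rE] := ffin.
have rP m : m \notin undup r -> f m = 0.
  rewrite mem_undup => mr; apply/eqP; apply: contraNT mr => fm.
  by suff : [set` r]%classic m by []; rewrite -rE.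
have [nr|] := boolP (n \in undup r); last exact: rP.
have [sZ sE] := cl_sum (undup r) zZ.
have : cl (\sum_(i <- undup r) z i) = cl 0.
  rewrite sE cl0; transitivity (\sum_(m <- undup r) f m).
    by apply: eq_bigr => m _; have [_ _ ->] := zE m.
  by rewrite -(fsumE (undup_uniq r) rP).
move=> /(cl_eq sZ (Z0 A))[b bS]; rewrite subr0 => sd.
have : deg_part n (\sum_(i <- undup r) z i) = z n :> C.
  rewrite deg_part_sum (bigD1_seq n) ?undup_uniq //= deg_part_id; last by have [] := zE n.
  rewrite big1 ?addr0 // => m mn; apply: deg_part0 => q x.
  by have [_ zm _] := zE m => /zm ->.
rewrite sd -[n](subrK 1) deg_part_d // subrK => zB.
have [_ _ ->] := zE n; apply: cl_B; rewrite -zB; exists (deg_part (n - 1) b) => //.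
exact: deg_part_bim.
Qed.

Lemma oddM_sub1 m n : odd `|(m - 1) * (n - 1)| = ~~ odd `|m| && ~~ odd `|n|.
Proof. by rewrite abszM oddM; congr andb; lia. Qed.

Lemma cup_assoc a b c : a \in bim -> b \in bim -> c \in bim ->
  cup m2 (cup m2 a b) c = cup m2 a (cup m2 b c) :> C.
Proof.
move=> aS bS cS; move: c cS; apply: bim_ind => [c c' cS cS' ih ih'|ec c cS ce].
  by rewrite !cupDr ?ih ?ih' //; bim.
move: b bS; apply: bim_ind => [b b' bS bS' ih ih'|eb b bS be].
  have abS := cup_bim aS bS; have abS' := cup_bim aS bS'.
  have bcS := cup_bim bS cS; have bcS' := cup_bim bS' cS.
  by rewrite (cupDr bS bS' aS) !cupDl // (cupDr bcS bcS' aS) ih ih'.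
move: a aS; apply: bim_ind => [a a' aS aS' ih ih'|ea a aS ae].
  have abS := cup_bim aS bS; have abS' := cup_bim aS' bS; have bcS := cup_bim bS cS.
  by rewrite !cupDl // ih ih'.
exact: (cupA aS bS cS ae be ce).
Qed.

Lemma cup_1l a : a \in bim -> cup m2 (unit_cochain A) a = a :> C.
Proof.
move: a; apply: bim_ind => [a b aS bS ih ih'|e a aS ae]; last exact: cup_unitl aS ae.
by rewrite (cupDr aS bS unit_bim) ih ih'.
Qed.

Lemma hhbim_graded_comm : graded_comm_algebra deg (hhbim_one A) mul.
Proof.
split; [exact: hhbim_graded | | | |].
- split; first exact: mul_bilinear.
  move=> m n x y /deg_cl[a [aZ am ->]] /deg_cl[b [bZ bn ->]]; apply/deg_cl.
  rewrite mul_cl //; exists (cup m2 a b); split=> //; first exact: cup_Z.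
  exact: of_degree_cup.
- move=> x y z.
  have [b bZ ->] := cl_surj y; have [a aZ ->] := cl_surj x; have [c cZ ->] := cl_surj z.
  rewrite !mul_cl //; try exact: cup_Z.
  by rewrite (cup_assoc (proj1 aZ) (proj1 bZ) (proj1 cZ)).
- have uZ := unit_Z A; split.
  + apply/deg_cl; exists (unit_cochain A); split=> // q [|u x] /=; rewrite ?eqxx //.
    by case: (q =P 0) => [->|]; rewrite ?eqxx.
  + move=> x; have [a aZ ->] := cl_surj x; rewrite mul_cl // cup_1l //.
    exact: (proj1 aZ).
  move=> x; have [a aZ ->] := cl_surj x; rewrite mul_cl // cup_unitr //.
  exact: (proj1 aZ).
move=> m n x y /deg_cl[a [aZ /of_degree_par am ->]] /deg_cl[b [bZ /of_degree_par bn ->]].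
rewrite !mul_cl // signz_parity abszM oddM -clZ; last exact: cup_Z.
apply/cl_eq; [exact: cup_Z | by apply/ZZ/cup_Z |].
by have := cup_comm aZ bZ am bn; rewrite !negbK.
Qed.

Lemma hhbim_lie : gerstenhaber_bracket deg mul br.
Proof.
split; [split; [split | | | |]|].
- exact: br_bilinear.
- move=> m n x y /deg_cl[a [aZ am ->]] /deg_cl[b [bZ bn ->]]; apply/deg_cl.
  rewrite br_cl //; exists (bracket a b); split=> //; first exact: bracket_Z.
  exact: of_degree_bracket (proj1 aZ) (proj1 bZ) am bn.
- move=> m n x y /deg_cl[a [aZ /of_degree_par am ->]] /deg_cl[b [bZ /of_degree_par bn ->]].
  have baZ := bracket_Z bZ aZ.
  rewrite !br_cl // signz_parity oddM_sub1 -clZ // -clN; last exact: ZZ.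
  by rewrite -(bracketC (proj1 aZ) (proj1 bZ) am bn).
- move=> l m n x y z /deg_cl[a [aZ /of_degree_par al ->]].
  move=> /deg_cl[b [bZ /of_degree_par bm ->]] /deg_cl[c [cZ /of_degree_par cn ->]].
  have abZ := bracket_Z aZ bZ; have acZ := bracket_Z aZ cZ; have bcZ := bracket_Z bZ cZ.
  rewrite !br_cl // signz_parity oddM_sub1 -clZ -?clD; try exact: bracket_Z; last first.
    by apply/ZZ/bracket_Z.
  by rewrite -(bracket_jacobi (proj1 aZ) (proj1 bZ) (proj1 cZ) al bm cn).
- move=> n x /deg_cl[a [aZ /of_degree_par an ->]]; rewrite dvdz2 negbK => on.
  by rewrite br_cl // bracket_self ?cl0 //; [exact: (proj1 aZ) | rewrite on in an].
- move=> n x /deg_cl[a [aZ /of_degree_par an ->]]; rewrite dvdz2 => on.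
  rewrite on in an; rewrite !br_cl //; last exact: bracket_Z.
  by rewrite bracket_bracket_self ?cl0 //; apply: (proj1 aZ).
move=> l m n x y z /deg_cl[a [aZ /of_degree_par al ->]].
move=> /deg_cl[b [bZ /of_degree_par bm ->]] /deg_cl[c [cZ /of_degree_par cn ->]].
have abZ := bracket_Z aZ bZ; have acZ := bracket_Z aZ cZ; have bcZ := cup_Z bZ cZ.
have ab_cZ := cup_Z abZ cZ; have b_acZ := cup_Z bZ acZ.
rewrite !(br_cl, mul_cl) // signz_parity -clZ -?clD //; last exact: ZZ.
apply/cl_eq; [exact: bracket_Z | by apply: ZD => //; apply: ZZ |].
have := bracket_cup aZ bZ cZ al bm cn; rewrite !negbK opprD addrA.
by have -> : odd `|(l - 1) * m| = ~~ odd `|l| && odd `|m| by rewrite abszM oddM; congr andb; lia.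
Qed.

Lemma sq_add x y : (2 \in [pchar k])%N -> sq (x + y) = sq x + sq y + br x y.
Proof.
move=> k2; have par2 e c : par e c by apply: par_char2.
have [a aZ ->] := cl_surj x; have [b bZ ->] := cl_surj y.
have abZ := ZD aZ bZ; have saZ := sq_Z aZ (par2 true a); have sbZ := sq_Z bZ (par2 true b).
have bZ' := bracket_Z aZ bZ.
rewrite br_cl // -clD // !sq_cl // -!clD //; last exact: ZD.
by rewrite sqD //; [exact: (proj1 aZ) | exact: (proj1 bZ)].
Qed.

Lemma sq_mul x y : (2 \in [pchar k])%N ->
  sq (mul x y) = mul (sq x) (mul y y) + mul (mul x (br x y)) y + mul (mul x x) (sq y).
Proof.
move=> k2; have par2 e c : par e c by apply: par_char2.
have [a aZ ->] := cl_surj x; have [b bZ ->] := cl_surj y.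
have saZ := sq_Z aZ (par2 true a); have sbZ := sq_Z bZ (par2 true b).
have abZ := bracket_Z aZ bZ; have cZ := cup_Z aZ bZ.
have aaZ := cup_Z aZ aZ; have bbZ := cup_Z bZ bZ.
have Z1 := cup_Z saZ bbZ; have Z2 := cup_Z (cup_Z aZ abZ) bZ; have Z3 := cup_Z aaZ sbZ.
rewrite !(br_cl, mul_cl, sq_cl) //; try exact: cup_Z.
rewrite -!clD //; last exact: ZD.
apply/cl_eq; [exact: sq_Z | by apply: ZD => //; apply: ZD |].
exact: sq_cup.
Qed.

Lemma hhbim_square : (2 \in [pchar k])%N -> gerstenhaber_square deg mul br sq.
Proof.
move=> k2; have par2 e c : par e c by apply: par_char2.
split.
- move=> n x /deg_cl[a [aZ an ->]]; rewrite sq_cl //; apply/deg_cl.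
  exists (brace a a); split=> //; first exact: sq_Z.
  have -> : 2 * n - 1 = n + n - 1 by ring.
  exact: (of_degree_brace (proj1 aZ) an an).
- by move=> n x y _ _; apply: sq_add.
- by move=> m n x y _ _; apply: sq_mul.
move=> m n x y /deg_cl[a [aZ _ ->]] /deg_cl[b [bZ _ ->]].
have saZ := sq_Z aZ (par2 true a); have abZ := bracket_Z aZ bZ.
rewrite sq_cl // !br_cl // bracket_sq //; [exact: (proj1 aZ) | exact: (proj1 bZ)].
Qed.

Lemma hhbim_gerstenhaber : gerstenhaber_algebra deg (hhbim_one A) mul br sq.
Proof. by split; [exact: hhbim_graded_comm | exact: hhbim_lie | exact: hhbim_square]. Qed.

End Gerstenhaber.

(** * Inserting the unit of the bimodule *)

Section UnitInsertion.
Variables (k : fieldType) (A : gradedAlgType k).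
Implicit Types (l m r x y z : seq (input A)) (f g b : mmap A) (e : bool).

Let W : lmodType k := mmap A.

Definition detag x : seq (input A) := [seq (false, u.2) | u <- x].

Definition unit_input : input A := (true, aone).

(** On lists without inputs of bimodule type this is kappa1 on the
    suspension. On lists with one such input it is the homotopy: the unit is
    inserted on its left and takes over its tag. *)
Definition insert_unit f : mmap A := fun x => cut2 (fun l r =>
  if has fst l then 0 else f (hat true l ++ unit_input :: detag r)) x.

Lemma detag_cat x y : detag (x ++ y) = detag x ++ detag y.
Proof. exact: map_cat. Qed.

Lemma has_detag x : has fst (detag x) = false.
Proof. by elim: x. Qed.

Lemma detag_hat e x : detag (hat e x) = hat e (detag x).
Proof. by rewrite /detag /hat -!map_comp. Qed.

Lemma size_detag x : size (detag x) = size x.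
Proof. exact: size_map. Qed.

Lemma detag_id x : has fst x = false -> detag x = x.
Proof. by elim: x => // -[[] u] x IH //= hx; rewrite IH. Qed.

Lemma m2f_detag x : (count fst x <= 1)%N -> m2f (detag x) = m2f x :> A.
Proof.
have [|s2] := eqVneq (size x) 2%N; last by rewrite !m2f_size ?size_detag.
by case: x => [|[[] u] [|[[] v] [|? ?]]] //= _; rewrite !m2f_pair.
Qed.

Lemma count_cat3 l m r : count fst (l ++ m ++ r) = (count fst l + count fst m + count fst r)%N.
Proof. by rewrite !count_cat addnA. Qed.

Lemma insert_unit_hat e f x : multilinear f ->
  insert_unit f (hat e x) = (-1) ^+ e *: insert_unit (fun y => f (hat e y)) x.
Proof.
move=> fl; rewrite /insert_unit cut2_map -cut2Z; apply: eq_cut2 => l r _.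
rewrite has_hat; case: ifP => _; first by rewrite scaler0.
rewrite [hat e (_ ++ _)]hat_cat /= sg_one multilinearZ // scalerA.
by rewrite -expr2 sqrr_sign scale1r hatC -detag_hat.
Qed.

Lemma insert_unit_linear : linear (insert_unit : W -> W).
Proof.
move=> a f g; apply/funext => x; rewrite !fctE /insert_unit -cut2Z -cut2D.
by apply: eq_cut2 => l r _; case: ifP => _; rewrite ?scaler0 ?addr0.
Qed.

(** The unit lies among the inputs of g, and then those of f contain no input
    of bimodule type, or it lies among the inputs of f. *)
Lemma insert_unit_cup e f g x : multilinear f ->
  insert_unit (cupf e f g) x =
    cut2 (fun l y => if has fst l then 0 else amul (f (hat e l)) (insert_unit g y)) x +
    (-1) ^+ (~~ e) *: cut2 (fun y r => amul (insert_unit f (hat (~~ e) y)) (g (detag r))) x.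
Proof.
move=> fl.
transitivity (cut2 (fun y r => cut2 (fun l m => if has fst l || has fst m then 0 else
      amul (f (hat e l)) (g (hat true m ++ unit_input :: detag r))) y) x +
    cut2 (fun l y => cut2 (fun m r => if has fst l then 0 else
      amul (f (hat (~~ e) (hat true l ++ unit_input :: detag m))) (g (detag r))) y) x).
  rewrite -cut2D; apply: eq_cut2 => l r _; case: ifP => hl.
    rewrite cut2_0 ?add0r => [|a b ab]; first by rewrite cut2_0.
    by rewrite -has_cat ab hl.
  rewrite /cupf cut2_cat_cons; congr (_ + _).
    rewrite cut2_map; apply: eq_cut2 => a b ab.
    move: hl; rewrite -ab has_cat => /negbT; rewrite negb_or => /andP[/negPf ha /negPf hb].
    by rewrite has_hat ha hb /tmul hat_hat addbT negbK.
  by rewrite cut2_map; apply: eq_cut2 => a b _; rewrite -/(detag b) has_detag andbF.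
congr (_ + _).
  rewrite (cut2_assoc (fun l m r => if has fst l || has fst m then 0 else
      amul (f (hat e l)) (g (hat true m ++ unit_input :: detag r)))).
  apply: eq_cut2 => l y _; case: ifP => hl; first by rewrite cut2_0.
  rewrite /insert_unit (cut2_linear _ _ (amul_linearr _)); apply: eq_cut2 => m r _ /=.
  by case: ifP => // _; rewrite (linear_at0 (amul_linearr _)).
rewrite -(cut2_assoc (fun l m r => if has fst l then 0 else
      amul (f (hat (~~ e) (hat true l ++ unit_input :: detag m))) (g (detag r)))).
rewrite -cut2Z; apply: eq_cut2 => y r _.
rewrite insert_unit_hat // (linear_scale _ _ (amul_linearl _)) scalerA -expr2 sqrr_sign scale1r.
rewrite /insert_unit (cut2_linear _ _ (amul_linearl _)); apply: eq_cut2 => l m _.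
by case: ifP => // _; rewrite (linear_at0 (amul_linearl _)).
Qed.

Lemma insert_unit_idf x : insert_unit idf x = unitf x.
Proof.
case: x => [|u x]; first by rewrite /insert_unit cut2_nil.
rewrite /insert_unit cut2_0 // => l r lr; case: ifP => // _; apply: idf_size.
have := congr1 size lr; rewrite !size_cat /= size_hat size_detag; lia.
Qed.

(** The two products of an element of the algebra with the unit cancel. If
    the element is of bimodule type, the unit is inserted on its left only. *)
Lemma insert_unit_m2f x : (count fst x <= 1)%N ->
  insert_unit m2f x = - (if x is [:: u] then (if u.1 then u.2 else 0) else 0) :> A.
Proof.
move=> cx; have [|s1] := eqVneq (size x) 1%N; last first.
  have -> : (if x is [:: u] then if u.1 then u.2 else 0 else 0) = 0 :> A.
    by case: x s1 {cx} => [|u [|]].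
  rewrite oppr0; apply: cut2_0 => l' r lr; case: ifP => // _; apply: m2f_size.
  by apply: contra_neq s1 => s2; move: s2; rewrite -lr !size_cat /= size_hat size_detag; lia.
case: x cx => [|[t u] [|? ?]] //= _ _.
rewrite /insert_unit !cut2_cons cut2_nil /= orbF /detag /= m2f_pair /tmul /= sg_one expr1 scaleN1r.
rewrite (linear_opp _ (amul_linearl _)) amul1; case: t => /=; first by rewrite addr0.
by rewrite m2f_pair /tmul /= sg_sg addbb amulr1 oppr0 addNr.
Qed.

Lemma insert_unit_single f y x : multilinear f -> has fst y = false -> (count fst x <= 1)%N ->
  cut3 (fun l m r => if has fst l then 0 else
    f (y ++ l ++ (true, if m is [:: u] then (if u.1 then u.2 else 0) else 0) :: detag r)) x =
  if has fst x then f (y ++ x) else 0.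
Proof.
move=> fl; elim: x y => [|u x IH] y hy cx.
  by rewrite /cut3 !cut2_nil /= multilinear0.
rewrite cut3_single => [|l m r]; last first.
  by case: m => [|v [|? ?]] //= _; case: ifP => // _; rewrite catA multilinear0.
case: u cx => -[] u /= cx.
  rewrite cut3_0 ?addr0 // detag_id //; apply/negbTE; rewrite has_count; lia.
rewrite multilinear0 // add0r -cat_rcons -(IH (rcons y (false, u))) ?has_rcons //.
by apply: eq_cut3 => l m r _; rewrite -cat_rcons.
Qed.

(** A product that is inserted into f can have the inserted unit as a factor.
    By insert_unit_m2f these terms cancel, except for the one that restores
    f. *)
Lemma insert_unit_insert f x : multilinear f -> (count fst x <= 1)%N ->
  insert_unit (insert true m2f f) x =
    - insert true m2f (insert_unit f) x - (if has fst x then f x else 0).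
Proof.
move=> fl cx.
(* The product lies on the left of the unit in T1, on its right in T3, and it *)
(* has the unit as a factor in T2. *)
pose T1 := cut2 (fun y r => cut3 (fun l m n => if has fst (l ++ m ++ n) then 0 else
  f (hat true (hat true l ++ out m2f m :: n) ++ unit_input :: detag r)) y) x.
pose T3 := cut2 (fun l y => cut3 (fun p m r => if has fst l then 0 else
  f (l ++ unit_input :: detag (hat true p ++ out m2f m :: r))) y) x.
pose T2 := cut2 (fun y w => cut2 (fun l m => cut2 (fun p r => if has fst (l ++ m) then 0 else
  f (l ++ (true, m2f (hat true m ++ unit_input :: detag p)) :: detag r)) w) y) x.
have -> : insert_unit (insert true m2f f) x = - T1 + T2 - T3.
  transitivity (cut2 (fun l r => if has fst l then 0 else
      insert true m2f (fun y => f (y ++ unit_input :: detag r)) (hat true l)) x +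
    cut2 (fun l r => if has fst l then 0 else cut2 (fun l' m => cut2 (fun m' r' =>
      f (hat true l' ++ out m2f (m ++ unit_input :: m') :: r')) (detag r)) (hat true l)) x +
    cut2 (fun l r => if has fst l then 0 else cut3 (fun l' m r' =>
      f (hat true (hat true l ++ unit_input :: l') ++ out m2f m :: r')) (detag r)) x).
    rewrite -!cut2D; apply: eq_cut2 => l r _; case: ifP => _; first by rewrite !addr0.
    exact: insert_cat_cons.
  congr (_ + _ + _).
  - rewrite /T1 -scaleN1r -cut2Z; apply: eq_cut2 => y r _; rewrite -cut3Z.
    rewrite insert_hat; [|exact: multilinear_left|exact: sign_homog_m2f].
    rewrite expr1 -cut3Z; case: ifP => hy.
      by rewrite cut3_0 // => l m n ->; rewrite hy scaler0.
    by apply: eq_cut3 => l m n ->; rewrite hy.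
  - apply: eq_cut2 => y w _; case: ifP => hy.
      by rewrite cut2_0 // => a b ab; rewrite cut2_0 // => p r _; rewrite ab hy.
    rewrite cut2_map; apply: eq_cut2 => l m lm; rewrite cut2_map; apply: eq_cut2 => p r _.
    rewrite lm hy hat_hat addbb hat0; congr (f (_ ++ _ :: _)).
    by rewrite /out has_cat /= orbT.
  rewrite /T3 -scaleN1r -cut2Z; apply: eq_cut2 => l y ly; rewrite -cut3Z.
  case: ifP => _; first by rewrite cut3_0 // => *; rewrite scaler0.
  rewrite cut3_map; apply: eq_cut3 => p m r pmr.
  have cm : (count fst m <= 1)%N by move: cx; rewrite -ly -pmr count_cat count_cat3; lia.
  rewrite hat_cat hat_hat addbb hat0 /= sg_one expr1 -catA cat_cons multilinearZ //.
  congr (_ *: f (_ ++ _ :: _)); rewrite -/(detag p) detag_cat detag_hat /=.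
  by rewrite -/(detag m) /out has_detag m2f_detag.
have -> : insert true m2f (insert_unit f) x = T1 + T3.
  rewrite /T1 /T3 -cut3_right -cut3_left -cut3D {1}/insert; apply: eq_cut3 => l m r _.
  rewrite /insert_unit cut2_cat_cons addrC; congr (_ + _).
    by apply: eq_cut2 => a b _; rewrite has_out !has_cat has_hat.
  by rewrite cut2_map; apply: eq_cut2 => a b _; rewrite has_hat hat_hat addbb hat0.
have -> : T2 = - (if has fst x then f x else 0).
  rewrite -(@insert_unit_single f [::]) // /T2.
  rewrite (cut2_assoc (fun l m w => cut2 (fun p r => if has fst (l ++ m) then 0 else
    f (l ++ (true, m2f (hat true m ++ unit_input :: detag p)) :: detag r)) w)).
  rewrite -scaleN1r -cut3Z; apply: eq_cut2 => l v lv.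
  rewrite -(cut2_assoc (fun m p r => if has fst (l ++ m) then 0 else
    f (l ++ (true, m2f (hat true m ++ unit_input :: detag p)) :: detag r))).
  apply: eq_cut2 => u r ur.
  have cu : (count fst u <= 1)%N by move: cx; rewrite -lv -ur !count_cat; lia.
  case: ifP => hl.
    by rewrite scaler0 cut2_0 // => m p _; rewrite has_cat hl.
  rewrite scaleN1r -(linear_opp _ (multilinear_slot l (detag r) true fl)).
  rewrite -insert_unit_m2f // /insert_unit multilinear_cut2 //; apply: eq_cut2 => m p _.
  by rewrite has_cat hl /=; case: ifP => // _; rewrite multilinear0.
by linear_comb k A.
Qed.

End UnitInsertion.

(** * Algebra cochains as a retract of bimodule cochains *)

Section Retract.
Variables (k : fieldType) (A : gradedAlgType k).
Implicit Types (q t n : int) (e : bool) (l m r x y : seq (input A)).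

Let C : lmodType k := cochain A.
Implicit Types (a b c z : C).
Local Notation bim := (bim_cochains A).
Local Notation alg := (alg_cochains A).
Local Notation m2 := (bim_m2 A).
Local Notation am2 := (alg_m2 A).

(** The diagonal bimodule is A itself, so that a cochain of A also accepts
    one input of bimodule type. *)
Definition extend c : C := fun q x =>
  if (count fst x <= 1)%N then c q (detag x) else 0.

Lemma algP c : reflect (c \in bim /\ forall q x, has fst x -> c q x = 0) (c \in alg).
Proof. by apply: (iffP andP) => -[cS ca]; split=> //; apply/asboolP. Qed.

Lemma alg_bim c : c \in alg -> c \in bim.
Proof. by move=> /algP[]. Qed.

Lemma extend_linear (u : k) a b : extend (u *: a + b) = u *: extend a + extend b.
Proof.
apply/funext => q; apply/funext => x; rewrite !fctE /extend.
by case: ifP => _; rewrite ?scaler0 ?addr0.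
Qed.

Lemma kappa0_linear (u : k) a b : kappa0 (u *: a + b : C) = u *: kappa0 a + kappa0 b :> C.
Proof.
apply/funext => q; apply/funext => x; rewrite !fctE /kappa0.
by case: ifP => _; rewrite ?scaler0 ?addr0.
Qed.

Lemma kappa0_alg c : c \in bim -> kappa0 c \in alg.
Proof.
move=> cS; apply/algP; split; last by move=> q x hx; rewrite /kappa0 hx.
apply/bimP; split.
- move=> q l r b a u v; rewrite /kappa0 !has_cat /=; case: ifP => _.
    by rewrite scaler0 addr0.
  exact: bim_multilinear.
- by move=> q x xh; rewrite /kappa0; case: ifP => _; [exact: homog0 | exact: bim_degree].
- by move=> q x cx; rewrite /kappa0 (bim_typed q cS cx) if_same.
have [N cN] := bim_finite cS; exists N => q x; rewrite /kappa0.
by case: ifP => [_|_ /cN //]; rewrite eqxx.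
Qed.

Lemma kappa0_id c : c \in alg -> kappa0 c = c.
Proof.
move=> /algP[_ ca]; apply/funext => q; apply/funext => x; rewrite /kappa0.
by case: ifP => // hx; rewrite ca.
Qed.

Lemma extend_bim c : c \in alg -> extend c \in bim.
Proof.
move=> /alg_bim cS; apply/bimP; split.
- move=> q l r b a u v; rewrite /extend !count_cat /=; case: ifP => _; last first.
    by rewrite scaler0 addr0.
  by rewrite !detag_cat /= (bim_multilinear q cS).
- move=> q x xh; rewrite /extend; case: ifP => _; last exact: homog0.
  have -> : detag [seq u.2 | u <- x] = [seq u.2 | u <- [seq (u.1, (false, u.2.2)) | u <- x]].
    by rewrite /detag -!map_comp.
  have -> : \sum_(u <- x) u.1 = \sum_(u <- [seq (u.1, (false, u.2.2)) | u <- x]) u.1.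
    by rewrite big_map.
  by apply: bim_degree => // u /mapP[v vx ->] /=; apply: xh.
- by move=> q x cx; rewrite /extend leqNgt cx.
have [N cN] := bim_finite cS; exists N => q x; rewrite /extend.
by case: ifP => [_ /cN|_]; rewrite ?size_detag ?eqxx.
Qed.

Lemma kappa0_extend c : c \in alg -> kappa0 (extend c) = c.
Proof.
move=> /algP[cS ca]; apply/funext => q; apply/funext => x; rewrite /kappa0 /extend.
case: ifP => [hx|hx]; first by rewrite ca.
by rewrite detag_id // ifT //; move/negbT: hx; rewrite has_count; lia.
Qed.

(** If no input is of bimodule type, then neither is an intermediate value. *)
Lemma kappa0_wbrace w a b : kappa0 (wbrace w a b) = wbrace w (kappa0 a) (kappa0 b) :> C.
Proof.
apply/funext => q; apply/funext => x; rewrite /kappa0 !wbraceE; case: ifP => hx.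
  apply/esym/cut3_0 => l m r lmr; apply: fsum0 => t; rewrite /wterm.
  by rewrite has_cat has_kz /= -!has_cat lmr hx !scaler0.
apply: eq_cut3 => l m r lmr; apply: eq_fsum => t; rewrite /wterm.
rewrite has_cat has_kz /= -!has_cat lmr hx; congr (_ *: (_ *: a _ (_ ++ _ :: _))).
rewrite /out; have -> : has fst m = false by move: hx; rewrite -lmr !has_cat => /norP[_ /norP[/negPf]].
by [].
Qed.

Lemma kappa0_cup a b : kappa0 (cup m2 a b) = cup am2 (kappa0 a) (kappa0 b) :> C.
Proof.
apply/funext => q; apply/funext => x; rewrite /kappa0 !cupE; case: ifP => hx.
  apply/esym/cut2_0 => l r lr; apply: fsum0 => t; rewrite negb_and !negbK.
  by rewrite -has_cat lr hx /= scaler0.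
apply: eq_cut2 => l r lr; apply: eq_fsum => t; rewrite has_kz.
by move: hx; rewrite -lr has_cat => /norP[/negPf -> /negPf ->].
Qed.

Lemma kappa0_m2 : kappa0 m2 = am2 :> C.
Proof.
apply/funext => q; apply/funext => -[|u [|v [|w x]]]; rewrite /kappa0 /= ?if_same //.
by case: u.1; case: v.1; rewrite ?andbF.
Qed.

Lemma alg_m2_alg : am2 \in alg.
Proof. by rewrite -kappa0_m2; apply: kappa0_alg bim_m2_bim. Qed.

Lemma detag_kz t x : detag (kz t x) = kz t (detag x).
Proof. by rewrite /detag /kz -!map_comp. Qed.

Lemma extend_wbrace w a b : a \in alg -> b \in alg ->
  extend (wbrace w a b) = wbrace w (extend a) (extend b) :> C.
Proof.
move=> aS bS; have aS' := extend_bim aS; have bS' := extend_bim bS.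
apply/funext => q; apply/funext => x; rewrite /extend; case: ifP => cx; last first.
  by rewrite (bim_typed q (wbrace_bim w aS' bS')) // ltnNge cx.
rewrite !wbraceE /detag cut3_map; apply: eq_cut3 => l m r lmr; apply: eq_fsum => t.
have cm : (count fst m <= 1)%N by move: cx; rewrite -lmr count_cat3; lia.
rewrite /wterm !size_map /extend count_out_le1 // !count_cat count_kz -!count_cat lmr cx.
rewrite map_cat /= /out cm -!/(detag _) has_detag detag_kz.
by [].
Qed.

Lemma extend_cup a b : a \in alg -> b \in alg ->
  extend (cup am2 a b) = cup m2 (extend a) (extend b) :> C.
Proof.
move=> aS bS; have aS' := extend_bim aS; have bS' := extend_bim bS.
apply/funext => q; apply/funext => x; rewrite /extend; case: ifP => cx; last first.
  by rewrite (bim_typed q (cup_bim aS' bS')) // ltnNge cx.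
rewrite !cupE /detag cut2_map; apply: eq_cut2 => l r lr; apply: eq_fsum => t.
move: cx; rewrite -lr count_cat -/(detag l) -/(detag r) => cx.
have [cl cr] : (count fst l <= 1)%N /\ (count fst r <= 1)%N by split; lia.
rewrite -!/(detag _) size_detag count_kz cl cr !has_detag detag_kz /= negbK; congr (_ *: _).
have -> // : has fst l && has fst r = false.
by rewrite !has_count; lia.
Qed.

Lemma extend_m2 : extend am2 = m2.
Proof.
apply/funext => q; apply/funext => -[|[t u] [|[t' v] [|w x]]]; rewrite /extend /= ?if_same //.
by case: t; case: t'; rewrite ?andbF ?mulr0n.
Qed.

End Retract.

Section Kappa.
Variables (k : fieldType) (A : gradedAlgType k).
Implicit Types (q t n : int) (e : bool) (l m r x y : seq (input A)).

Let W : lmodType k := mmap A.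
Let C : lmodType k := cochain A.
Implicit Types (a b c z : C).
Local Notation bim := (bim_cochains A).
Local Notation alg := (alg_cochains A).
Local Notation m2 := (bim_m2 A).
Local Notation am2 := (alg_m2 A).
Local Notation d := (@bim_d k A).
Local Notation da := (@alg_d k A).

Lemma kappa0D a b : kappa0 (a + b : C) = kappa0 a + kappa0 b :> C.
Proof. by have := kappa0_linear 1 a b; rewrite !scale1r. Qed.

Lemma kappa00 : kappa0 (0 : C) = 0 :> C.
Proof. by apply/funext => q; apply/funext => x; rewrite /kappa0 if_same. Qed.

Lemma kappa0N a : kappa0 (- a : C) = - kappa0 a :> C.
Proof. by have := kappa0_linear (-1) a 0; rewrite !scaleN1r kappa00 !addr0. Qed.

Lemma extendD a b : extend (a + b) = extend a + extend b.
Proof. by have := extend_linear 1 a b; rewrite !scale1r. Qed.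

Lemma extend0 : extend (0 : C) = 0.
Proof. by apply/funext => q; apply/funext => x; rewrite /extend if_same. Qed.

Lemma extendN a : extend (- a) = - extend a.
Proof. by have := extend_linear (-1) a 0; rewrite !scaleN1r extend0 !addr0. Qed.

Lemma kappa0_bracket a b : kappa0 (bracket a b) = bracket (kappa0 a) (kappa0 b) :> C.
Proof. by rewrite /bracket kappa0D kappa0N /brace !kappa0_wbrace. Qed.

Lemma extend_bracket a b : a \in alg -> b \in alg ->
  extend (bracket a b) = bracket (extend a) (extend b) :> C.
Proof. by move=> aS bS; rewrite /bracket extendD extendN /brace !extend_wbrace. Qed.

Lemma kappa0_d c : kappa0 (d c) = da (kappa0 c) :> C.
Proof. by rewrite /bim_d kappa0_bracket kappa0_m2. Qed.

Lemma extend_d c : c \in alg -> extend (da c) = d (extend c).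
Proof. by move=> cS; rewrite /alg_d extend_bracket ?alg_m2_alg // extend_m2. Qed.

Lemma kappa0_even_part c : kappa0 (even_part c) = even_part (kappa0 c) :> C.
Proof.
by apply/funext => q; apply/funext => x; rewrite /kappa0 /even_part; do 2!case: ifP.
Qed.

Lemma extend_even_part c : extend (even_part c) = even_part (extend c).
Proof.
apply/funext => q; apply/funext => x; rewrite /extend /even_part size_detag.
by do 2!case: ifP.
Qed.

Lemma extend_sq c : c \in alg -> extend (sq_cochain c) = sq_cochain (extend c) :> C.
Proof.
move=> cS; rewrite /sq_cochain; case: ifP => _; first exact: extend_wbrace.
rewrite -extend_even_part /brace extend_wbrace //.
  rewrite -(kappa0_extend cS) -kappa0_even_part; apply: kappa0_alg.
  exact/even_part_bim/extend_bim.
rewrite -(kappa0_extend cS) -kappa0_even_part; apply: kappa0_alg.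
exact/even_part_bim/extend_bim.
Qed.

Lemma par_extend e c : par e c -> par e (extend c).
Proof.
by move=> ce q x; rewrite /extend; case: ifP => [_ /ce|_]; rewrite ?size_detag ?eqxx.
Qed.

(** * The second component of kappa *)

Lemma kappa1E c q x : kappa1 c q x = if has fst x then 0 else
  cut2 (fun l r => (-1) ^+ size r *: c q (l ++ unit_input A :: r)) x.
Proof.
rewrite /kappa1 /cut2; case: ifP => // _; apply: eq_bigr => p _.
by rewrite size_drop.
Qed.

Lemma kappa1_linear (u : k) a b : kappa1 (u *: a + b : C) = u *: kappa1 a + kappa1 b :> C.
Proof.
apply/funext => q; apply/funext => x; rewrite !fctE !kappa1E.
case: ifP => _; first by rewrite scaler0 addr0.
rewrite -cut2Z -cut2D; apply: eq_cut2 => l r _.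
by rewrite !fctE scalerDr !scalerA mulrC.
Qed.

Lemma homog_one : homog 0 (aone : A).
Proof. exact: hcomp_one. Qed.

Lemma homog_insert_unit c q (l r : seq (int * input A)) : c \in bim ->
  (forall u, u \in l ++ r -> homog u.1 u.2.2) ->
  homog (\sum_(u <- l ++ r) u.1 + q)
    (c q ([seq u.2 | u <- l] ++ unit_input A :: [seq u.2 | u <- r])).
Proof.
move=> cS lrh.
have -> : [seq u.2 | u <- l] ++ unit_input A :: [seq u.2 | u <- r] =
    [seq u.2 | u <- l ++ (0, unit_input A) :: r] by rewrite map_cat.
have -> : \sum_(u <- l ++ r) u.1 = \sum_(u <- l ++ (0, unit_input A) :: r) u.1.
  by rewrite !big_cat big_cons /= add0r.
apply: bim_degree => // u; rewrite mem_cat inE => /or3P[ul|/eqP ->|ur]; last 2 first.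
- exact: homog_one.
- by apply: lrh; rewrite mem_cat ur orbT.
by apply: lrh; rewrite mem_cat ul.
Qed.

Lemma kappa1_alg c : c \in bim -> kappa1 c \in alg.
Proof.
move=> cS; apply/algP; split; last by move=> q x hx; rewrite /kappa1 hx.
apply/bimP; split.
- move=> q l r b a u v; rewrite !kappa1E !has_cat /=; case: ifP => _.
    by rewrite scaler0 addr0.
  have cl := bim_multilinear q cS.
  suff : multilinear (cut2 (fun l r => (-1) ^+ size r *: c q (l ++ unit_input A :: r))) by apply.
  apply: multilinear_cut2_fun => [y|y].
    by move=> l' r' b' a' u' v'; rewrite (multilinear_left _ _ cl) scalerDr !scalerA mulrC.
  exact: (multilinear_sized (fun s : nat => (-1) ^+ s) (multilinear_right (unit_input A) y cl)).
- move=> q x xh; rewrite kappa1E; case: ifP => _; first exact: homog0.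
  rewrite cut2_map; apply: homog_cut2 => l r lr; apply: homogZ; rewrite -lr.
  by apply: homog_insert_unit => // u; rewrite lr; apply: xh.
- move=> q x cx; rewrite kappa1E ifT // has_count; lia.
have [N cN] := bim_finite cS; exists N => q x; rewrite kappa1E.
case: ifP => _; first by rewrite eqxx.
move=> nz; have [l [r [lr /cN]]] : exists l r, l ++ r = x /\ c q (l ++ unit_input A :: r) != 0.
  apply: contrapT => no; move/eqP: nz; apply; apply: cut2_0 => l r lr; apply/eqP.
  by apply: contra_notT no => nz; exists l, r; split=> //; apply: contra_neq nz => ->; rewrite scaler0.
by rewrite -lr !size_cat /=; lia.
Qed.

Lemma kappa1_neq0 c q x : kappa1 c q x != 0 -> exists y, c q y != 0 /\ size y = (size x).+1.
Proof.
rewrite kappa1E; case: ifP => _; first by rewrite eqxx.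
move=> nz; apply: contrapT => no; move/eqP: nz; apply; apply: cut2_0 => l r lr; apply/eqP.
apply: contra_notT no => nz; exists (l ++ unit_input A :: r); split.
  by apply: contra_neq nz => ->; rewrite scaler0.
by rewrite -lr !size_cat addnS.
Qed.

Lemma par_kappa1 e c : par e c -> par (~~ e) (kappa1 c).
Proof.
move=> ce q x /kappa1_neq0[y [/ce/orP[-> //|py] sy]]; apply/orP; right.
by move: py; rewrite sy; case: e {ce} => /=; lia.
Qed.

Lemma twist_insert_unit l r :
  twist (hat true l ++ unit_input A :: r) =
  hat (odd (size r)) (twist l) ++ (true, (-1) ^+ odd (size r) *: aone) :: twist r.
Proof. by rewrite twist_mid twist_hat hat_hat /= sg_one addbT negbK. Qed.

Lemma signr_size (s : nat) : (-1 : k) ^+ s = (-1) ^+ odd s.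
Proof. by rewrite signr_odd. Qed.

Lemma totf_kappa1 c x : c \in bim ->
  totf (kappa1 c) x = if has fst x then 0 else insert_unit (totf c) x.
Proof.
move=> cS; have [N cN] := bim_finite cS; rewrite /totf.
case: ifP => hx; first by apply: fsum0 => q; rewrite kappa1E has_twist hx.
under eq_fsum do rewrite kappa1E has_twist hx cut2_twist.
rewrite (@fsum_cut2 _ _ _ N) => [|q l r]; last first.
  by move=> nz; have /cN/andP[] : c q (hat (odd (size r)) (twist l) ++ unit_input A :: twist r) != 0;
     first by apply: contra_neq nz => ->; rewrite scaler0.
apply: eq_cut2 => l r lr; move: hx; rewrite -lr has_cat => /norP[/negPf -> /negPf hr].
apply: eq_fsum => q; rewrite (detag_id hr) twist_insert_unit.
by rewrite (multilinearZ _ _ _ _ _ (bim_multilinear q cS)) signr_size size_twist.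
Qed.

Lemma totf_kappa0 c x : totf (kappa0 c) x = if has fst x then 0 else totf c x.
Proof.
rewrite /totf; case: ifP => hx; first by apply: fsum0 => q; rewrite /kappa0 has_twist hx.
by apply: eq_fsum => q; rewrite /kappa0 has_twist hx.
Qed.

Lemma insert_unit_m2_left e f x : insert_unit (cupf e idf f) x =
  cut2 (fun l y => if has fst l then 0 else amul (idf (hat e l)) (insert_unit f y)) x +
  (-1) ^+ (~~ e) *: f (detag x).
Proof.
rewrite insert_unit_cup; last exact: multilinear_idf.
rewrite [X in _ + _ *: X]cut2_first => [|w l r]; rewrite insert_unit_idf /= ?amul1 //.
by rewrite (linear_at0 (amul_linearl _)).
Qed.

(** There is no sign because eps multiplies from the right. The products in
    which the inserted unit is a factor cancel. *)
Lemma kappa1_d_par e c : c \in bim -> par e c -> kappa1 (d c) = da (kappa1 c).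
Proof.
move=> cS ce; have uS := alg_bim (kappa1_alg cS); have ue := par_kappa1 ce.
have fl := multilinear_totf cS.
have -> : da (kappa1 c) = kappa0 (d (kappa1 c)) by rewrite kappa0_d (kappa0_id (kappa1_alg cS)).
have dS := d_bim cS; have duS := d_bim uS.
apply: totf_inj; [exact/alg_bim/kappa1_alg | exact/alg_bim/kappa0_alg |].
apply/funext => x; rewrite totf_kappa1 // totf_kappa0.
case: ifP => hx //; rewrite (totf_d cS ce) (totf_d uS ue) /df.
rewrite (insert_m2f (sign_homog_totf cS ce)) (insert_m2f (sign_homog_totf uS ue)).
have cx : (count fst x <= 1)%N by move/negbT: hx; rewrite has_count; lia.
set f := totf c; set g := totf (kappa1 c).
rewrite (linear_add _ _ (@insert_unit_linear k A)) (linear_opp _ (@insert_unit_linear k A)).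
rewrite (linear_add _ _ (@insert_unit_linear k A)) !(linear_scale _ _ (@insert_unit_linear k A)) !fctE.
have sub l r : l ++ r = x -> has fst l = false /\ has fst r = false.
  by move=> lr; move: hx; rewrite -lr has_cat => /norP[/negPf -> /negPf ->].
have gE y : has fst y = false -> g y = insert_unit f y by move=> hy; rewrite /g totf_kappa1 // hy.
have E1 : insert_unit (cupf e idf f) x = cupf (~~ e) idf g x + (-1) ^+ (~~ e) *: f x.
  rewrite insert_unit_m2_left detag_id //; congr (_ + _); apply: eq_cut2 => l y ly.
  by have [hl hy] := sub _ _ ly; rewrite hl hy /= negbK gE.
have E2 : insert_unit (cupf false f idf) x = f x - cupf false g idf x.
  rewrite insert_unit_cup // expr1 scaleN1r; congr (_ - _).
    have := congr1 (@^~ x) (cupf1r f); rewrite /cupf => <-; apply: eq_cut2 => l y ly.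
    by have [hl hy] := sub _ _ ly; rewrite hl hy insert_unit_idf.
  apply: eq_cut2 => l y ly; have [hl hy] := sub _ _ ly.
  by rewrite hl hy gE ?has_hat // detag_id.
have E3 : insert_unit (insert true m2f f) x = - insert true m2f g x.
  rewrite insert_unit_insert // hx subr0; congr (- _); apply: eq_cut3 => l m r lmr.
  by rewrite gE // has_out has_cat has_hat -has_cat lmr.
rewrite E1 E2 E3.
by case: e {ce ue E1} => /=; linear_comb k A.
Qed.

Lemma kappa1D a b : kappa1 (a + b : C) = kappa1 a + kappa1 b :> C.
Proof. by have := kappa1_linear 1 a b; rewrite !scale1r. Qed.

Lemma kappa10 : kappa1 (0 : C) = 0 :> C.
Proof.
apply/funext => q; apply/funext => x; rewrite kappa1E; case: ifP => // _.
by rewrite cut2_0 // => l r _; rewrite scaler0.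
Qed.

Lemma kappa1N a : kappa1 (- a : C) = - kappa1 a :> C.
Proof. by have := kappa1_linear (-1) a 0; rewrite !scaleN1r kappa10 !addr0. Qed.

Lemma daD a b : a \in alg -> b \in alg -> da (a + b) = da a + da b :> C.
Proof. by move=> aS bS; have := alg_d_linear 1 aS bS; rewrite !scale1r. Qed.

Lemma kappa1_d c : c \in bim -> kappa1 (d c) = da (kappa1 c).
Proof.
move: c; apply: bim_ind => [a b aS bS aE bE|e c cS ce]; last exact: kappa1_d_par cS ce.
by rewrite (dD aS bS) (kappa1D (d a)) (kappa1D a) aE bE daD //; apply: kappa1_alg.
Qed.

(** * The class of eps *)

(** The identity map of the bimodule, a cocycle that represents eps. *)
Definition module_id : C := fun q x =>
  if x is [:: u] then (if u.1 && (q == 0) then u.2 else 0) else 0.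

Definition module_idf : mmap A := fun x =>
  if x is [:: u] then (if u.1 then u.2 else 0) else 0.

Lemma module_id_bidegree : of_bidegree 1 0 module_id.
Proof.
move=> q [|[t u] [|? ?]]; rewrite /= ?eqxx //.
by case: t; rewrite ?eqxx //=; case: (q =P 0) => [-> _|]; rewrite ?eqxx.
Qed.

Lemma module_id_bim : module_id \in bim.
Proof.
apply/bimP; split.
- move=> q [|w l] [|w' r] b a u v /=; rewrite ?scaler0 ?addr0 //.
  + by case: ifP; rewrite ?scaler0 ?addr0.
  + by case: l => *; rewrite scaler0 addr0.
  by case: l => *; rewrite scaler0 addr0.
- move=> q [|[i [t u]] [|? ?]] xh; try exact: homog0.
  rewrite /= big_seq1 /=; case: ifP => [/andP[_ /eqP ->]|_]; last exact: homog0.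
  by rewrite addr0; apply: (xh (i, (t, u))); rewrite inE eqxx.
- by move=> q [|u [|? ?]] //=; case: u.1.
exists 1%N => q x nz; have [sx q0] := module_id_bidegree nz; rewrite q0.
by move: sx; lia.
Qed.

Lemma par_module_id : par false module_id.
Proof. by move=> q x /module_id_bidegree[-> ->]; rewrite orbT. Qed.

Lemma totf_module_id : totf module_id = module_idf.
Proof.
apply/funext => x; rewrite /totf (@fsum_unique _ _ 0).
  by case: x => [|u [|? ?]] //=; rewrite andbT.
by move=> t t0; case: x => [|u [|v x]] //=; rewrite (negPf t0) andbF.
Qed.

Lemma module_idf_size x : size x != 1%N -> module_idf x = 0.
Proof. by case: x => [|u [|v x]]. Qed.

Lemma insert_module_idf e (b : mmap A) x : insert e b module_idf x = if has fst x then b x else 0.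
Proof. by rewrite insert_single //; apply: module_idf_size. Qed.

(** The blocks that contribute are the single inputs of bimodule type, each
    of them replaced by itself. *)
Lemma module_idf_insert f y x : multilinear f ->
  cut3 (fun l m r => f (y ++ l ++ out module_idf m :: r)) x = (count fst x)%:R *: f (y ++ x).
Proof.
move=> fl; elim: x y => [|u x IH] y.
  by rewrite /cut3 !cut2_nil /= scale0r multilinear0.
rewrite cut3_single => [|l m r sm]; last first.
  by rewrite /out module_idf_size // catA multilinear0.
have -> : cut3 (fun l m r => f (y ++ (u :: l) ++ out module_idf m :: r)) x =
    (count fst x)%:R *: f (y ++ u :: x).
  by rewrite -cat_rcons -IH; apply: eq_cut3 => l m r _; rewrite cat_rcons.
case: u => -[] u /=; last by rewrite /out /= multilinear0 // add0r.
by rewrite /out /= add1n mulrS scalerDl scale1r.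
Qed.

Lemma insert_module_idf_right f x : multilinear f ->
  insert false module_idf f x = (count fst x)%:R *: f x.
Proof.
move=> fl; rewrite -(module_idf_insert [::] x fl).
by apply: eq_cut3 => l m r _; rewrite hat0.
Qed.

(** For c{E} the cochain c is multiplied by the number of inputs of bimodule
    type; for E{c} it is restricted to the lists with such an input. There is
    at most one of them. *)
Lemma bracket_module_id c : c \in bim -> bracket c module_id = 0 :> C.
Proof.
move: c; apply: bim_ind => [a b aS bS aE bE|e c cS ce].
  by rewrite bracketDl ?aE ?bE ?addr0 //; apply: module_id_bim.
have iS := module_id_bim; have bS := bracket_bim cS iS; have fl := multilinear_totf cS.
apply: totf_inj; [exact: bS | bim |].
rewrite (totf_bracket cS iS ce par_module_id) totf_module_id totf0 /brf andbF scale1r.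
apply/funext => x; rewrite !fctE insert_module_idf insert_module_idf_right //.
have [cx|cx] := leqP (count fst x) 1; last first.
  have -> : totf c x = 0.
    by apply: fsum0 => q; rewrite (bim_typed q cS) // count_twist.
  by rewrite scaler0 if_same subrr.
rewrite has_count; case: (count fst x) cx => [|[|]] //= _; rewrite ?scale0r ?scale1r subrr //.
Qed.

End Kappa.

Arguments module_idf {k A} x.

(** * The contraction onto the multiples of eps *)

Section Homotopy.
Variables (k : fieldType) (A : gradedAlgType k).
Implicit Types (q t n : int) (e : bool) (l m r x y : seq (input A)).

Let W : lmodType k := mmap A.
Let C : lmodType k := cochain A.
Implicit Types (a b c z : C).
Local Notation bim := (bim_cochains A).
Local Notation alg := (alg_cochains A).
Local Notation m2 := (bim_m2 A).
Local Notation am2 := (alg_m2 A).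
Local Notation d := (@bim_d k A).
Local Notation da := (@alg_d k A).
Local Notation E := (@module_id k A).

Lemma module_id_Z : Z E.
Proof. by split; [exact: module_id_bim | exact: bracket_module_id bim_m2_bim]. Qed.

(** Both factors would be in the bimodule. *)
Lemma cup_module_id_self : cup m2 E E = 0 :> C.
Proof.
have iS := @module_id_bim k A; have iiS := cup_bim iS iS.
apply: totf_inj; [exact: iiS | exact: bim_0 |].
rewrite (totf_cup iS iS (@par_module_id k A)) totf_module_id totf0.
apply/funext => x; apply: cut2_0 => l r _.
have [|sl] := eqVneq (size l) 1%N; last first.
  by rewrite module_idf_size ?size_hat // (linear_at0 (tmul_linearl _ _)).
case: l => [|[[] u] [|? ?]] // _; last first.
  by rewrite [module_idf (hat _ _)]/= (linear_at0 (tmul_linearl _ _)).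
have [|sr] := eqVneq (size r) 1%N; last first.
  by rewrite [module_idf r]module_idf_size // (linear_at0 (tmul_linearr _ _)).
case: r => [|[[] v] [|? ?]] // _.
by rewrite [module_idf [:: _]]/= (linear_at0 (tmul_linearr _ _)).
Qed.

Lemma brace_module_id_self : brace E E = E :> C.
Proof.
have iS := @module_id_bim k A; have iiS := brace_bim iS iS.
apply: totf_inj; [exact: iiS | exact: iS |].
rewrite (totf_brace iS iS (@par_module_id k A)) totf_module_id.
apply/funext => x; rewrite insert_module_idf.
by case: x => [|[[] u] [|? ?]] //=; rewrite if_same.
Qed.

Lemma kappa0_module_id : kappa0 E = 0 :> C.
Proof.
apply/funext => q; apply/funext => -[|[[] u] [|? ?]]; rewrite /kappa0 //=; by case: ifP.
Qed.

Lemma kappa0_cup_module_id a : kappa0 (cup m2 a E) = 0 :> C.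
Proof.
rewrite kappa0_cup kappa0_module_id; apply/funext => q; apply/funext => x.
rewrite cupE; apply: cut2_0 => l r _; apply: fsum0 => t.
by rewrite (linear_at0 (tmul_linearr _ _)) scaler0.
Qed.

Lemma insert_unit_module_idf x : has fst x = false -> insert_unit module_idf x = unitf x :> A.
Proof.
case: x => [|u x] hx; first by rewrite /insert_unit cut2_nil.
rewrite /insert_unit cut2_0 // => l r lr; case: ifP => // _; apply: module_idf_size.
by have := congr1 size lr; rewrite !size_cat /= size_hat size_detag; lia.
Qed.

(** The unit can only be inserted as the input of E, and E maps it to the
    unit of A. *)
Lemma kappa1_cup_module_id c : c \in alg -> kappa1 (cup m2 (extend c) E) = c.
Proof.
move=> cS; have eS := extend_bim cS; have iS := @module_id_bim k A.
have uS := cup_bim eS iS; have fl := multilinear_totf eS.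
apply: totf_inj; [exact/alg_bim/kappa1_alg | exact: alg_bim |].
apply/funext => x; rewrite totf_kappa1 // (totf_cup eS iS (@par_module_id k A)) totf_module_id.
have -> : totf c x = if has fst x then 0 else totf (extend c) x.
  by rewrite -{1}(kappa0_extend cS) totf_kappa0.
case: ifP => // hx; rewrite insert_unit_cup //.
rewrite [X in _ + _ *: X]cut2_0 => [|l r lr]; last first.
  have -> : module_idf (detag r) = 0 :> A by case: r {lr} => [|u [|? ?]].
  by rewrite (linear_at0 (amul_linearr _)).
rewrite scaler0 addr0.
have := congr1 (@^~ x) (cupf1r (totf (extend c))); rewrite /cupf => <-.
apply: eq_cut2 => l y ly; move: hx; rewrite -ly has_cat => /norP[/negPf hl /negPf hy].
by rewrite hl hy insert_unit_module_idf.
Qed.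

Lemma totf_extend c x : totf (extend c) x =
  if (count fst x <= 1)%N then totf c (detag x) else 0.
Proof.
have dt y : detag (twist y) = twist (detag y).
  by elim: y => //= u y ->; rewrite size_detag.
rewrite /totf; case: ifP => cx.
  by apply: eq_fsum => q; rewrite /extend count_twist cx dt.
by apply: fsum0 => q; rewrite /extend count_twist cx.
Qed.

Lemma kappa0_unit : kappa0 (unit_cochain A) = unit_cochain A :> C.
Proof. by apply/funext => q; apply/funext => -[|u x]; rewrite /kappa0 //= if_same. Qed.

Lemma insert_unitf f x : multilinear f ->
  insert true unitf f x = cut2 (fun l r => f (hat true l ++ (false, aone) :: r)) x.
Proof.
move=> fl; apply: eq_cut2 => l y _; apply: cut2_first => w m r.
exact: multilinear0.
Qed.

(** An extended cochain does not distinguish the unit of the bimodule from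
    the unit of the algebra. The other half of the bracket is 0 since the
    unit cochain has no inputs. *)
Lemma kappa1_extend c : c \in alg -> kappa1 (extend c) = bracket c (unit_cochain A).
Proof.
move=> cS; have eS := extend_bim cS; have uS := @unit_bim k A; have cb := alg_bim cS.
have fl := multilinear_totf cb.
suff -> : bracket c (unit_cochain A) = brace c (unit_cochain A) :> C.
  apply: totf_inj; [exact/alg_bim/kappa1_alg | exact: brace_bim |].
  rewrite (totf_brace cb uS par_unit) totf_unit; apply/funext => x.
  rewrite totf_kappa1 // insert_unitf //; case: ifP => hx.
    apply/esym/cut2_0 => l r lr; apply: fsum0 => q; move/algP: (cS) => [_ -> //].
    by rewrite has_twist has_cat has_hat /= -has_cat lr.
  apply: eq_cut2 => l r lr; move: hx; rewrite -lr has_cat => /norP[/negPf hl /negPf hr].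
  rewrite hl totf_extend count_cat /= count_hat.
  have cl : count fst l = 0%N by apply/eqP; move/negbT: hl; rewrite has_count -eqn0Ngt.
  have cr : count fst (detag r) = 0%N.
    by apply/eqP; move/negbT: (has_detag r); rewrite has_count -eqn0Ngt.
  rewrite cl cr /= detag_cat detag_hat (detag_id hl) /= (detag_id (has_detag r)).
  by rewrite (detag_id hr).
have -> : bracket c (unit_cochain A) = brace c (unit_cochain A) - 0 :> C; last by rewrite subr0.
rewrite /bracket; congr (_ - _); apply/funext => q; apply/funext => x.
rewrite wbraceE; apply: cut3_0 => l m r _; apply: fsum0 => t; rewrite /wterm.
have -> : unit_cochain A (q - t) (kz t l ++ out (c t) m :: r) = 0 by case: l.
by rewrite !scaler0.
Qed.

(** The unit of the bimodule is inserted on the left of the input of bimodule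
    type, and this input is moved to the algebra. *)
Definition homotopy c : C := fun q x => if count fst x == 1%N then
  cut2 (fun l r => if has fst l then 0 else
    (-1) ^+ size r *: c q (l ++ unit_input A :: detag r)) x else 0.

Lemma homotopy_bim c : c \in bim -> homotopy c \in bim.
Proof.
move=> cS; apply/bimP; split.
- move=> q l r b a u v; rewrite /homotopy !count_cat /=; case: ifP => _; last first.
    by rewrite scaler0 addr0.
  have cl := bim_multilinear q cS.
  suff : multilinear (cut2 (fun l r => if has fst l then 0 else
    (-1) ^+ size r *: c q (l ++ unit_input A :: detag r))) by apply.
  apply: multilinear_cut2_fun => [y|y] l' r' b' a' u' v'.
    rewrite !has_cat /=; case: ifP => _; first by rewrite scaler0 addr0.
    by rewrite (multilinear_left _ _ cl) scalerDr !scalerA mulrC.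
  case: ifP => _; first by rewrite scaler0 addr0.
  rewrite !detag_cat /= (multilinear_right _ _ cl) !size_cat /= scalerDr !scalerA.
  by rewrite mulrC.
- move=> q x xh; rewrite /homotopy; case: ifP => _; last exact: homog0.
  rewrite cut2_map; apply: homog_cut2 => l r lr; case: ifP => _; first exact: homog0.
  apply: homogZ.
  pose r' := [seq (u.1, (false, u.2.2)) | u <- r].
  have -> : detag [seq u.2 | u <- r] = [seq u.2 | u <- r'] by rewrite /detag /r' -!map_comp.
  have -> : \sum_(u <- x) u.1 = \sum_(u <- l ++ r') u.1.
    by rewrite -lr !big_cat /r' big_map.
  apply: homog_insert_unit => // u; rewrite mem_cat => /orP[ul|/mapP[v vr ->]] /=.
    by apply: xh; rewrite -lr mem_cat ul.
  by apply: xh; rewrite -lr mem_cat vr orbT.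
- by move=> q x cx; rewrite /homotopy; case: eqP => // c1; rewrite c1 in cx.
have [N cN] := bim_finite cS; exists N => q x; rewrite /homotopy.
case: (_ =P 1%N) => _; last by rewrite eqxx.
move=> nz; have [l [r [lr /cN]]] : exists l r, l ++ r = x /\ c q (l ++ unit_input A :: detag r) != 0.
  apply: contrapT => no; move/eqP: nz; apply; apply: cut2_0 => l r lr; case: ifP => // _; apply/eqP.
  by apply: contra_notT no => nz; exists l, r; split=> //; apply: contra_neq nz => ->; rewrite scaler0.
by rewrite -lr !size_cat /= size_detag; lia.
Qed.

Lemma par_homotopy e c : par e c -> par (~~ e) (homotopy c).
Proof.
move=> ce q x; rewrite /homotopy; case: (_ =P 1%N) => _; last by rewrite eqxx.
move=> nz; have [l [r [lr /ce]]] : exists l r, l ++ r = x /\ c q (l ++ unit_input A :: detag r) != 0.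
  apply: contrapT => no; move/eqP: nz; apply; apply: cut2_0 => l r lr; case: ifP => // _; apply/eqP.
  by apply: contra_notT no => nz; exists l, r; split=> //; apply: contra_neq nz => ->; rewrite scaler0.
move=> /orP[-> //|pc]; apply/orP; right; move: pc.
by rewrite -lr !size_cat /= size_detag; case: e {ce} => /=; lia.
Qed.

Lemma detag_twist y : detag (twist y) = twist (detag y) :> seq (input A).
Proof. by elim: y => //= u y ->; rewrite size_detag. Qed.

Lemma totf_homotopy c x : c \in bim ->
  totf (homotopy c) x = if count fst x == 1%N then insert_unit (totf c) x else 0.
Proof.
move=> cS; have [N cN] := bim_finite cS; rewrite /totf /homotopy count_twist.
case: eqP => cx; last exact: fsum0.
under eq_fsum do rewrite cut2_twist.
rewrite (@fsum_cut2 _ _ _ N) => [|q l r]; last first.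
  case: ifP => _; first by rewrite eqxx.
  by move=> nz; have /cN/andP[] : c q (hat (odd (size r)) (twist l) ++ unit_input A :: detag (twist r)) != 0;
     first by apply: contra_neq nz => ->; rewrite scaler0.
apply: eq_cut2 => l r lr; rewrite has_hat has_twist; case: ifP => _; first exact: fsum0.
apply: eq_fsum => q; rewrite twist_insert_unit size_detag detag_twist.
by rewrite (multilinearZ _ _ _ _ _ (bim_multilinear q cS)) signr_size size_twist.
Qed.

(** Inserting the unit as in the homotopy commutes with the differential up
    to the terms in which the unit meets a product. Applied to the cocycle
    condition for c this gives the homotopy formula. *)
Lemma homotopy_d e c : Z c -> par e c -> kappa0 c = 0 ->
  c - cup m2 (extend (kappa1 c)) E = d (- ((-1) ^+ e *: homotopy c)).
Proof.
move=> [cS dc] ce c0; have hS := homotopy_bim cS; have he := par_homotopy ce.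
have k1S := kappa1_alg cS; have eS := extend_bim k1S; have iS := @module_id_bim k A.
have fl := multilinear_totf cS; have hSd := d_bim hS; have ciS := cup_bim eS iS.
rewrite -scaleNr dZ //; apply: totf_inj; [bim | bim |].
rewrite totfB // totfZ // (totf_d hS he) (totf_cup eS iS (@par_module_id k A)) totf_module_id.
set f := totf c; set g := totf (extend (kappa1 c)); set h := totf (homotopy c).
have f0 x : has fst x = false -> f x = 0.
  by move=> hx; have := totf_kappa0 c x; rewrite hx c0 totf0.
apply/funext => x; rewrite !fctE.
have [cx|cx] := ltnP 1 (count fst x).
  have tot0 b : b \in bim -> totf b x = 0.
    by move=> bS; apply: fsum0 => q; rewrite (bim_typed q bS) // count_twist.
  rewrite /f /g /h tot0 // -(totf_d hS he) (tot0 _ hSd) scaler0 sub0r.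
  rewrite -totf_module_id -(totf_cup eS iS (@par_module_id k A)) tot0 // oppr0 //.
case hx: (has fst x); last first.
  rewrite f0 // sub0r; have -> : cupf false g module_idf x = 0.
    apply: cut2_0 => l r lr; have -> : module_idf r = 0 :> A.
      by move: hx; rewrite -lr has_cat; case: r {lr} => [|[[] u] [|? ?]] //=; rewrite orbT.
    by rewrite (linear_at0 (tmul_linearr _ _)).
  have := totf_kappa0 (d (homotopy c)) x; rewrite hx (totf_d hS he) -/h => <-.
  have -> : kappa0 (d (homotopy c)) = 0 :> C.
    rewrite kappa0_d; suff -> : kappa0 (homotopy c) = 0 :> C.
      by have := alg_d_linear (-1) (rpred0 alg) (rpred0 alg); rewrite !scaleN1r oppr0 addr0 addNr.
    apply/funext => q; apply/funext => y; rewrite /kappa0 /homotopy; case: ifP => // hy.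
    by case: eqP => // cy; move: hy; rewrite has_count cy.
  by rewrite totf0 scaler0 oppr0.
have c1 : count fst x = 1%N by move: cx; rewrite leq_eqVlt ltnS leqn0 => /orP[/eqP|]//; rewrite -leqn0 leqNgt -has_count hx.
have hE y : (count fst y <= 1)%N -> h y = if has fst y then insert_unit f y else 0.
  move=> cy; rewrite /h totf_homotopy // has_count.
  by case: (count fst y) cy => [|[|]].
have gE y : has fst y = false -> g y = insert_unit f y.
  move=> hy; rewrite /g totf_extend detag_id // totf_kappa1 // hy ifT //.
  by rewrite leqNgt; move/negbT: hy; rewrite has_count; lia.
have fh := sign_homog_totf cS ce; have hh := sign_homog_totf hS he.
(* x has a single input of module type, on one side of each cut. *)
have sub l r : l ++ r = x -> has fst r = ~~ has fst l /\
    (count fst l <= 1)%N /\ (count fst r <= 1)%N.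
  by move=> lr; move: c1; rewrite -lr count_cat !has_count; lia.
have E1 : insert_unit (cupf e idf f) x = cupf (~~ e) idf h x.
  rewrite insert_unit_m2_left f0 ?has_detag // scaler0 addr0.
  apply: eq_cut2 => l y ly; have [hy [cl cy]] := sub _ _ ly.
  rewrite negbK hE // hy; case: (has fst l) => //=.
  by rewrite (linear_at0 (amul_linearr _)).
have E2 : insert_unit (cupf false f idf) x =
    - cupf false h idf x - cupf false g module_idf x.
  rewrite insert_unit_cup // expr1 scaleN1r -opprD.
  have aux (u v w : A) : u = 0 -> v = w -> u - v = - w by move=> -> ->; rewrite sub0r.
  apply: aux => [|].
    apply: cut2_0 => l y ly; have [hy _] := sub _ _ ly; case: (has fst l) hy => //= hy.
    rewrite insert_unit_idf; have -> : unitf y = 0 :> A by case: y hy {ly} => [|w y].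
    exact: (linear_at0 (amul_linearr _)).
  rewrite -cut2D; apply: eq_cut2 => l y ly.
  have [hy [cl cy]] := sub _ _ ly; have chl : (count fst (hat (~~ false) l) <= 1)%N by rewrite count_hat.
  rewrite hy andbN (hE _ chl) has_hat.
  have [sy|sy] := eqVneq (size y) 1%N; last first.
    rewrite idf_size ?size_detag // [idf y]idf_size // [module_idf y]module_idf_size //.
    by rewrite !(linear_at0 (tmul_linearr false _)) addr0 (linear_at0 (amul_linearr _)).
  case: y sy hy {ly cy} => [|[t u] [|? ?]] //= _; rewrite orbF => ->.
  case: ifP => hl /=; first by rewrite (linear_at0 (amul_linearr _)) addr0.
  by rewrite gE ?has_hat // (linear_at0 (amul_linearl _)) add0r.
have E3 : insert_unit (insert true m2f f) x = - insert true m2f h x - f x.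
  rewrite insert_unit_insert ?c1 // hx; congr (- _ - _); apply: eq_cut3 => l m r lmr.
  have ch : (count fst m <= 1)%N by move: c1; rewrite -lmr count_cat3; lia.
  rewrite hE ?has_out ?count_out_le1 //; rewrite ?has_cat ?has_hat ?count_cat ?count_hat -?has_cat -?count_cat lmr ?hx ?c1 //.
have df0 : insert_unit (df e f) x = 0.
  by rewrite -(totf_d cS ce) dc totf0 /insert_unit cut2_0 // => l r _; case: ifP.
move: df0; rewrite /df insert_m2f // insert_m2f //.
rewrite (linear_add _ _ (@insert_unit_linear k A)) (linear_opp _ (@insert_unit_linear k A)).
rewrite (linear_add _ _ (@insert_unit_linear k A)) !(linear_scale _ _ (@insert_unit_linear k A)) !fctE.
rewrite E1 E2 E3 => df0; apply/eqP; rewrite -subr_eq0; apply/eqP.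
have := congr1 ( *:%R ((-1) ^+ e)) df0; rewrite scaler0 => {}df0; rewrite -{}df0.
by case: e {ce hh fh he E1} => /=; linear_comb k A.
Qed.

End Homotopy.

(** * Multiplicativity of kappa *)

Section AlgebraCochains.
Variables (k : fieldType) (A : gradedAlgType k).
Implicit Types (q t n : int) (e : bool) (l m r x y : seq (input A)).

Let C : lmodType k := cochain A.
Implicit Types (a b c z : C).
Local Notation bim := (bim_cochains A).
Local Notation alg := (alg_cochains A).
Local Notation m2 := (bim_m2 A).
Local Notation am2 := (alg_m2 A).
Local Notation d := (@bim_d k A).
Local Notation da := (@alg_d k A).
Local Notation E := (@module_id k A).

#[local] Opaque bim_d alg_d bracket brace cup.

Lemma par_kappa0 e c : par e c -> par e (kappa0 c).
Proof. by move=> ce q x; rewrite /kappa0; case: ifP; rewrite ?eqxx // => _ /ce. Qed.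

(** The unit is inserted among the inputs of a or of b; the sign is the one
    of eps moving past b. *)
Lemma kappa1_cup e a b : a \in bim -> b \in bim -> par e b ->
  kappa1 (cup m2 a b) = cup am2 (kappa0 a) (kappa1 b) +
    (-1) ^+ (~~ e) *: cup am2 (kappa1 a) (kappa0 b) :> C.
Proof.
move=> aS bS be; have a0S := kappa0_alg aS; have b0S := kappa0_alg bS.
have a1S := kappa1_alg aS; have b1S := kappa1_alg bS.
have b0e := par_kappa0 be; have b1e := par_kappa1 be.
have abS := cup_bim aS bS.
have abS1 := cup_bim (alg_bim a0S) (alg_bim b1S); have abS2 := cup_bim (alg_bim a1S) (alg_bim b0S).
rewrite -{1}(kappa0_id a0S) -{1}(kappa0_id b1S) -{1}(kappa0_id a1S) -{1}(kappa0_id b0S).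
rewrite -!kappa0_cup addrC -kappa0_linear; apply: totf_inj.
- exact/alg_bim/kappa1_alg.
- apply/alg_bim/kappa0_alg; bim.
apply/funext => x; rewrite totf_kappa1 // totf_kappa0; case: ifP => // hx.
rewrite totfD ?totfZ; try bim.
rewrite (totf_cup aS bS be) (totf_cup (alg_bim a0S) (alg_bim b1S) b1e).
rewrite (totf_cup (alg_bim a1S) (alg_bim b0S) b0e) insert_unit_cup; last exact: multilinear_totf.
rewrite !fctE addrC; congr (_ + _ *: _); apply: eq_cut2 => l r lr;
  move: hx; rewrite -lr has_cat => /norP[/negPf hl /negPf hr];
  rewrite !(totf_kappa0, totf_kappa1) // !has_hat hl hr /= ?hl ?detag_id //.
by rewrite negbK.
Qed.

Lemma alg_ind (P : C -> Prop) :
  (forall a b, a \in alg -> b \in alg -> P a -> P b -> P (a + b)) ->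
  (forall e a, a \in alg -> par e a -> P a) -> forall a, a \in alg -> P a.
Proof.
move=> PD Pe a aS; have [b [c [bS cS be ce ac]]] := par_split true (alg_bim aS).
rewrite -(kappa0_id aS) ac kappa0D; have bS' := kappa0_alg bS; have cS' := kappa0_alg cS.
by apply: PD => //; [apply: (Pe true) | apply: (Pe false)] => //; apply: par_kappa0.
Qed.

Lemma sign_par e c : par e c -> sign_cochain c = (-1) ^+ (~~ e) *: c :> C.
Proof.
move=> ce; apply/funext => q; apply/funext => x; rewrite !fctE /sign_cochain.
have [->|/ce] := eqVneq (c q x) 0; first by rewrite !scaler0.
rewrite signz_parity => /orP[k2|/eqP <-] //.
by rewrite (oppr_pchar2 k2) !expr1n.
Qed.

Lemma sign_linear (u : k) a b : sign_cochain (u *: a + b) = u *: sign_cochain a + sign_cochain b :> C.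
Proof.
apply/funext => q; apply/funext => x; rewrite !fctE /sign_cochain !fctE.
by rewrite scalerDr !scalerA mulrC.
Qed.

Lemma signD a b : sign_cochain (a + b) = sign_cochain a + sign_cochain b :> C.
Proof. by have := sign_linear 1 a b; rewrite !scale1r. Qed.

Definition Za c : Prop := c \in alg /\ da c = 0.
Definition Ba c : Prop := exists2 b, b \in alg & c = da b.

Lemma Za_alg c : Za c -> c \in alg. Proof. by case. Qed.

Lemma Za_kappa0 z : Z z -> Za (kappa0 z).
Proof. by move=> [zS dz]; split; [exact: kappa0_alg | rewrite -kappa0_d dz kappa00]. Qed.

Lemma Za_kappa1 z : Z z -> Za (kappa1 z).
Proof. by move=> [zS dz]; split; [exact: kappa1_alg | rewrite -kappa1_d // dz kappa10]. Qed.

Lemma Z_extend c : Za c -> Z (extend c).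
Proof. by move=> [cS dc]; split; [exact: extend_bim | rewrite -extend_d // dc extend0]. Qed.

Lemma Ba_kappa0 z : B z -> Ba (kappa0 z).
Proof. by move=> [b bS ->]; exists (kappa0 b); [exact: kappa0_alg | rewrite kappa0_d]. Qed.

Lemma Ba_kappa1 z : B z -> Ba (kappa1 z).
Proof. by move=> [b bS ->]; exists (kappa1 b); [exact: kappa1_alg | rewrite kappa1_d]. Qed.

Lemma B_extend c : Ba c -> B (extend c).
Proof. by move=> [b bS ->]; exists (extend b); [exact: extend_bim | rewrite extend_d]. Qed.

Lemma ZaP z : (z \in is_cocycle (alg_cochains A) (@alg_d k A)) <-> Za z.
Proof. by rewrite inE; split=> [/andP[? /eqP]|[-> ->]] //; rewrite eqxx. Qed.

Lemma Za_lin (u : k) a b : Za a -> Za b -> Za (u *: a + b).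
Proof.
move=> [aS da0] [bS db0]; split; first by apply: rpredD => //; apply: rpredZ.
by rewrite (alg_d_linear u aS bS) da0 db0 scaler0 addr0.
Qed.

Lemma Za0 : Za 0.
Proof. by have := Za_kappa0 (BZc (B0 A)); rewrite kappa00. Qed.

Lemma ZaD a b : Za a -> Za b -> Za (a + b).
Proof. by move=> aZ bZ; have := Za_lin 1 aZ bZ; rewrite scale1r. Qed.

Lemma Za_cup a b : Za a -> Za b -> Za (cup am2 a b).
Proof.
move=> aZ bZ; rewrite -(kappa0_extend (Za_alg aZ)) -(kappa0_extend (Za_alg bZ)) -kappa0_cup.
by apply/Za_kappa0/cup_Z; apply: Z_extend.
Qed.

Lemma Za_bracket a b : Za a -> Za b -> Za (bracket a b).
Proof.
move=> aZ bZ; rewrite -(kappa0_extend (Za_alg aZ)) -(kappa0_extend (Za_alg bZ)) -kappa0_bracket.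
by apply/Za_kappa0/bracket_Z; apply: Z_extend.
Qed.

Lemma unit_Za : Za (unit_cochain A).
Proof. by rewrite -kappa0_unit; apply/Za_kappa0/unit_Z. Qed.

Lemma par_da e c : c \in alg -> par e c -> par (~~ e) (da c).
Proof.
move=> cS ce; have -> : da c = kappa0 (d c) :> C by rewrite kappa0_d (kappa0_id cS).
by apply/par_kappa0/par_d; first exact: alg_bim.
Qed.

Lemma da_sign c : c \in alg -> da (sign_cochain c) = - sign_cochain (da c) :> C.
Proof.
move: c; apply: alg_ind => [a b aS bS aE bE|e c cS ce].
  have sS c : c \in alg -> sign_cochain c \in alg.
    move: c; apply: alg_ind => [a' b' aS' bS' aE' bE'|e c cS ce]; first by rewrite signD rpredD.
    by rewrite (sign_par ce) rpredZ.
  by rewrite signD (daD (sS a aS) (sS b bS)) (daD aS bS) signD aE bE opprD.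
have := alg_d_linear ((-1) ^+ ~~ e) cS (rpred0 alg); rewrite addr0 (sign_par ce) => ->.
have -> : da 0 = 0 :> C by case: Za0.
rewrite addr0 (sign_par (par_da cS ce)) negbK -scaleNr; congr (_ *: _).
by case: e {ce}; rewrite /= ?expr0 ?expr1 ?opprK.
Qed.

Lemma sign_alg c : c \in alg -> sign_cochain c \in alg.
Proof.
move: c; apply: alg_ind => [a b aS bS aE bE|e c cS ce]; first by rewrite signD rpredD.
by rewrite (sign_par ce) rpredZ.
Qed.

Lemma Za_sign c : Za c -> Za (sign_cochain c).
Proof.
move=> [cS dc]; split; first exact: sign_alg.
rewrite da_sign // dc (sign_par (e := true)) ?scaler0 ?oppr0 //.
by move=> q x; rewrite eqxx.
Qed.

(** The product with eps is a homotopy inverse of kappa1 on the kernel of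
    kappa0; the correction by extend makes the condition on kappa0 void. *)
Lemma kappa_split z : Z z ->
  let z' := z - extend (kappa0 z) in
  B (z' - cup m2 (extend (kappa1 z')) E).
Proof.
move: z; apply: Z_ind => [a b aZ bZ|e z zZ ze] /=.
  set a' := a - _; set b' := b - _ => aB bB.
  have -> : a + b - extend (kappa0 (a + b)) = a' + b' :> C.
    by rewrite kappa0D extendD /a' /b'; linear_comb k C.
  have exS c : Z c -> extend (kappa1 (c - extend (kappa0 c))) \in bim.
    move=> cZ; apply/extend_bim/kappa1_alg; apply: bim_sub; first exact: Z_bim.
    by apply/extend_bim/kappa0_alg/Z_bim.
  rewrite kappa1D extendD (cupDl (exS a aZ) (exS b bZ) (module_id_bim A)).
  suff -> : a' + b' - (cup m2 (extend (kappa1 a')) E + cup m2 (extend (kappa1 b')) E) =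
    (a' - cup m2 (extend (kappa1 a')) E) + (b' - cup m2 (extend (kappa1 b')) E) :> C.
    exact: (BD aB bB).
  by linear_comb k C.
have sZ := Z_extend (Za_kappa0 zZ); have z'Z := ZB zZ sZ.
have z'e : par e (z - extend (kappa0 z)).
  by have := @par_lin k A e (-1) _ _ (par_extend (par_kappa0 ze)) ze; rewrite scaleN1r addrC.
have z0 : kappa0 (z - extend (kappa0 z)) = 0 :> C.
  by rewrite kappa0D kappa0N kappa0_extend ?subrr //; apply/kappa0_alg/Z_bim.
rewrite (homotopy_d z'Z z'e z0); eexists; last reflexivity.
by rewrite rpredN rpredZ //; apply/homotopy_bim/Z_bim.
Qed.

End AlgebraCochains.

Section GradedSpaces.
Variables (k : fieldType) (V : lmodType k) (deg : int -> V -> Prop).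

Lemma graded_space_ind (P : V -> Prop) : graded_space deg ->
  (forall x y, P x -> P y -> P (x + y)) -> (forall n x, deg n x -> P x) ->
  forall x, P x.
Proof.
move=> [deg0 dec _] PD Ph x; have [f [fd _ ->]] := dec x.
by apply: big_ind => // [|n _]; [apply: Ph (proj1 (deg0 0)) | apply: Ph (fd n)].
Qed.

End GradedSpaces.

(** * The isomorphism on cohomology *)

Section AlgebraCohomology.
Variables (k : fieldType) (A : gradedAlgType k).
Implicit Types (p q t n : int) (e : bool).

Let C : lmodType k := cochain A.
Implicit Types (a b c z : C).
Local Notation bim := (bim_cochains A).
Local Notation alg := (alg_cochains A).
Local Notation m2 := (bim_m2 A).
Local Notation am2 := (alg_m2 A).
Local Notation d := (@bim_d k A).
Local Notation da := (@alg_d k A).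
Local Notation E := (@module_id k A).
Local Notation H := (HHbim A).
Local Notation Ha := (HH A).
Local Notation cl := (cls (@bim_d_linear k A)).
Local Notation acl := (cls (@alg_d_linear k A)).
Local Notation mul := (@hhbim_mul k A).
Local Notation br := (@hhbim_bracket k A).
Local Notation sq := (@hhbim_sq k A).
Implicit Types x y : H.
Implicit Types u v w : Ha.

Lemma kappa0_brace a b : kappa0 (brace a b) = brace (kappa0 a) (kappa0 b) :> C.
Proof. exact: kappa0_wbrace. Qed.

#[local] Opaque bim_d alg_d bracket brace cup.

Lemma acl_rep_Z u : Za (rep u).
Proof. exact/ZaP/rep_cocycle. Qed.

Lemma acl_surj u : exists2 z, Za z & u = acl z.
Proof. by exists (rep u); [apply: acl_rep_Z | rewrite cls_rep]. Qed.

Lemma acl_lin (s : k) a b : Za a -> Za b -> acl (s *: a + b) = s *: acl a + acl b.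
Proof. by move=> /ZaP aZ /ZaP bZ; apply: cls_linear. Qed.

Lemma acl_eq a b : Za a -> Za b -> acl a = acl b <-> Ba (a - b).
Proof. by move=> /ZaP aZ /ZaP bZ; apply: cls_eq. Qed.

Lemma aclD a b : Za a -> Za b -> acl (a + b) = acl a + acl b.
Proof. by move=> aZ bZ; have := acl_lin 1 aZ bZ; rewrite !scale1r. Qed.

Lemma acl0 : acl 0 = 0.
Proof. by have := acl_lin (-1) (Za0 A) (Za0 A); rewrite !scaleN1r oppr0 addr0 addNr. Qed.

Lemma aclZ (s : k) a : Za a -> acl (s *: a) = s *: acl a.
Proof. by move=> aZ; have := acl_lin s aZ (Za0 A); rewrite acl0 !addr0. Qed.

Lemma acl_eq0 a : Za a -> acl a = 0 <-> Ba a.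
Proof. by move=> aZ; rewrite -acl0; have := acl_eq aZ (Za0 A); rewrite subr0. Qed.

Lemma acl_rep a : Za a -> exists2 b, b \in alg & rep (acl a) = a + da b.
Proof.
move=> aZ; have /(acl_eq (acl_rep_Z _) aZ)[b bS ab] : acl (rep (acl a)) = acl a by apply: cls_rep.
by exists b; rewrite // -ab addrC subrK.
Qed.

Lemma Hkappa_cl z : Z z -> Hkappa (cl z) = (acl (kappa0 z), acl (kappa1 z)).
Proof.
move=> zZ; have [b bS rE] := cl_rep zZ; have dB : B (d b) by exists b.
have rZ := cl_rep_Z (cl z).
congr pair; apply/acl_eq; try exact: Za_kappa0; try exact: Za_kappa1; rewrite rE.
- by rewrite kappa0D addrC addKr; apply: Ba_kappa0.
by rewrite kappa1D addrC addKr; apply: Ba_kappa1.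
Qed.

Lemma Hkappa_linear : linear (@Hkappa k A).
Proof.
move=> s x y; have [a aZ ->] := cl_surj x; have [b bZ ->] := cl_surj y.
rewrite -cl_lin // !Hkappa_cl //; last by apply: ZD => //; apply: ZZ.
rewrite kappa0_linear kappa1_linear.
by rewrite !acl_lin; try exact: Za_kappa0; try exact: Za_kappa1.
Qed.

(** The section of the first component of H(kappa) induced by extend. *)
Definition hh_incl u : H := cl (extend (rep u)).

Lemma hh_incl_cl c : Za c -> hh_incl (acl c) = cl (extend c).
Proof.
move=> cZ; have [b bS rE] := acl_rep cZ; apply/cl_eq; try exact: Z_extend.
  exact/Z_extend/acl_rep_Z.
by rewrite rE extendD addrC addKr; apply: B_extend; exists b.
Qed.

Lemma hh_incl_linear : linear hh_incl.
Proof.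
move=> s u v; have [a aZ ->] := acl_surj u; have [b bZ ->] := acl_surj v.
rewrite -acl_lin // !hh_incl_cl //; last exact: Za_lin.
by rewrite extend_linear cl_lin //; apply: Z_extend.
Qed.

Lemma hh_incl_mul u v : hh_incl (hh_mul u v) = mul (hh_incl u) (hh_incl v).
Proof.
have uZ := acl_rep_Z u; have vZ := acl_rep_Z v.
rewrite hh_incl_cl; last exact: Za_cup.
by rewrite mul_cl; try exact: Z_extend; rewrite extend_cup //; exact: Za_alg.
Qed.

Lemma hh_incl_bracket u v : hh_incl (hh_bracket u v) = br (hh_incl u) (hh_incl v).
Proof.
have uZ := acl_rep_Z u; have vZ := acl_rep_Z v.
rewrite hh_incl_cl; last exact: Za_bracket.
by rewrite br_cl; try exact: Z_extend; rewrite extend_bracket //; exact: Za_alg.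
Qed.

Lemma hh_incl_sq u : (2 \in [pchar k])%N -> hh_incl (hh_sq u) = sq (hh_incl u).
Proof.
move=> k2; have uZ := acl_rep_Z u; have eZ := Z_extend uZ.
have par2 c : par true c by apply: par_char2.
rewrite [hh_sq u]/(acl (sq_cochain (rep u))) hh_incl_cl.
  by rewrite sq_cl // extend_sq ?(Za_alg uZ) // /sq_cochain k2.
rewrite /sq_cochain k2 -(kappa0_extend (Za_alg uZ)) -kappa0_brace.
exact/Za_kappa0/sq_Z.
Qed.

Lemma hh_incl_one : hh_incl (hh_one A) = hhbim_one A.
Proof.
rewrite hh_incl_cl; last exact: unit_Za.
congr (cl _); apply/funext => q; apply/funext => -[|u x] //.
by rewrite /extend; case: ifP.
Qed.

(** By the Leibniz rule for the bracket with 1 = 1 . 1. *)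
Lemma bracket_one x : br x (hhbim_one A) = 0.
Proof.
have [[gr _ _ [d1 m1 m1r] _] [lie leib] _] := hhbim_gerstenhaber A.
move: x; apply: (graded_space_ind gr) => [x y x0 y0|n x xn].
  by rewrite (linear_add _ _ (proj1 (br_bilinear A) _)) x0 y0 addr0.
have := leib _ _ _ _ _ _ xn d1 d1.
rewrite mulr0 expr0z scale1r m1 m1r m1 => /eqP.
by rewrite -subr_eq0 opprD addNKr oppr_eq0 => /eqP.
Qed.

Lemma Ba_bracket_unit c : Za c -> Ba (bracket c (unit_cochain A)).
Proof.
move=> cZ; have eZ := Z_extend cZ; have uZ := unit_Z A.
have := bracket_one (cl (extend c)); rewrite br_cl // -cl0.
case/(cl_eq (bracket_Z eZ uZ) (Z0 A)) => b bS; rewrite subr0 => bE.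
rewrite -(kappa0_extend (Za_alg cZ)) -[X in bracket _ X]kappa0_unit -kappa0_bracket.
by apply: Ba_kappa0; exists b.
Qed.

Lemma Hkappa_incl u : Hkappa (hh_incl u) = (u, 0).
Proof.
have [c cZ ->] := acl_surj u; have eZ := Z_extend cZ; rewrite hh_incl_cl // Hkappa_cl //.
rewrite kappa0_extend ?(Za_alg cZ) //; congr (_, _); apply/(acl_eq0 (Za_kappa1 eZ)).
by rewrite kappa1_extend ?(Za_alg cZ) //; apply: Ba_bracket_unit.
Qed.

Definition bim_eps : H := cl E.

Lemma Hkappa_incl_eps u : Hkappa (mul (hh_incl u) bim_eps) = (0, u).
Proof.
have [c cZ ->] := acl_surj u; have eZ := Z_extend cZ; have EZ := module_id_Z A.
rewrite hh_incl_cl // mul_cl // Hkappa_cl; last exact: cup_Z.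
by rewrite kappa0_cup_module_id kappa1_cup_module_id ?(Za_alg cZ) // acl0.
Qed.

Lemma Hkappa_eps : Hkappa bim_eps = eps A.
Proof.
rewrite /eps -Hkappa_incl_eps hh_incl_one.
by have [[_ _ _ [_ -> _] _] _ _] := hhbim_gerstenhaber A.
Qed.

Lemma HkappaD x y : Hkappa (x + y) = Hkappa x + Hkappa y.
Proof. exact: (linear_add _ _ Hkappa_linear). Qed.

(** If both components of a class vanish, then kappa_split writes a
    representative as a sum of three coboundaries. *)
Lemma Hkappa_inj : injective (@Hkappa k A).
Proof.
move=> x y xy; apply/eqP; rewrite -subr_eq0; apply/eqP.
have : Hkappa (x - y) = 0.
  by rewrite addrC -scaleN1r Hkappa_linear xy scaleN1r addNr.
move: (x - y) => {xy}x {y}; have [z zZ ->] := cl_surj x; rewrite Hkappa_cl //.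
case=> /(acl_eq0 (Za_kappa0 zZ)) k0B /(acl_eq0 (Za_kappa1 zZ))[b bS bE].
apply: cl_B; have := kappa_split zZ; rewrite /=.
have beB := B_extend k0B.
set z' := z - _ => zB; have z'Z : Z z' by apply: ZB => //; apply: BZc.
have k1B : Ba (kappa1 z').
  rewrite /z' kappa1D kappa1N bE; have [b2 bS2 ->] := Ba_kappa1 beB.
  exists (b - b2); first exact: rpredB.
  have := alg_d_linear (-1) bS2 bS; rewrite !scaleN1r addrC => ->.
  by rewrite addrC.
have cB : B (cup m2 (extend (kappa1 z')) E).
  by apply: cup_Bl; [exact: B_extend | exact: module_id_Z].
by have := BD (BD zB cB) beB; rewrite subrK /z' subrK.
Qed.

Definition Hkappa_section (w : HHeps A) : H := hh_incl w.1 + mul (hh_incl w.2) bim_eps.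

Lemma Hkappa_sectionK : cancel Hkappa_section (@Hkappa k A).
Proof.
move=> [u v]; rewrite HkappaD Hkappa_incl Hkappa_incl_eps.
by congr (_, _); rewrite ?addr0 ?add0r.
Qed.

Lemma HkappaK : cancel (@Hkappa k A) Hkappa_section.
Proof. by move=> x; apply: Hkappa_inj; rewrite Hkappa_sectionK. Qed.

Lemma Hkappa_bij : bijective (@Hkappa k A).
Proof. exact: Bijective HkappaK Hkappa_sectionK. Qed.

Lemma hh_incl_inj : injective hh_incl.
Proof. by move=> u v /(congr1 (@Hkappa k A)); rewrite !Hkappa_incl => -[]. Qed.

Lemma hh_mul_bilinear : bilinear_op (@hh_mul k A).
Proof.
have [ml mr] := mul_bilinear A.
split=> [v s u u'|u s v v']; apply: hh_incl_inj; rewrite !(hh_incl_linear, hh_incl_mul);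
  [exact: ml | exact: mr].
Qed.

Lemma hh_sign_cl c : Za c -> hh_sign (acl c) = acl (sign_cochain c).
Proof.
move=> cZ; rewrite [LHS]/(acl (sign_cochain (rep (acl c)))); have rZ := acl_rep_Z (acl c).
apply/acl_eq; try exact: Za_sign.
have [b bS ->] := acl_rep cZ; rewrite signD addrC addKr.
exists (- sign_cochain b); first by rewrite rpredN sign_alg.
have := alg_d_linear (-1) (sign_alg bS) (rpred0 alg).
have -> : da 0 = 0 :> C by case: (Za0 A).
by rewrite !scaleN1r !addr0 => ->; rewrite da_sign // opprK.
Qed.

Lemma hh_signD u v : hh_sign (u + v) = hh_sign u + hh_sign v.
Proof.
have [a aZ ->] := acl_surj u; have [b bZ ->] := acl_surj v.
rewrite -aclD // !hh_sign_cl //; last exact: ZaD.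
by rewrite signD aclD //; apply: Za_sign.
Qed.

Lemma hh_mul_cl a b : Za a -> Za b -> hh_mul (acl a) (acl b) = acl (cup am2 a b).
Proof.
move=> aZ bZ; apply: hh_incl_inj; rewrite hh_incl_mul !hh_incl_cl //; last exact: Za_cup.
by rewrite mul_cl; try exact: Z_extend; rewrite extend_cup //; exact: Za_alg.
Qed.

Lemma mulDr x y y' : mul x (y + y') = mul x y + mul x y'.
Proof. by have := proj2 (mul_bilinear A) x 1 y y'; rewrite !scale1r. Qed.

Lemma hh_mulDr u v w : hh_mul u (v + w) = hh_mul u v + hh_mul u w.
Proof. by have := proj2 hh_mul_bilinear u 1 v w; rewrite !scale1r. Qed.

Lemma hh_mulZr (s : k) u v : hh_mul u (s *: v) = s *: hh_mul u v.
Proof. exact: (linear_scale _ _ (proj2 hh_mul_bilinear u)). Qed.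

Lemma heps_mulDr (w1 w2 w3 : HHeps A) :
  heps_mul w1 (w2 + w3) = heps_mul w1 w2 + heps_mul w1 w3.
Proof.
case: w1 w2 w3 => [u1 v1] [u2 v2] [u3 v3]; rewrite /heps_mul.
rewrite -[(u2, v2) + (u3, v3)]/(u2 + u3, v2 + v3) [LHS]/= hh_signD !hh_mulDr addrACA.
by [].
Qed.

Lemma Hkappa_mul x y : Hkappa (mul x y) = heps_mul (Hkappa x) (Hkappa y).
Proof.
have [a aZ ->] := cl_surj x; have [b bZ ->] := cl_surj y.
move: b bZ; apply: Z_ind => [b c bZ cZ|e b bZ be].
  rewrite (clD bZ cZ) mulDr !HkappaD => -> ->.
  by rewrite heps_mulDr.
have a0Z := Za_kappa0 aZ; have b0Z := Za_kappa0 bZ.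
have a1Z := Za_kappa1 aZ; have b1Z := Za_kappa1 bZ.
have Z1 := Za_cup a0Z b1Z; have Z2 := Za_cup a1Z b0Z.
rewrite mul_cl // !Hkappa_cl //; last exact: cup_Z.
rewrite /heps_mul /= hh_sign_cl // (sign_par (par_kappa0 be)) aclZ //.
rewrite kappa0_cup (kappa1_cup (Z_bim aZ) (Z_bim bZ) be).
rewrite (addrC (cup am2 (kappa0 a) (kappa1 b) : C)).
rewrite acl_lin // hh_mulZr !hh_mul_cl //.
by congr (_, _); apply: addrC.
Qed.

End AlgebraCohomology.

Section Degrees.
Variables (k : fieldType) (A : gradedAlgType k).
Implicit Types (p q t n : int) (e : bool).

Let C : lmodType k := cochain A.
Implicit Types (a b c z : C).
Local Notation bim := (bim_cochains A).
Local Notation alg := (alg_cochains A).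
Local Notation m2 := (bim_m2 A).
Local Notation E := (@module_id k A).
Local Notation H := (HHbim A).
Local Notation cl := (cls (@bim_d_linear k A)).
Local Notation acl := (cls (@alg_d_linear k A)).
Implicit Types x y : H.
Implicit Types u v w : HH A.

#[local] Opaque bim_d alg_d bracket brace cup.

Lemma extend_neq0 c q l : extend c q l != 0 -> exists2 r, c q r != 0 & size r = size l.
Proof.
rewrite /extend; case: ifP => _ nz; last by rewrite eqxx in nz.
by exists (detag l); rewrite ?size_detag.
Qed.

Lemma kappa0_neq0 c q l : kappa0 c q l != 0 -> c q l != 0.
Proof. by rewrite /kappa0; case: ifP; rewrite ?eqxx. Qed.

Lemma bideg_cl p q x : hhbim_bidegree p q x <-> exists z, [/\ Z z, of_bidegree p q z & x = cl z].
Proof. by split=> -[z [zZ zn ->]]; exists z; split=> //; apply/cocycleP. Qed.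

Lemma abideg_cl p q u : hh_bidegree p q u <-> exists c, [/\ Za c, of_bidegree p q c & u = acl c].
Proof. by split=> -[z [zZ zn ->]]; exists z; split=> //; apply/ZaP. Qed.

Lemma adeg_cl n u : hh_degree A n u <-> exists c, [/\ Za c, of_degree n c & u = acl c].
Proof. by split=> -[z [zZ zn ->]]; exists z; split=> //; apply/ZaP. Qed.

Lemma Hkappa_eq_section x u v : Hkappa x = (u, v) -> x = hh_incl u + hhbim_mul (hh_incl v) (bim_eps A).
Proof. by move=> xE; rewrite -(HkappaK x) xE. Qed.

Lemma section_cl a b : Za a -> Za b ->
  let z := extend a + cup m2 (extend b) E in
  Z z /\ hh_incl (acl a) + hhbim_mul (hh_incl (acl b)) (bim_eps A) = cl z.
Proof.
move=> aZ bZ /=; have eaZ := Z_extend aZ; have ebZ := Z_extend bZ.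
have EZ := module_id_Z A; have cZ := cup_Z ebZ EZ.
by split; [exact: ZD | rewrite !hh_incl_cl // mul_cl // -clD].
Qed.

Lemma Hkappa_bidegree p q x : hhbim_bidegree p q x <-> heps_bidegree p q (Hkappa x).
Proof.
split=> [/bideg_cl[z [zZ zpq ->]]|]; rewrite ?Hkappa_cl //.
  split; apply/abideg_cl; [exists (kappa0 z) | exists (kappa1 z)]; split=> //.
  - exact: Za_kappa0.
  - by move=> r l /kappa0_neq0/zpq.
  - exact: Za_kappa1.
  by move=> r l /kappa1_neq0[y [/zpq[<- <-] ->]]; split; lia.
case xE: (Hkappa x) => [u v] [/abideg_cl[a [aZ an uE]] /abideg_cl[b [bZ bn vE]]].
rewrite (Hkappa_eq_section xE); rewrite /= in uE vE; rewrite uE vE.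
have [zZ ->] := section_cl aZ bZ; apply/bideg_cl; eexists; split; [exact: zZ | | by []].
move=> r l /(@add_neq0 _ _ (extend a) (cup m2 (extend b) E)) [/extend_neq0[y /an[<- <-] ->] //|].
have ebn : of_bidegree (p - 1) q (extend b) by move=> r' l' /extend_neq0[y /bn[<- <-] ->].
by move=> /(of_bidegree_cup ebn (@module_id_bidegree k A))[-> ->]; split; lia.
Qed.

Lemma Hkappa_degree n x : hhbim_degree n x <-> heps_degree A n (Hkappa x).
Proof.
split=> [/deg_cl[z [zZ zn ->]]|]; rewrite ?Hkappa_cl //.
  split; apply/adeg_cl; [exists (kappa0 z) | exists (kappa1 z)]; split=> //.
  - exact: Za_kappa0.
  - by move=> r l /kappa0_neq0/zn.
  - exact: Za_kappa1.
  by move=> r l /kappa1_neq0[y [/zn <- ->]]; lia.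
case xE: (Hkappa x) => [u v] [/adeg_cl[a [aZ an uE]] /adeg_cl[b [bZ bn vE]]].
rewrite (Hkappa_eq_section xE); rewrite /= in uE vE; rewrite uE vE.
have [zZ ->] := section_cl aZ bZ; apply/deg_cl; eexists; split; [exact: zZ | | by []].
move=> r l /(@add_neq0 _ _ (extend a) (cup m2 (extend b) E)) [/extend_neq0[y /an <- ->] //|].
have ebn : of_degree (n - 1) (extend b) by move=> r' l' /extend_neq0[y /bn <- ->].
have En : of_degree 1 E by move=> r' l' /module_id_bidegree[-> ->].
by move=> /(of_degree_cup ebn En) ->; lia.
Qed.

Lemma Hkappa_invK x : Hkappa_inv (Hkappa x) = x.
Proof.
apply: (@Hkappa_inj k A); rewrite /Hkappa_inv.
by case: xgetP => [y _ //|/(_ x)]; case.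
Qed.

End Degrees.

(** * Transport of structure *)

Section Transport.
Variables (k : fieldType) (E F : lmodType k) (f : E -> F) (g : F -> E).
Variables (degE : int -> E -> Prop) (oneE : E) (mulE brE : E -> E -> E) (sqE : E -> E).
Variables (degF : int -> F -> Prop) (oneF : F) (mulF brF : F -> F -> F) (sqF : F -> F).
Hypotheses (f_linear : linear f) (fK : cancel f g) (gK : cancel g f).
Hypothesis f_deg : forall n x, degE n x <-> degF n (f x).
Hypothesis f_one : f oneE = oneF.
Hypothesis f_mul : forall x y, f (mulE x y) = mulF (f x) (f y).
Hypothesis f_br : forall x y, f (brE x y) = brF (f x) (f y).
Hypothesis f_sq : forall x, f (sqE x) = sqF (f x).

Let f_surj y : exists x, y = f x.
Proof. by exists (g y). Qed.

Let fD x y : f (x + y) = f x + f y.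
Proof. by have := f_linear 1 x y; rewrite !scale1r. Qed.

Let f0 : f 0 = 0.
Proof. by apply: (addrI (f 0)); rewrite -fD !addr0. Qed.

Let fZ a x : f (a *: x) = a *: f x.
Proof. by have := f_linear a x 0; rewrite !addr0 f0 addr0. Qed.

Let fN x : f (- x) = - f x.
Proof. by rewrite -!scaleN1r fZ. Qed.

Let f_inj : injective f. Proof. exact: can_inj fK. Qed.

Let f_neq0 x : (f x != 0) = (x != 0).
Proof. by rewrite -(inj_eq f_inj) f0. Qed.

Lemma bilinear_op_transfer (opE : E -> E -> E) (opF : F -> F -> F) :
  (forall x y, f (opE x y) = opF (f x) (f y)) -> bilinear_op opE -> bilinear_op opF.
Proof.
move=> f_op [opl opr]; split=> [y a x x'|x a y y'].
  have [{}y ->] := f_surj y; have [{}x ->] := f_surj x; have [{}x' ->] := f_surj x'.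
  by rewrite -fZ -fD -!f_op opl fD fZ.
have [{}y ->] := f_surj y; have [{}x ->] := f_surj x; have [{}y' ->] := f_surj y'.
by rewrite -fZ -fD -!f_op opr fD fZ.
Qed.

Lemma graded_space_transfer : graded_space degE -> graded_space degF.
Proof.
move=> [deg0 dec uniq]; split=> [n|y|h hd hfin hs n].
- split; first by rewrite -f0; apply/f_deg; apply: (proj1 (deg0 n)).
  move=> a x y; have [{}y ->] := f_surj y; have [{}x ->] := f_surj x.
  by move=> /f_deg xn /f_deg yn; rewrite -f_linear; apply/f_deg/(proj2 (deg0 n)).
- have [{}y ->] := f_surj y; have [h [hd hfin ->]] := dec y; exists (f \o h); split.
  + by move=> n; apply/f_deg/hd.
  + by apply: sub_finite_set hfin => m /=; rewrite f_neq0.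
  exact: fsum_linear.
have hfin' : finite_set [set m | g (h m) != 0]%classic.
  by apply: sub_finite_set hfin => m /=; rewrite -f_neq0 gK.
rewrite -[h n]gK (_ : g (h n) = 0) //; apply: (uniq (g \o h)) => // [m|].
  by apply/f_deg; rewrite /= gK.
apply: f_inj; rewrite fsum_linear // f0 -[RHS]hs; apply: eq_fsum => m; exact: gK.
Qed.

Lemma gerstenhaber_transfer : gerstenhaber_algebra degE oneE mulE brE sqE ->
  gerstenhaber_algebra degF oneF mulF brF sqF.
Proof.
move=> [[gr [mul2 muld] mulA [one_d mul1 mulr1] mulC] [[[br2 brd] brC jac odd even] leib] sq].
split; [split | split; [split|] | move=> k2; have [sqd sqD sqM sqbr] := sq k2; split].
- exact: graded_space_transfer.
- split; first exact: bilinear_op_transfer mul2.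
  move=> m n x y; have [{}y ->] := f_surj y; have [{}x ->] := f_surj x.
  by move=> /f_deg xm /f_deg yn; rewrite -f_mul; apply/f_deg/muld.
- move=> x y z.
  have [{}y ->] := f_surj y; have [{}x ->] := f_surj x; have [{}z ->] := f_surj z.
  by rewrite -!f_mul mulA.
- split; first by rewrite -f_one; apply/f_deg.
    by move=> x; have [{}x ->] := f_surj x; rewrite -f_one -f_mul mul1.
  by move=> x; have [{}x ->] := f_surj x; rewrite -f_one -f_mul mulr1.
- move=> m n x y; have [{}y ->] := f_surj y; have [{}x ->] := f_surj x.
  by move=> /f_deg xm /f_deg yn; rewrite -!f_mul -fZ (mulC _ _ _ _ xm yn).
- split; first exact: bilinear_op_transfer br2.
  move=> m n x y; have [{}y ->] := f_surj y; have [{}x ->] := f_surj x.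
  by move=> /f_deg xm /f_deg yn; rewrite -f_br; apply/f_deg/brd.
- move=> m n x y; have [{}y ->] := f_surj y; have [{}x ->] := f_surj x.
  by move=> /f_deg xm /f_deg yn; rewrite -!f_br -fZ -fN (brC _ _ _ _ xm yn).
- move=> l m n x y z.
  have [{}y ->] := f_surj y; have [{}x ->] := f_surj x; have [{}z ->] := f_surj z.
  move=> /f_deg xl /f_deg ym /f_deg zn.
  by rewrite -!f_br -fZ -fD (jac _ _ _ _ _ _ xl ym zn).
- move=> n x; have [{}x ->] := f_surj x => /f_deg xn od.
  by rewrite -f_br (odd _ _ xn od) f0.
- move=> n x; have [{}x ->] := f_surj x => /f_deg xn ev.
  by rewrite -!f_br (even _ _ xn ev) f0.
- move=> l m n x y z.
  have [{}y ->] := f_surj y; have [{}x ->] := f_surj x; have [{}z ->] := f_surj z.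
  move=> /f_deg xl /f_deg ym /f_deg zn.
  by rewrite -f_mul -!f_br -!f_mul -fZ -fD (leib _ _ _ _ _ _ xl ym zn).
- move=> n x; have [{}x ->] := f_surj x => /f_deg xn.
  by rewrite -f_sq; apply/f_deg/sqd.
- move=> n x y; have [{}y ->] := f_surj y; have [{}x ->] := f_surj x.
  by move=> /f_deg xm /f_deg yn; rewrite -fD -!f_sq -f_br -!fD (sqD _ _ _ xm yn).
- move=> m n x y; have [{}y ->] := f_surj y; have [{}x ->] := f_surj x.
  move=> /f_deg xm /f_deg yn; rewrite -f_br -!f_sq -!f_mul -!fD -f_sq.
  by rewrite (sqM _ _ _ _ xm yn).
move=> m n x y; have [{}y ->] := f_surj y; have [{}x ->] := f_surj x.
by move=> /f_deg xm /f_deg yn; rewrite -f_sq -!f_br (sqbr _ _ _ _ xm yn).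
Qed.

End Transport.

(** * The induced bracket and square *)

Section Uniqueness.
Variables (k : fieldType) (A : gradedAlgType k).
Implicit Types (m n : int) (u v w : HH A).

Local Notation mul := (@heps_mul k A).
Local Notation deg := (heps_degree A).
Local Notation ebr := (@heps_bracket k A).

Lemma heps_bracketE (x y : HHbim A) :
  heps_bracket (Hkappa x) (Hkappa y) = Hkappa (hhbim_bracket x y).
Proof. by rewrite /heps_bracket !Hkappa_invK. Qed.

Lemma heps_sqE (x : HHbim A) : heps_sq (Hkappa x) = Hkappa (hhbim_sq x).
Proof. by rewrite /heps_sq Hkappa_invK. Qed.

Lemma Hkappa_one : Hkappa (hhbim_one A) = heps_one A.
Proof. by rewrite -hh_incl_one Hkappa_incl. Qed.

Lemma heps_gerstenhaber :
  gerstenhaber_algebra deg (heps_one A) mul ebr (@heps_sq k A).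
Proof.
apply: (gerstenhaber_transfer (@Hkappa_linear k A) (@HkappaK k A) (@Hkappa_sectionK k A)).
- exact: Hkappa_degree.
- exact: Hkappa_one.
- exact: Hkappa_mul.
- by move=> x y; rewrite heps_bracketE.
- by move=> x; rewrite heps_sqE.
exact: hhbim_gerstenhaber.
Qed.

Lemma hh_bracket_bilinear : bilinear_op (@hh_bracket k A).
Proof.
have [bl br] := br_bilinear A.
split=> [v s u u'|u s v v']; apply: hh_incl_inj.
  rewrite hh_incl_bracket (hh_incl_linear s u u') (bl (hh_incl v) s (hh_incl u) (hh_incl u')).
  by rewrite (hh_incl_linear s (hh_bracket u v)) !hh_incl_bracket.
rewrite hh_incl_bracket (hh_incl_linear s v v') (br (hh_incl u) s (hh_incl v) (hh_incl v')).
by rewrite (hh_incl_linear s (hh_bracket u v)) !hh_incl_bracket.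
Qed.

Lemma hh_ind (P : HH A -> Prop) : (forall u v, P u -> P v -> P (u + v)) ->
  (forall n u, hh_degree A n u -> P u) -> forall u, P u.
Proof.
move=> PD Ph u; have [[gr _ _ _ _] _ _] := hhbim_gerstenhaber A.
suff Pk : forall x : HHbim A, P (Hkappa x).1 by have := Pk (hh_incl u); rewrite Hkappa_incl.
apply: (graded_space_ind gr) => [x y Px Py|n x /Hkappa_degree[xn _]]; last exact: Ph xn.
by rewrite HkappaD; apply: PD.
Qed.

Lemma hh_degree0 n : hh_degree A n 0.
Proof.
apply/adeg_cl; exists 0; split; rewrite ?acl0 //; first exact: Za0.
by move=> q x; rewrite eqxx.
Qed.

Lemma deg_inl n u : hh_degree A n u -> deg n (u, 0).
Proof. by move=> un; split=> //; apply: hh_degree0. Qed.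

Lemma deg_inr n u : hh_degree A n u -> deg (n + 1) (0, u).
Proof. by move=> un; split; rewrite /= ?addrK //; apply: hh_degree0. Qed.

Lemma deg_eps : deg 1 (eps A).
Proof.
have [[_ _ _ [one_d _ _] _] _ _] := heps_gerstenhaber.
by have := deg_inr (proj1 one_d); rewrite add0r.
Qed.

Lemma mul_inl_eps u : mul (u, 0) (eps A) = (0, u).
Proof. by rewrite -Hkappa_incl -Hkappa_eps -Hkappa_mul Hkappa_incl_eps. Qed.

Lemma mul_eps_eps : mul (eps A) (eps A) = 0.
Proof.
rewrite -Hkappa_eps -Hkappa_mul mul_cl; try exact: module_id_Z.
by rewrite cup_module_id_self cl0; exact: (linear_at0 (@Hkappa_linear k A)).
Qed.

Lemma mul_inr_eps u : mul (0, u) (eps A) = 0.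
Proof.
have [[_ [[_ mr] _] mulA _ _] _ _] := heps_gerstenhaber.
by rewrite -mul_inl_eps -mulA mul_eps_eps (linear_at0 (mr _)).
Qed.

Section Bracket.
Variable br : HHeps A -> HHeps A -> HHeps A.
Hypothesis br_gerst : gerstenhaber_bracket deg mul br.
Hypothesis br_inl : forall u v, br (u, 0) (v, 0) = (hh_bracket u v, 0).
Hypothesis br_eps_eps : br (eps A) (eps A) = 0.
Hypothesis br_inl_eps : forall u, br (u, 0) (eps A) = 0.

Let mul0l x : mul 0 x = 0.
Proof.
have [[_ [[ml _] _] _ _ _] _ _] := heps_gerstenhaber.
exact: (linear_at0 (ml x)).
Qed.

Let mul0r x : mul x 0 = 0.
Proof.
have [[_ [[_ mr] _] _ _ _] _ _] := heps_gerstenhaber.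
exact: (linear_at0 (mr x)).
Qed.

Lemma brDl x y z : br (x + y) z = br x z + br y z.
Proof.
have [[[[bl _] _] _ _ _ _] _] := br_gerst.
by have := bl z 1 x y; rewrite !scale1r.
Qed.

Lemma brDr x y z : br x (y + z) = br x y + br x z.
Proof.
have [[[[_ blr] _] _ _ _ _] _] := br_gerst.
by have := blr x 1 y z; rewrite !scale1r.
Qed.

Lemma inlD u v : (u + v, 0) = (u, 0) + (v, 0) :> HHeps A.
Proof. by rewrite -[RHS]/(u + v, 0 + 0) addr0. Qed.

Lemma inrD u v : (0, u + v) = (0, u) + (0, v) :> HHeps A.
Proof. by rewrite -[RHS]/(0 + 0, u + v) addr0. Qed.

Lemma pairE u v : (u, v) = (u, 0) + (0, v) :> HHeps A.
Proof. by rewrite -[RHS]/(u + 0, 0 + v) addr0 add0r. Qed.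

(** By the Leibniz rule for the bracket of u with v . eps. *)
Lemma br_inl_inr_deg m n u v : hh_degree A m u -> hh_degree A n v ->
  br (u, 0) (0, v) = (0, hh_bracket u v).
Proof.
have [_ leib] := br_gerst => um vn.
rewrite -[in LHS]mul_inl_eps (leib _ _ _ _ _ _ (deg_inl um) (deg_inl vn) deg_eps).
by rewrite br_inl br_inl_eps mul0r scaler0 addr0 mul_inl_eps.
Qed.

Lemma br_inl_inr u v : br (u, 0) (0, v) = (0, hh_bracket u v).
Proof.
have [hl hr] := hh_bracket_bilinear.
move: u v; apply: hh_ind => [u u' ih ih' v|m u um].
  have -> : hh_bracket (u + u') v = hh_bracket u v + hh_bracket u' v.
    by have := hl v 1 u u'; rewrite !scale1r.
  by rewrite inlD brDl ih ih' inrD.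
apply: hh_ind => [v v' ih ih'|n v vn]; last exact: br_inl_inr_deg um vn.
have -> : hh_bracket u (v + v') = hh_bracket u v + hh_bracket u v'.
  by have := hr u 1 v v'; rewrite !scale1r.
by rewrite [in LHS]inrD brDr ih ih' inrD.
Qed.

Lemma br_eps_inl m u : hh_degree A m u -> br (eps A) (u, 0) = 0.
Proof.
have [[_ anti _ _ _] _] := br_gerst => um.
by rewrite (anti _ _ _ _ deg_eps (deg_inl um)) br_inl_eps scaler0 oppr0.
Qed.

(** By antisymmetry and the Leibniz rule for the bracket of eps with u . eps. *)
Lemma br_inr_eps m u : hh_degree A m u -> br (0, u) (eps A) = 0.
Proof.
have [[_ anti _ _ _] leib] := br_gerst => um.
rewrite (anti _ _ _ _ (deg_inr um) deg_eps) -mul_inl_eps.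
rewrite (leib _ _ _ _ _ _ deg_eps (deg_inl um) deg_eps) (br_eps_inl um) br_eps_eps.
by rewrite mul0l mul0r !scaler0 addr0 scaler0 oppr0.
Qed.

Lemma br_inr_inl m n u v : hh_degree A m u -> hh_degree A n v ->
  br (0, u) (v, 0) = - ((-1) ^ ((m + 1 - 1) * (n - 1)) *: (0, hh_bracket v u)).
Proof.
have [[_ anti _ _ _] _] := br_gerst => um vn.
by rewrite (anti _ _ _ _ (deg_inr um) (deg_inl vn)) br_inl_inr.
Qed.

(** The Leibniz rule for the bracket with v . eps leaves a multiple of eps
    times eps. *)
Lemma br_inr u v : br (0, u) (0, v) = 0.
Proof.
have [[_ _ _ _ _] leib] := br_gerst.
have [[_ [[ml _] _] _ _ _] _ _] := heps_gerstenhaber.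
move: u v; apply: hh_ind => [u u' ih ih' v|m u um].
  by rewrite inrD brDl ih ih' addr0.
apply: hh_ind => [v v' ih ih'|n v vn]; first by rewrite inrD brDr ih ih' addr0.
rewrite -[(0, v)]mul_inl_eps (leib _ _ _ _ _ _ (deg_inr um) (deg_inl vn) deg_eps).
rewrite (br_inr_eps um) mul0r scaler0 addr0 (br_inr_inl um vn) -scaleNr.
by rewrite (linear_scale _ _ (ml _)) mul_inr_eps scaler0.
Qed.

End Bracket.

(** The brackets of all products with eps have been computed from the
    hypotheses alone. *)
Lemma br_unique br br' :
  gerstenhaber_bracket deg mul br -> gerstenhaber_bracket deg mul br' ->
  (forall u v, br (u, 0) (v, 0) = (hh_bracket u v, 0)) ->
  (forall u v, br' (u, 0) (v, 0) = (hh_bracket u v, 0)) ->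
  br (eps A) (eps A) = 0 -> br' (eps A) (eps A) = 0 ->
  (forall u, br (u, 0) (eps A) = 0) -> (forall u, br' (u, 0) (eps A) = 0) ->
  forall x y, br x y = br' x y.
Proof.
move=> g g' l l' ee ee' e e' [u1 u2] [v1 v2]; rewrite (pairE u1) (pairE v1).
have rl : forall u v, br (0, u) (v, 0) = br' (0, u) (v, 0).
  apply: hh_ind => [u u' ih ih' v|m u um].
    by rewrite inrD (brDl g) (brDl g') ih ih'.
  apply: hh_ind => [v v' ih ih'|n v vn].
    by rewrite inlD (brDr g) (brDr g') ih ih'.
  by rewrite (br_inr_inl g l e um vn) (br_inr_inl g' l' e' um vn).
rewrite !(brDl g) !(brDl g') !(brDr g) !(brDr g') l l' rl.
rewrite (br_inl_inr g l e) (br_inl_inr g' l' e').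
by rewrite (br_inr g l ee e) (br_inr g' l' ee' e').
Qed.

Lemma heps_bracket_inl u v : ebr (u, 0) (v, 0) = (hh_bracket u v, 0).
Proof. by rewrite -!Hkappa_incl heps_bracketE -hh_incl_bracket Hkappa_incl. Qed.

Lemma bracket_bim_eps (x : HHbim A) : hhbim_bracket x (bim_eps A) = 0.
Proof.
have [a aZ ->] := cl_surj x; rewrite br_cl //; last exact: module_id_Z.
by rewrite bracket_module_id ?cl0 //; apply: Z_bim.
Qed.

Lemma heps_bracket_eps x : ebr x (eps A) = 0.
Proof.
rewrite -(Hkappa_sectionK x) -Hkappa_eps heps_bracketE bracket_bim_eps.
exact: (linear_at0 (@Hkappa_linear k A)).
Qed.

Lemma heps_sq_inl u : (2 \in [pchar k])%N -> heps_sq (u, 0) = (hh_sq u, 0).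
Proof. by move=> k2; rewrite -!Hkappa_incl heps_sqE hh_incl_sq. Qed.

(** By the product formula for the square, Sq(v eps) = v^2 eps, since eps^2 =
    0, [v, eps] = 0 and Sq(eps) = eps. *)
Lemma heps_sq_char2 u v : (2 \in [pchar k])%N ->
  heps_sq (u, v) = (hh_sq u, hh_mul v v + hh_bracket u v).
Proof.
move=> k2; have [_ br_g _] := heps_gerstenhaber.
have lr := br_inl_inr br_g heps_bracket_inl (fun u => heps_bracket_eps _).
have -> : (u, v) = Hkappa (hh_incl u + hhbim_mul (hh_incl v) (bim_eps A)).
  by rewrite HkappaD Hkappa_incl Hkappa_incl_eps -pairE.
rewrite heps_sqE sq_add // !HkappaD -heps_bracketE Hkappa_incl Hkappa_incl_eps lr.
rewrite -hh_incl_sq // Hkappa_incl sq_mul // bracket_bim_eps.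
have EZ := module_id_Z A.
have E2 : hhbim_mul (bim_eps A) (bim_eps A) = 0 by rewrite mul_cl // cup_module_id_self cl0.
have Esq : hhbim_sq (bim_eps A) = bim_eps A.
  by rewrite sq_cl ?brace_module_id_self //; apply: par_char2.
have [ml mr] := mul_bilinear A.
rewrite E2 Esq !(linear_at0 (mr _)) (linear_at0 (ml _)) !add0r -hh_incl_mul Hkappa_incl_eps.
by rewrite [RHS](pairE (hh_sq u)) inrD addrA.
Qed.

(** On cochains of even degree, [a, a] = 2 a{a}. *)
Lemma heps_sq_half n x : (2 \notin [pchar k])%N -> (2 %| n)%Z -> deg n x ->
  heps_sq x = 2^-1 *: heps_bracket x x.
Proof.
move=> k2 n2; rewrite -(Hkappa_sectionK x); move: (Hkappa_section x) => y.
move=> /Hkappa_degree/deg_cl[a [aZ /of_degree_par an ->]].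
rewrite dvdz2 in n2; rewrite n2 in an; have aS := Z_bim aZ.
have saZ := sq_Z aZ an.
rewrite heps_sqE heps_bracketE sq_cl // br_cl // (bracket_odd aS aS an an) clD // HkappaD.
rewrite -mulr2n -scaler_nat scalerA mulVf ?scale1r //.
Qed.

End Uniqueness.

Theorem corollary4p74 (k : fieldType) (A : gradedAlgType k) :
  (* isomorphism of graded algebras *)
  [/\ linear (@Hkappa k A), bijective (@Hkappa k A),
      (forall p q x, hhbim_bidegree p q x <-> heps_bidegree p q (@Hkappa k A x)),
      Hkappa (hhbim_one A) = heps_one A
    & forall x y : HHbim A,
        Hkappa (hhbim_mul x y) = heps_mul (Hkappa x) (Hkappa y)] /\
  (* isomorphism of Gerstenhaber algebras *)
  [/\ gerstenhaber_algebra (heps_degree A) (heps_one A) (@heps_mul k A)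
        (@heps_bracket k A) (@heps_sq k A),
      forall x y : HHbim A,
        Hkappa (hhbim_bracket x y) = heps_bracket (Hkappa x) (Hkappa y)
    & forall x : HHbim A, Hkappa (hhbim_sq x) = heps_sq (Hkappa x)] /\
  (* (1) *)
  [/\ forall c1 c2 : HH A,
        heps_bracket (c1, 0) (c2, 0) = (hh_bracket c1 c2, 0),
      heps_bracket (eps A) (eps A) = 0 /\
      (forall c : HH A, heps_bracket (c, 0) (eps A) = 0),
      forall br : HHeps A -> HHeps A -> HHeps A,
        gerstenhaber_bracket (heps_degree A) (@heps_mul k A) br ->
        (forall c1 c2 : HH A, br (c1, 0) (c2, 0) = (hh_bracket c1 c2, 0)) ->
        br (eps A) (eps A) = 0 ->
        (forall c : HH A, br (c, 0) (eps A) = 0) ->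
        forall x y, br x y = heps_bracket x y,
      forall c1 c2 : HH A,
        heps_bracket (c1, 0) (0, c2) = (0, hh_bracket c1 c2)
    & forall c1 c2 : HH A, heps_bracket (0, c1) (0, c2) = 0] /\
  (* (2) *)
  ((2 \in [pchar k])%N ->
     (forall c : HH A, heps_sq (c, 0) = (hh_sq c, 0)) /\
     (forall c1 c2 : HH A,
        heps_sq (c1, c2) = (hh_sq c1, hh_mul c2 c2 + hh_bracket c1 c2))) /\
  ((2 \notin [pchar k])%N ->
     forall n (x : HHeps A), (2 %| n)%Z -> heps_degree A n x ->
       heps_sq x = 2^-1 *: heps_bracket x x).
Proof.
split; [|split; [|split; [|split]]].
- split; [exact: Hkappa_linear | exact: Hkappa_bij | exact: Hkappa_bidegree | |].
    exact: Hkappa_one.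
  exact: Hkappa_mul.
- split; first exact: heps_gerstenhaber.
    by move=> x y; rewrite heps_bracketE.
  by move=> x; rewrite heps_sqE.
- have [_ br_g _] := heps_gerstenhaber A.
  have inl := @heps_bracket_inl k A; have ee := heps_bracket_eps (eps A).
  have ce (c : HH A) := heps_bracket_eps (c, 0).
  split=> // [br g l e c x y||].
  + exact: (br_unique g br_g l inl e ee c ce).
  + exact: (br_inl_inr br_g inl ce).
  exact: (br_inr br_g inl ee ce).
- by move=> k2; split=> [c|c1 c2]; [exact: heps_sq_inl | exact: heps_sq_char2].
by move=> k2 n x; apply: heps_sq_half.
Qed.
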